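(* Let $K=\begin{pmatrix}k_{11}&k_{12}\\k_{21}&k_{22}\end{pmatrix}\in\mathrm{SL}(2,\mathbb R)$, and let $\lambda_n(K),\lambda_n(-K),\lambda_n(\gamma,K),\mu_n=\mu_n(K),\nu_n=\nu_n(K)$ be the $n$-th eigenvalues defined in the context. (a) If $k_{11}>0$ and $k_{12}\le0$, and $-\pi<\gamma<0$ or $0<\gamma<\pi$, then $\lambda_0(K)$ is simple, and $$\begin{aligned}\nu_0&\le\lambda_0(K)<\lambda_0(\gamma,K)<\lambda_0(-K)\le\{\mu_0,\nu_1\}\\&\le\lambda_1(-K)<\lambda_1(\gamma,K)<\lambda_1(K)\le\{\mu_1,\nu_2\}\\&\le\lambda_2(K)<\lambda_2(\gamma,K)<\lambda_2(-K)\le\{\mu_2,\nu_3\}\\&\le\lambda_3(-K)<\lambda_3(\gamma,K)<\lambda_3(K)\le\cdots.\end{aligned}$$ (b) If $k_{11}\le0$ and $k_{12}<0$, then for $-\pi<\gamma<0$ or $0<\gamma<\pi$, $$\begin{aligned}\lambda_0(K)&<\lambda_0(\gamma,K)<\lambda_0(-K)\le\{\mu_0,\nu_0\}\\&\le\lambda_1(-K)<\lambda_1(\gamma,K)<\lambda_1(K)\le\{\mu_1,\nu_1\}\\&\le\lambda_2(K)<\lambda_2(\gamma,K)<\lambda_2(-K)\le\{\mu_2,\nu_2\}\\&\le\lambda_3(-K)<\lambda_3(\gamma,K)<\lambda_3(K)\le\cdots.\end{aligned}$$ (c) For $0<\gamma_1<\gamma_2<\pi$, $$\lambda_0(\gamma_1,K)<\lambda_0(\gamma_2,K)<\lambda_1(\gamma_2,K)<\lambda_1(\gamma_1,K)<\lambda_2(\gamma_1,K)<\lambda_2(\gamma_2,K)<\cdots.$$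 (d) If $K$ satisfies the hypotheses of neither (a) nor (b), then $-K$ satisfies the hypotheses of (a) or of (b).
   Context: Let $J=(a,b)$ with $-\infty<a<b<\infty$, and let $p,q,r,s$ be real-valued functions on $J$ with $1/p,q,r,s\in L^1(J,\mathbb R)$, $p>0$ and $r>0$ a.e. on $J$. Put $y^{[1]}=p(y'+sy)$ and $Y=(y,y^{[1]})^T$. The equation is $-(y^{[1]})'+sy^{[1]}+qy=\lambda ry$ on $J$, with solutions $y$ such that $y,y^{[1]}$ are absolutely continuous on $[a,b]$. For each of the self-adjoint boundary conditions below, the eigenvalues (values $\lambda$ with a nontrivial solution satisfying the condition) are real and, counted with multiplicity, are ordered as a non-decreasing sequence indexed by $n\in\mathbb N_0=\{0,1,2,\dots\}$ tending to $+\infty$. Denote the $n$-th eigenvalue by: $\lambda_n(K)$ for $Y(b)=KY(a)$; $\lambda_n(\gamma,K)$ for $Y(b)=e^{i\gamma}KY(a)$, where $-\pi<\gamma<0$ or $0<\gamma<\pi$; $\mu_n=\mu_n(K)$ for $y(a)=0,\ k_{22}y(b)-k_{12}y^{[1]}(b)=0$; $\nu_n=\nu_n(K)$ for $y^{[1]}(a)=0,\ k_{21}y(b)-k_{11}y^{[1]}(b)=0$. An inequality involving $\{x,y\}$ means that it holds for both $x$ and $y$ (no order between $x$ and $y$ is asserted). The displayed chains continue with the evident period-two pattern in $n$.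
   Formalization: Part (c) is stated only for K satisfying the hypotheses of (a) or (b). For any other K it is false: −K satisfies them and λ_n(γ,K)=λ_n(π−γ,−K), so the inequalities between γ₁ and γ₂ reverse, e.g. K=−I, p=r=1, q=s=0 on (0,1): λ_0(γ,K)=(π−γ)². *)

(* Defs.v *)
From HB Require Import structures.
From mathcomp Require Import all_boot all_order all_algebra.
From mathcomp Require Import all_classical all_reals all_analysis.
From mathcomp Require Import complex.

Set Implicit Arguments.
Unset Strict Implicit.
Unset Printing Implicit Defensive.

Import Order.TTheory GRing.Theory Num.Theory.
Import numFieldNormedType.Exports.

Local Open Scope classical_set_scope.
Local Open Scope ring_scope.
Local Open Scope complex_scope.

Section AbsoluteContinuity.
Context {R : realType}.

Definition abs_continuous (a b : R) (f : R -> R) : Prop :=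
  forall e : R, 0 < e -> exists2 d : R, 0 < d &
    forall (n : nat) (u v : 'I_n -> R),
      (forall i, a <= u i /\ u i <= v i /\ v i <= b) ->
      trivIset [set: 'I_n] (fun i => `]u i, v i[%classic) ->
      \sum_(i < n) (v i - u i) < d ->
      \sum_(i < n) `|f (v i) - f (u i)| < e.

(* R[i] carries no structure of normed module over R, so the calculus of
   complex-valued functions of a real variable is done componentwise. *)
Definition cabs_continuous (a b : R) (f : R -> R[i]) : Prop :=
  abs_continuous a b (fun t => complex.Re (f t)) /\
  abs_continuous a b (fun t => complex.Im (f t)).

Definition cderivable (f : R -> R[i]) (t : R) : Prop :=
  derivable (fun u => complex.Re (f u)) t 1 /\
  derivable (fun u => complex.Im (f u)) t 1.

Definition cderive (f : R -> R[i]) (t : R) : R[i] :=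
  derive1 (fun u => complex.Re (f u)) t +i* derive1 (fun u => complex.Im (f u)) t.

End AbsoluteContinuity.

Section SturmLiouville.
Context {R : realType}.
Local Notation mu := (@lebesgue_measure R).

Definition SL_coefficients (a b : R) (p q r s : R -> R) : Prop :=
  [/\ mu.-integrable `]a, b[ (fun t => ((p t)^-1)%:E),
      mu.-integrable `]a, b[ (fun t => (q t)%:E),
      mu.-integrable `]a, b[ (fun t => (r t)%:E) &
      mu.-integrable `]a, b[ (fun t => (s t)%:E)] /\
  {ae mu, forall t, t \in `]a, b[ -> 0 < p t /\ 0 < r t}.

(* The quasi-derivative y^[1] = p (y' + s y) is only defined almost everywhere;
   [y1] is its absolutely continuous representative on [a, b], so that its
   values at the end points make sense. *)
Definition SL_solution (a b : R) (p q r s : R -> R) (l : R[i])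
    (y y1 : R -> R[i]) : Prop :=
  [/\ cabs_continuous a b y, cabs_continuous a b y1 &
      {ae mu, forall t, t \in `]a, b[ ->
        [/\ cderivable y t, cderivable y1 t,
            y1 t = (p t)%:C * (cderive y t + (s t)%:C * y t) &
            - cderive y1 t + (s t)%:C * y1 t + (q t)%:C * y t
              = l * (r t)%:C * y t]}].

Definition qvec (y y1 : R -> R[i]) (t : R) : 'cV[R[i]]_2 :=
  \col_(i < 2) (if i == 0 then y t else y1 t).

(* A boundary condition relates Y(a) and Y(b), in this order. *)
Definition boundary_condition : Type := 'cV[R[i]]_2 -> 'cV[R[i]]_2 -> Prop.

Definition bc_real (K : 'M[R]_2) : boundary_condition :=
  fun Ya Yb => Yb = map_mx (real_complex R) K *m Ya.

Definition bc_complex (g : R) (K : 'M[R]_2) : boundary_condition :=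
  fun Ya Yb =>
    Yb = (cos g +i* sin g) *: (map_mx (real_complex R) K *m Ya).

Definition bc_mu (K : 'M[R]_2) : boundary_condition :=
  fun Ya Yb =>
    Ya 0 0 = 0 /\ (K 1 1)%:C * Yb 0 0 - (K 0 1)%:C * Yb 1 0 = 0.

Definition bc_nu (K : 'M[R]_2) : boundary_condition :=
  fun Ya Yb =>
    Ya 1 0 = 0 /\ (K 1 0)%:C * Yb 0 0 - (K 0 0)%:C * Yb 1 0 = 0.

Definition in_eigenspace (a b : R) (p q r s : R -> R) (B : boundary_condition)
    (l : R[i]) (y : R -> R[i]) : Prop :=
  exists y1 : R -> R[i],
    SL_solution a b p q r s l y y1 /\ B (qvec y y1 a) (qvec y y1 b).

Definition is_eigenvalue (a b : R) (p q r s : R -> R) (B : boundary_condition)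
    (l : R[i]) : Prop :=
  exists2 y : R -> R[i], in_eigenspace a b p q r s B l y &
    exists2 t, t \in `[a, b] & y t != 0.

(* The dimension of the eigenspace, whose elements are regarded as functions
   on [a, b]: their values outside of [a, b] are irrelevant. *)
Definition has_multiplicity (a b : R) (p q r s : R -> R)
    (B : boundary_condition) (l : R[i]) (m : nat) : Prop :=
  exists e : 'I_m -> R -> R[i],
    [/\ forall i, in_eigenspace a b p q r s B l (e i),
        forall c : 'I_m -> R[i],
          (forall t, t \in `[a, b] -> \sum_(i < m) c i * e i t = 0) ->
          forall i, c i = 0 &
        forall y, in_eigenspace a b p q r s B l y ->
          exists c : 'I_m -> R[i],
            forall t, t \in `[a, b] -> y t = \sum_(i < m) c i * e i t].

(* [lam n] is the n-th eigenvalue: all eigenvalues are real and [lam] lists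
   them in non-decreasing order, each one as often as its multiplicity. *)
Definition eigenvalue_sequence (a b : R) (p q r s : R -> R)
    (B : boundary_condition) (lam : nat -> R) : Prop :=
  [/\ {homo lam : m n / (m <= n)%N >-> m <= n},
      lam n @[n --> \oo] --> +oo,
      forall l : R[i], is_eigenvalue a b p q r s B l ->
        exists n, l = (lam n)%:C &
      forall n, exists2 m : nat,
        has_multiplicity a b p q r s B (lam n)%:C m &
        ([set k | lam k = lam n] #= `I_m)%card].

End SturmLiouville.

Definition case_a {R : realType} (K : 'M[R]_2) : Prop :=
  0 < K 0 0 /\ K 0 1 <= 0.

Definition case_b {R : realType} (K : 'M[R]_2) : Prop :=
  K 0 0 <= 0 /\ K 0 1 < 0.

(* Main.v *)
Require Import Defs.
From HB Require Import structures.
From mathcomp Require Import all_boot all_order all_algebra.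
From mathcomp Require Import all_classical all_reals all_analysis.
From mathcomp Require Import complex measurable_realfun.
From mathcomp Require Import ring lra.

Set Implicit Arguments.
Unset Strict Implicit.
Unset Printing Implicit Defensive.

Import Order.TTheory GRing.Theory Num.Theory.
Import numFieldNormedType.Exports.

Local Open Scope classical_set_scope.
Local Open Scope ring_scope.
Local Open Scope complex_scope.

(** With [S] a primitive of [s], the functions [u = e^S y] and
    [v = e^-S y^[1]] satisfy [u' = P v], [v' = (Q - l W) u] with [P, W > 0], so
    that [Y(b) = M(l) Y(a)] for a matrix [M(l)].  Put [N = K^-1 M]; then
    [det N = 1], the coupled conditions read [tr N(l) = 2 cos gamma], and the
    [mu_n], [nu_n] are the zeros of [N12] and [N21].  Variation of the parameter
    gives [N' = N G], where [G = [[B, C], [- A, - B]]] is built from a positive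
    definite Gram matrix: [N] rotates in a fixed direction.  Hence [tr N] is
    strictly monotone wherever [|tr N| < 2], the zeros of [N12] and [N21] are
    simple, lie where [|tr N| >= 2], and are crossed in a direction prescribed
    by the sign of [tr N], and [tr N = 2] or [- 2] is met either transversally
    or, when [N = 1] or [N = -1], tangentially with a double eigenvalue.
    So [tr N] sweeps back and forth across the interval from [- 2] to [2], and
    between two sweeps there is exactly one zero of [N12] and one of [N21].
    The numbering is fixed by the signs of the entries of [N] as [l] tends to
    [- oo], which are found by a gauge making the system positive. *)

(** * Absolutely continuous functions *)

(** Integrable coefficients give derivatives almost everywhere only, so the calculus rests on one
    fact: an absolutely continuous function whose derivative is nonnegative almost everywhere does
    not decrease. Uniqueness and all norm estimates follow from it by algebra. The trace is monotone
    where |tr N| < 2 because (tr N)' = C n21 + B (n11 - n22) - A n12 pairs the definite form of G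
    with a form attached to N, whose discriminant (n11 - n22)^2 + 4 n12 n21 equals (tr N)^2 - 4. The
    sweeps never stop because the eigenvalue sequences are given and unbounded, and the terms for K
    and - K are points where tr N is 2 and - 2. The delicate point is the numbering, since double
    eigenvalues count twice: an induction carries the exact number of terms of every sequence up to
    the end of each sweep. Replacing N by - N after each sweep makes all sweeps go downwards. *)

Section AC.
Context {R : realType}.
Local Notation mu := (@lebesgue_measure R).
Implicit Types (a b x y t : R) (F G f g : R -> R).

Lemma ac_sub a b x y F : abs_continuous a b F -> a <= x -> y <= b ->
  abs_continuous x y F.
Proof.
move=> acF ax yb e e0; have [d d0 dP] := acF e e0; exists d => // n u v uv.
apply: dP => i; have [xu [uvi vy]] := uv i.
by split; [exact: le_trans xu|split=> //; exact: le_trans yb].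
Qed.

(** Non-overlapping intervals are listed from right to left, so that a piece can be added at the
    head when [x] moves to the right. *)
Fixpoint ordered_pieces a x (s : seq (R * R)) : bool :=
  if s is p :: s' then [&& p.2 <= x, p.1 <= p.2 & ordered_pieces a p.1 s']
  else a <= x.

Lemma ordered_pieces_nth a x s : ordered_pieces a x s ->
  forall i, (i < size s)%N ->
    [/\ a <= (nth (0, 0) s i).1, (nth (0, 0) s i).1 <= (nth (0, 0) s i).2 &
        (nth (0, 0) s i).2 <= x].
Proof.
have lea y s' : ordered_pieces a y s' -> a <= y.
  elim: s' y => [//|p s' IH y] /= /and3P[py pp /IH ap].
  by rewrite (le_trans ap)// (le_trans pp).
elim: s x => [//|p s IH x] /= /and3P[px pp ops] [|i] /=.
  by move=> _; split=> //; exact: lea ops.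
rewrite ltnS => /(IH _ ops)[h1 h2 h3]; split=> //.
by rewrite (le_trans h3)// (le_trans pp).
Qed.

Lemma ordered_pieces_triv a x s : ordered_pieces a x s ->
  forall i j, (i < j < size s)%N -> (nth (0, 0) s j).2 <= (nth (0, 0) s i).1.
Proof.
elim: s x => [|p s IH] x /=; first by move=> _ i j; rewrite ltn0 andbF.
move=> /and3P[px pp ops] [|i] [|j] //=; rewrite ltnS.
  by move=> /(ordered_pieces_nth ops)[].
rewrite ltnS; exact: IH ops i j.
Qed.

Lemma ac_pieces a b F (e : R) : abs_continuous a b F -> 0 < e ->
  exists2 d, 0 < d & forall s, ordered_pieces a b s ->
    \sum_(p <- s) (p.2 - p.1) < d -> \sum_(p <- s) `|F p.2 - F p.1| < e.
Proof.
move=> acF e0; have [d d0 dP] := acF e e0; exists d => // s ops.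
rewrite !(big_nth (0, 0)) !big_mkord => hd.
apply: (dP (size s) (fun i : 'I__ => (nth (0, 0) s i).1)
  (fun i : 'I__ => (nth (0, 0) s i).2)) => //.
  by move=> i; have [] := ordered_pieces_nth ops (ltn_ord i).
move=> i j _ _ [t [/=]]; rewrite !in_itv/= => /andP[it ti] /andP[jt tj].
apply/val_inj => /=.
have [ij|ji|//] := ltngtP i j.
  have /(ordered_pieces_triv ops) : (i < j < size s)%N by rewrite ij /=.
  by rewrite leNgt (lt_trans it tj).
have /(ordered_pieces_triv ops) : (j < i < size s)%N by rewrite ji /=.
by rewrite leNgt (lt_trans jt ti).
Qed.

(* A covering argument in the style of Cousin's lemma: near a point where the
   derivative is nonnegative the increments of [F] are almost nonnegative, and
   the remaining points lie in an open set of small measure, on which absolute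
   continuity makes the total variation small. *)
Lemma ac_le_endpoints a b F : a <= b -> abs_continuous a b F ->
  {ae mu, forall t, t \in `]a, b[ -> exists2 d, 0 <= d & is_derive t 1 F d} ->
  F a <= F b.
Proof.
move=> ab acF [Z0 [mZ0 Z00 subZ0]].
(* The loss [e * (b - a)] is due to the points with a nonnegative derivative, the loss [e] to the
   exceptional open set. *)
suff key e : 0 < e -> - (e * (b - a)) - e <= F b - F a.
  rewrite -subr_ge0; apply/ler_addgt0Pr => e e0.
  have h : 0 < (b - a) + 1 by lra.
  have /key : 0 < e / ((b - a) + 1) by rewrite divr_gt0.
  set e' := e / _.
  have -> : e = e' * ((b - a) + 1) by rewrite /e' mulfVK// gt_eqF.
  by nra.
move=> e0.
have [d d0 dP] := ac_pieces acF e0.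
(* The end points join the exceptional set, as the hypothesis is silent about them. *)
pose Z := Z0 `|` [set a] `|` [set b].
have mZ : measurable Z.
  by apply: measurableU => //; apply: measurableU.
have Zmu0 : mu Z = 0%E.
  rewrite null_set_setU//; first exact: measurableU.
    by rewrite null_set_setU//; exact: lebesgue_measure_set1.
  exact: lebesgue_measure_set1.
have [U [oU ZU Ud]] : exists U : set R, [/\ open U, Z `<=` U & (mu U < d%:E)%E].
  have [|U [oU ZU Ud]] := @lebesgue_regularity_outer R Z d mZ _ d0.
    by rewrite (_ : _ Z = 0%E) ?ltry.
  exists U; split=> //.
  have mU : measurable U by exact: open_measurable.
  have -> : U = U `\` Z `|` Z by rewrite setUC setDUK.
  by rewrite measureU0//; exact: measurableD.
have mU : measurable U by exact: open_measurable.
(* Up to the variation of [F] over the pieces, [F] falls from [a] to [x] by at most [e * (x - a)];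
   the total length of the pieces is controlled by the part of [U] already met. *)
pose good x := exists s, [/\ ordered_pieces a x s,
  - (e * (x - a)) - \sum_(p <- s) `|F p.2 - F p.1| <= F x - F a &
  ((\sum_(p <- s) (p.2 - p.1))%:E <= mu (U `&` `]a, x]))%E].
have good_small x y : a <= x -> x <= y ->
    - (e * (y - x)) <= F y - F x -> good x -> good y.
  move=> ax xy Fxy [s [ops Fs ms]]; exists s; split.
  - case: s ops {Fs ms} => [|p s] /=; first by move=> ?; exact: le_trans xy.
    by move=> /and3P[h -> ->]; rewrite (le_trans h).
  - by move: Fs Fxy; lra.
  - apply: (le_trans ms); apply: le_measure; rewrite ?inE//.
    + exact: measurableI.
    + exact: measurableI.
    + by apply: setIS; apply: subset_itvl; rewrite bnd_simp.
have good_U x y : a <= x -> x <= y -> `]x, y] `<=` U -> good x -> good y.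
  move=> ax xy xyU [s [ops Fs ms]]; exists ((x, y) :: s); split.
  - by rewrite /= lexx xy ops.
  - rewrite big_cons/=; have := ler_norm (- (F y - F x)); rewrite normrN.
    have : 0 <= e * (y - x) by rewrite mulr_ge0 ?subr_ge0// ltW.
    by move: Fs; lra.
  - rewrite big_cons /= EFinD.
    have -> : U `&` `]a, y] = `]x, y] `|` (U `&` `]a, x]).
      apply/seteqP; split => t /=; rewrite !in_itv/=.
        by move=> [Ut /andP[at_ ty]]; case: (ltP x t) => xt;
          [left; rewrite ty|right; rewrite at_].
      move=> [/andP[xt ty]|[Ut /andP[at_ tx]]]; split=> //.
      - by apply: xyU; rewrite /= in_itv/= xt.
      - by rewrite ty (le_lt_trans ax).
      - by rewrite at_ (le_trans tx).
    rewrite measureU//=; last 2 first.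
    - exact: measurableI.
    - apply/seteqP; split => t //= [] /=; rewrite !in_itv/=.
      by move=> /andP[xt _] [_ /andP[_ tx]]; move: xt; rewrite ltNge tx.
    rewrite leeD//; rewrite lebesgue_measure_itv/= lte_fin.
    by case: ltP => // yx; rewrite lee_fin subr_le0.
have good_a : good a.
  by exists [::]; split=> //=; rewrite big_nil ?subrr ?mulr0 ?subr0 ?oppr0.
(* Goodness passes across every point: by a new piece if [t] lies in [U], otherwise by the
   difference quotients on both sides of [t], which are at least [- e]. *)
have local t : a <= t <= b -> exists2 r, 0 < r & forall x y, a <= x ->
    t - r < x -> x <= t -> t <= y -> y < t + r -> y <= b -> good x -> good y.
  move=> /andP[at_ tb].
  have [Ut|nUt] := pselect (U t).
    have [r /= r0 rU] := (@nbhs_ballP _ _ t U).1 (open_nbhs_nbhs (conj oU Ut)).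
    exists r => // x y ax trx xt ty ytr yb; apply: good_U => //.
      exact: le_trans ty.
    move=> z /=; rewrite in_itv/= => /andP[xz zy]; apply: rU.
    by rewrite /ball/= ltr_norml; move: xz zy trx ytr; lra.
  have nZ : ~ Z t by move=> /ZU.
  have tab : t \in `]a, b[.
    rewrite in_itv/=; apply/andP; split.
      rewrite lt_neqAle at_ andbT; apply/eqP => ta; apply: nZ.
      by left; right; rewrite /= ta.
    rewrite lt_neqAle tb andbT; apply/eqP => tb'; apply: nZ.
    by right; rewrite /= tb'.
  have [D D0 Fd] : exists2 D, 0 <= D & is_derive t 1 F D.
    by apply: contrapT => h; apply: nZ; left; left; apply: subZ0 => /= /(_ tab).
  have dF : derivable F t 1 by exact: ex_derive.
  have cF : h^-1 *: (F (h *: 1 + t) - F t) @[h --> 0^'] --> D.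
    by rewrite -(@derive_val _ _ _ _ _ _ _ Fd); exact: dF.
  move/cvgrPdist_le: cF => /(_ e e0); rewrite near_withinE => -[r /= r0 rP].
  have incr h : `|h| < r -> h != 0 -> - e <= h^-1 * (F (t + h) - F t).
    move=> hr h0; have := rP h; rewrite /ball/= sub0r normrN => /(_ hr h0).
    rewrite /GRing.scale/= mulr1 (addrC h) ler_norml => /andP[_].
    by lra.
  exists r => // x y ax trx xt ty ytr yb gx.
  have gt : good t.
    apply: (good_small x) => //.
    have [->|xt'] := eqVneq x t; first by rewrite !subrr mulr0 oppr0.
    have xt0 : x - t < 0 by rewrite subr_lt0 lt_neqAle xt' xt.
    have := incr (x - t); rewrite ltr0_norm// subr_eq0 xt'.
    rewrite subrKC => /(_ _ isT) h.
    have {}h : - e <= (x - t)^-1 * (F x - F t) by apply: h; move: trx; lra.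
    have := ler_wnM2l (ltW xt0) h; rewrite mulrA divff ?lt_eqF// mul1r.
    by lra.
  apply: (good_small t) => //.
  have [->|yt'] := eqVneq y t; first by rewrite !subrr mulr0 oppr0.
  have yt0 : 0 < y - t by rewrite subr_gt0 lt_neqAle eq_sym yt' ty.
  have := incr (y - t); rewrite gtr0_norm// subr_eq0 yt'.
  rewrite subrKC => /(_ _ isT) h.
  have {}h : - e <= (y - t)^-1 * (F y - F t) by apply: h; move: ytr; lra.
  have := ler_wpM2l (ltW yt0) h; rewrite mulrA divff ?gt_eqF// mul1r.
  by lra.
pose S := [set x | a <= x <= b /\ good x].
have Sa : S a by split=> //; rewrite lexx.
have hS : has_sup S by split; [exists a|exists b => x [/andP[]]].
have ubS z : S z -> z <= sup S by move=> Sz; apply: (sup_upper_bound hS).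
have supab : a <= sup S <= b.
  apply/andP; split; first exact: ubS.
  by apply: ge_sup; [exists a|move=> x [/andP[]]].
have [r r0 rP] := local _ supab.
have [x [/andP[ax xb] gx] rx] := sup_adherent r0 hS.
have xs : x <= sup S by apply: ubS; split=> //; rewrite ax.
have [/andP[as_ sb]] := supab.
have gb : good b.
  have [bs|bs] := leP b (sup S).
    by apply: (rP x b) => //; move: bs r0; lra.
  exfalso; pose y := Num.min b (sup S + r / 2).
  have gy : good y.
    apply: (rP x y) => //.
    - by rewrite /y le_min sb; move: r0; lra.
    - by rewrite /y gt_min; apply/orP; right; move: r0; lra.
    - by rewrite /y ge_min lexx.
  have : sup S < y by rewrite /y lt_min bs; move: r0; lra.
  apply/negP; rewrite -leNgt; apply: ubS; split=> //.
  rewrite /y ge_min lexx andbT le_min (le_trans ax xb) /=.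
  by move: r0 as_; lra.
have [s [ops Fs ms]] := gb.
have := dP s ops; rewrite -lte_fin => /(_ _) h.
have {}h : \sum_(p <- s) `|F p.2 - F p.1| < e.
  apply: h; apply: le_lt_trans Ud; apply: (le_trans ms).
  by apply: le_measure; rewrite ?inE//; exact: measurableI.
by move: Fs h; lra.
Qed.

End AC.

(** * Functions with a prescribed derivative almost everywhere *)

Section AE.
Context {R : realType}.
Local Notation mu := (@lebesgue_measure R).
Implicit Types (a b x y t : R) (F G f g : R -> R).

Let ae_filter : Filter (almost_everywhere mu) := ae_filter_ringOfSetsType mu.

Definition ae_itv a b (P : R -> Prop) : Prop :=
  {ae mu, forall t, t \in `]a, b[ -> P t}.

Lemma ae_itv0 a b (P : R -> Prop) : (forall t, t \in `]a, b[ -> P t) ->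
  ae_itv a b P.
Proof. by move=> h; apply: aeW. Qed.

Lemma ae_itv1 a b (P Q : R -> Prop) : (forall t, t \in `]a, b[ -> P t -> Q t) ->
  ae_itv a b P -> ae_itv a b Q.
Proof.
by rewrite /ae_itv => PQ; apply: (@filterS _ _ ae_filter) => t Pt tab;
  exact: PQ tab (Pt tab).
Qed.

Lemma ae_itv2 a b (P Q S : R -> Prop) :
  (forall t, t \in `]a, b[ -> P t -> Q t -> S t) ->
  ae_itv a b P -> ae_itv a b Q -> ae_itv a b S.
Proof.
rewrite /ae_itv => PQS; apply: (@filterS2 _ _ ae_filter) => t Pt Qt tab.
exact: PQS tab (Pt tab) (Qt tab).
Qed.

Lemma ae_itv3 a b (P Q S T : R -> Prop) :
  (forall t, t \in `]a, b[ -> P t -> Q t -> S t -> T t) ->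
  ae_itv a b P -> ae_itv a b Q -> ae_itv a b S -> ae_itv a b T.
Proof.
move=> PQST hP hQ; apply: (@ae_itv2 _ _ (fun t => P t /\ Q t)).
  by move=> t tab [Pt Qt]; exact: PQST.
exact: ae_itv2 hP hQ.
Qed.

Lemma ae_itv_sub a b x y (P : R -> Prop) : a <= x -> y <= b ->
  ae_itv a b P -> ae_itv x y P.
Proof.
rewrite /ae_itv => ax yb; apply: (@filterS _ _ ae_filter) => t Pt;
  rewrite in_itv/= => /andP[xt ty].
by apply: Pt; rewrite in_itv/= (le_lt_trans ax xt) (lt_le_trans ty yb).
Qed.

(** The one epsilon-delta argument behind sums, products and compositions, each of which satisfies
    such an estimate of increments. *)
Lemma ac_combine a b F G H (C : R) : 0 < C ->
  (forall x y, a <= x -> x <= y -> y <= b ->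
    `|H y - H x| <= C * (`|F y - F x| + `|G y - G x|)) ->
  abs_continuous a b F -> abs_continuous a b G -> abs_continuous a b H.
Proof.
move=> C0 HFG acF acG e e0.
have e'0 : 0 < e / C / 2 by rewrite !divr_gt0.
have [d1 d10 d1P] := acF _ e'0; have [d2 d20 d2P] := acG _ e'0.
exists (Num.min d1 d2); first by rewrite lt_min d10.
move=> n u v uv tr; rewrite lt_min => /andP[/(d1P n u v uv tr) h1].
move=> /(d2P n u v uv tr) h2.
have -> : e = C * (e / C / 2 + e / C / 2).
  by rewrite -splitr mulrCA divff ?mulr1// gt_eqF.
apply: (@le_lt_trans _ _ (C * (\sum_(i < n) `|F (v i) - F (u i)|
   + \sum_(i < n) `|G (v i) - G (u i)|))).
  rewrite -big_split mulr_sumr /=; apply: ler_sum => i _.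
  by have [? [? ?]] := uv i; exact: HFG.
by rewrite ltr_pM2l// ltrD.
Qed.

Lemma ac_cst a b (c : R) : abs_continuous a b (fun=> c).
Proof.
move=> e e0; exists 1 => // n u v _ _ _.
by rewrite big1// => i _; rewrite subrr normr0.
Qed.

Lemma ac_continuous a b F : abs_continuous a b F ->
  {within `[a, b], continuous F}.
Proof.
move=> acF; apply/subspace_continuousP => x /=;
  rewrite in_itv/= => /andP[ax xb].
apply/cvgrPdist_lt => e e0; have [d d0 dP] := ac_pieces acF e0.
rewrite near_withinE; exists d => //= y /= xyd;
  rewrite in_itv/= => /andP[ay yb].
move: xyd; have [xy|yx] := leP x y.
  move=> xyd; have := dP [:: (x, y)]; rewrite /= yb xy ax => /(_ isT).
  rewrite !big_cons !big_nil /= !addr0 distrC; apply.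
  by move: xyd; rewrite ltr_norml; lra.
move=> xyd; have := dP [:: (y, x)]; rewrite /= xb ay ltW// => /(_ isT).
rewrite !big_cons !big_nil /= !addr0; apply.
by move: xyd; rewrite ltr_norml; lra.
Qed.

Lemma ac_bounded a b F : a <= b -> abs_continuous a b F ->
  exists2 C : R, 0 < C & forall t, t \in `[a, b] -> `|F t| <= C.
Proof.
move=> ab /ac_continuous cF.
have [c1 _ h1] := EVT_max ab cF.
have [c2 _ h2] := EVT_min ab cF.
exists (`|F c1| + `|F c2| + 1).
  by have := normr_ge0 (F c1); have := normr_ge0 (F c2); lra.
move=> t tab; have := h1 t tab; have := h2 t tab.
have := ler_norm (F c1); have := ler_norm (- F c2); rewrite normrN.
by have := normr_ge0 (F c1); have := normr_ge0 (F c2); rewrite ler_norml; lra.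
Qed.

Lemma acD a b F G : abs_continuous a b F -> abs_continuous a b G ->
  abs_continuous a b (fun t => F t + G t).
Proof.
apply: (@ac_combine _ _ _ _ _ 1) => // x y _ _ _; rewrite mul1r.
by rewrite (le_trans _ (ler_normD _ _))// opprD addrACA.
Qed.

Lemma acM a b F G : a <= b -> abs_continuous a b F -> abs_continuous a b G ->
  abs_continuous a b (fun t => F t * G t).
Proof.
move=> ab acF acG.
have [C C0 CP] := ac_bounded ab acF; have [D D0 DP] := ac_bounded ab acG.
apply: (ac_combine (C := C + D) _ _ acF acG); first exact: addr_gt0.
move=> x y ax xy yb.
have -> : F y * G y - F x * G x = (F y - F x) * G y + F x * (G y - G x) by ring.
rewrite (le_trans (ler_normD _ _))// !normrM.
have Fx : `|F x| <= C by apply: CP; rewrite in_itv/= ax (le_trans xy).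
have Gy : `|G y| <= D by apply: DP; rewrite in_itv/= yb (le_trans ax).
have := normr_ge0 (F y - F x); have := normr_ge0 (G y - G x).
by move: (normr_ge0 (F x)) (normr_ge0 (G y)); nra.
Qed.

(** [F] stays in a compact interval [[- C, C]], on which the mean value theorem makes [h]
    Lipschitz. *)
Lemma ac_comp a b F (h h' : R -> R) : a <= b -> abs_continuous a b F ->
  (forall x, is_derive x 1 h (h' x)) -> continuous h' ->
  abs_continuous a b (fun t => h (F t)).
Proof.
move=> ab acF hh' ch'.
have [C C0 CP] := ac_bounded ab acF.
have NCC : - C <= C by lra.
have ch'C : {within `[- C, C], continuous h'} by exact: continuous_subspaceT.
have [M M0 MP] : exists2 M, 0 < M & forall t, t \in `[- C, C] -> `|h' t| <= M.
  have [c1 _ h1] := EVT_max NCC ch'C.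
  have [c2 _ h2] := EVT_min NCC ch'C.
  exists (`|h' c1| + `|h' c2| + 1).
    by have := normr_ge0 (h' c1); have := normr_ge0 (h' c2); lra.
  move=> t tab; have := h1 t tab; have := h2 t tab.
  have := ler_norm (h' c1); have := ler_norm (- h' c2); rewrite normrN.
  by have := normr_ge0 (h' c1); have := normr_ge0 (h' c2); rewrite ler_norml;
    lra.
have lip u v : u <= v -> - C <= u -> v <= C -> `|h v - h u| <= M * `|v - u|.
  move=> uv Cu vC.
  have [w wuv ->] : exists2 w, w \in `[u, v] & h v - h u = h' w * (v - u).
    apply: (@MVT_segment _ h h') => //.
    apply: derivable_within_continuous => x ?.
    by apply: ex_derive; exact: hh'.
  rewrite normrM ler_wpM2r//; apply: MP.
  move: wuv; rewrite !in_itv/= => /andP[uw wv].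
  by rewrite (le_trans Cu)//= (le_trans wv).
apply: (ac_combine (C := M) M0 _ acF acF) => x y ax xy yb.
have bx : - C <= F x <= C.
  by rewrite -ler_norml; apply: CP; rewrite in_itv/= ax (le_trans xy).
have by_ : - C <= F y <= C.
  by rewrite -ler_norml; apply: CP; rewrite in_itv/= yb (le_trans ax).
have [Fxy|Fyx] := leP (F x) (F y).
  apply: (le_trans (lip _ _ _ _ _)) => //; [lra|lra|].
  by rewrite ler_wpM2l ?(ltW M0)// lerDl.
rewrite distrC (distrC (F y)); apply: (le_trans (lip _ _ _ _ _));
  [lra|lra|lra|].
by rewrite ler_wpM2l ?(ltW M0)// lerDl.
Qed.

(** Takes the place of an indefinite Lebesgue integral: [f] determines the increments of [F]
    ([primitive_unique]), and no integral has to be manipulated. *)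
Definition primitive a b f F : Prop :=
  abs_continuous a b F /\ ae_itv a b (fun t => is_derive t 1 F (f t)).

Lemma primitive_sub a b x y f F : a <= x -> y <= b ->
  primitive a b f F -> primitive x y f F.
Proof.
by move=> ax yb [acF dF]; split; [exact: ac_sub ax yb|exact: ae_itv_sub dF].
Qed.

Lemma primitive_ae a b f g F : ae_itv a b (fun t => f t = g t) ->
  primitive a b f F -> primitive a b g F.
Proof.
by move=> fg [acF dF]; split=> //; apply: ae_itv2 fg dF => t _ ->.
Qed.

Lemma primitive_ext a b f g F : f =1 g ->
  primitive a b f F -> primitive a b g F.
Proof. by move=> /funext ->. Qed.

Lemma primitive_cst a b (c : R) : primitive a b (fun=> 0) (fun=> c).
Proof.
by split; [exact: ac_cst|apply: ae_itv0 => t _; exact: is_derive_cst].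
Qed.

Lemma primitiveD a b f g F G : primitive a b f F -> primitive a b g G ->
  primitive a b (fun t => f t + g t) (fun t => F t + G t).
Proof.
by move=> [acF dF] [acG dG]; split; [exact: acD|apply: ae_itv2 dF dG => t _ *;
  exact: is_deriveD].
Qed.

Lemma primitiveM a b f g F G : a <= b -> primitive a b f F ->
  primitive a b g G ->
  primitive a b (fun t => F t * g t + f t * G t) (fun t => F t * G t).
Proof.
move=> ab [acF dF] [acG dG]; split; first exact: acM.
apply: ae_itv2 dF dG => t _ dF dG.
by rewrite (mulrC (f t)); exact: is_deriveM.
Qed.

Lemma primitive_comp a b f F (h h' : R -> R) : a <= b ->
  (forall x, is_derive x 1 h (h' x)) -> continuous h' ->
  primitive a b f F ->
  primitive a b (fun t => h' (F t) * f t) (fun t => h (F t)).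
Proof.
move=> ab hh' ch' [acF dF]; split; first exact: ac_comp.
by apply: ae_itv1 dF => t _ dF; exact: (@is_derive1_comp _ h F).
Qed.

Lemma primitiveZ a b (c : R) f F : a <= b -> primitive a b f F ->
  primitive a b (fun t => c * f t) (fun t => c * F t).
Proof.
move=> ab /(primitiveM ab (primitive_cst a b c)).
by apply: primitive_ext => t; rewrite mul0r addr0.
Qed.

Lemma primitiveN a b f F : a <= b -> primitive a b f F ->
  primitive a b (fun t => - f t) (fun t => - F t).
Proof.
move=> ab /(primitiveZ (-1) ab); rewrite (_ : (fun t => -1 * F t) = \- F).
  by apply: primitive_ext => t; rewrite mulN1r.
by apply/funext => t; rewrite mulN1r.
Qed.

Lemma primitiveB a b f g F G : a <= b -> primitive a b f F ->
  primitive a b g G ->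
  primitive a b (fun t => f t - g t) (fun t => F t - G t).
Proof. by move=> ab pf pg; apply: primitiveD => //; exact: primitiveN. Qed.

Lemma primitive_expR a b f F : a <= b -> primitive a b f F ->
  primitive a b (fun t => expR (F t) * f t) (fun t => expR (F t)).
Proof.
by move=> ab; apply: primitive_comp => //; exact: continuous_expR.
Qed.

Lemma primitive_ge0 a b f F x y : primitive a b f F ->
  ae_itv a b (fun t => 0 <= f t) -> a <= x -> x <= y -> y <= b -> F x <= F y.
Proof.
move=> /(primitive_sub _ _)h f0 ax xy yb; have {h}[acF dF] := h _ _ ax yb.
apply: ac_le_endpoints => //; apply: ae_itv2 (ae_itv_sub ax yb f0) dF.
by move=> t _ ft dF; exists (f t).
Qed.

Lemma primitive_le a b f g F G x y : primitive a b f F -> primitive a b g G ->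
  ae_itv a b (fun t => f t <= g t) -> a <= x -> x <= y -> y <= b ->
  F y - F x <= G y - G x.
Proof.
move=> pf pg fg ax xy yb; have ab : a <= b by rewrite (le_trans ax)// (le_trans
  xy).
have /primitive_ge0 := primitiveB ab pg pf.
move=> /(_ x y _ ax xy yb) h.
have {h} : G x - F x <= G y - F y.
  by apply: h; apply: ae_itv1 fg => t _; rewrite subr_ge0.
by lra.
Qed.

Lemma primitive_norm_le a b f g F G x y : primitive a b f F ->
  primitive a b g G ->
  ae_itv a b (fun t => `|f t| <= g t) -> a <= x -> x <= y -> y <= b ->
  `|F y - F x| <= G y - G x.
Proof.
move=> pf pg fg ax xy yb; have ab : a <= b by rewrite (le_trans ax)// (le_trans
  xy).
rewrite ler_norml; apply/andP; split; last first.
  apply: (primitive_le pf pg) => //; apply: ae_itv1 fg => t _; apply: le_trans.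
  exact: ler_norm.
rewrite lerNl opprB addrC -(opprK (F x)).
apply: (primitive_le (primitiveN ab pf) pg) => //; apply: ae_itv1 fg => t _.
by apply: le_trans; rewrite -normrN ler_norm.
Qed.

Lemma primitive_unique a b f g F G x y : primitive a b f F ->
  primitive a b g G ->
  ae_itv a b (fun t => f t = g t) -> x \in `[a, b] -> y \in `[a, b] ->
  F y - F x = G y - G x.
Proof.
move=> pf pg fg; rewrite !in_itv/= => /andP[ax xb] /andP[ay yb].
wlog xy : x y ax xb ay yb / x <= y.
  move=> hw; have [xy|/ltW yx] := leP x y; first exact: hw.
  by have := hw y x ay yb ax xb yx; lra.
apply/eqP; rewrite eq_le; apply/andP; split.
  by apply: primitive_le pf pg _ _ _ _ => //; apply: ae_itv1 fg => t _ ->.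
by apply: primitive_le pg pf _ _ _ _ => //; apply: ae_itv1 fg => t _ ->.
Qed.

Lemma primitive_eq0 a b f F : primitive a b f F ->
  (forall t, t \in `[a, b] -> F t = F a) -> ae_itv a b (fun t => f t = 0).
Proof.
move=> [acF dF] Fa; apply: ae_itv1 dF => t tab dF.
rewrite -(@derive_val _ _ _ _ _ _ _ dF).
have -> : 'D_1 F t = 'D_1 (cst (F a)) t.
  apply: near_eq_derive.
  apply: filterS (near_in_itvoo tab) => z; rewrite in_itv/= => /andP[az zb].
  by apply: Fa; rewrite in_itv/= !ltW.
exact: derive_cst.
Qed.

(** If [P] failed throughout []x, y[], a contradiction would hold almost everywhere there, and the
    identity would have the same increments as a constant. *)
Lemma ae_itv_witness a b x y (P : R -> Prop) : ae_itv a b P ->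
  a <= x -> x < y -> y <= b -> exists2 t, x < t < y & P t.
Proof.
move=> aeP ax xy yb; apply: contrapT => nP.
have p1 : primitive x y (fun=> 1) (@id R).
  split; last by apply: ae_itv0 => t _; exact: is_derive_id.
  move=> e e0; exists e => // n u v uv _.
  rewrite [X in _ -> X < _](eq_bigr (fun i => v i - u i))// => i _.
  by have [_ [? _]] := uv i; rewrite ger0_norm ?subr_ge0.
have := primitive_unique (x := y) (y := x) p1 (primitive_cst x y 0).
rewrite !in_itv/= !lexx (ltW xy) /= => /(_ _ isT isT) h.
suff : x - y = 0 by move: xy; lra.
rewrite h ?subrr//; apply: ae_itv1 (ae_itv_sub ax yb aeP) => t txy Pt.
by exfalso; apply: nP; exists t; rewrite // in_itv in txy.
Qed.

Lemma ac_ae_eq0 a b F t : a < b -> abs_continuous a b F ->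
  ae_itv a b (fun t => F t = 0) -> t \in `[a, b] -> F t = 0.
Proof.
move=> ab acF F0; rewrite in_itv/= => /andP[at_ tb].
apply/eqP; rewrite -normr_eq0; case: ltgtP (normr_ge0 (F t)) => // Ft _.
have [d d0 dP] := ac_pieces acF Ft.
have [at'|ta] := ltP a t.
  have [s /andP[ms st] Fs] : exists2 s, Num.max a (t - d) < s < t & F s = 0.
    apply: (ae_itv_witness F0) => //; first by rewrite le_max lexx.
    by rewrite gt_max at' gtrBl.
  move: ms; rewrite gt_max => /andP[as_ tds].
  have := dP [:: (s, t)]; rewrite /= tb !ltW// => /(_ isT).
  rewrite !big_cons !big_nil /= !addr0 Fs subr0 ltxx; apply; lra.
have [s /andP[ts sm] Fs] : exists2 s, t < s < Num.min b (t + d) & F s = 0.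
  apply: (ae_itv_witness F0) => //; last by rewrite ge_min lexx.
  by rewrite lt_min ltrDl d0 (le_lt_trans ta).
move: sm; rewrite lt_min => /andP[sb std].
have := dP [:: (t, s)]; rewrite /= at_ !ltW// => /(_ isT).
rewrite !big_cons !big_nil /= !addr0 Fs sub0r normrN ltxx; apply; lra.
Qed.

End AE.

(** * Primitives of integrable functions *)

Section Integrable.
Context {R : realType}.
Local Notation mu := (@lebesgue_measure R).
Implicit Types (a b x y t : R) (F G f g : R -> R).

Definition integrable_itv a b f := mu.-integrable `]a, b[ (fun t => (f t)%:E).

(** Extended by zero, [f] is integrable on the whole line, where the fundamental theorem of calculus
    differentiates its indefinite integral almost everywhere. Absolute continuity comes from that of
    the integral of |g| over sets of small measure. *)
Lemma integrable_primitive a b f : a <= b -> integrable_itv a b f ->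
  exists F, [/\ primitive a b f F, F a = 0 & F b = \int[mu]_(t in `]a, b[) f t].
Proof.
move=> ab intf; suff [F pF Fb] : exists2 F, primitive a b f F &
    F b - F a = \int[mu]_(t in `]a, b[) f t.
  exists (fun t => F t - F a); split=> //; last exact: subrr.
  have := primitiveB ab pF (primitive_cst a b (F a)).
  by apply: primitive_ext => t; rewrite subr0.
move: ab intf.
move=> ab intf; pose g := f \_ `]a, b[.
have intg : mu.-integrable setT (EFin \o g).
  rewrite /g -restrict_EFin.
  exact: (integrable_mkcond (mu := mu) (EFin \o f) (measurable_itv `]a, b[)).1.
have intgS (A : set R) : measurable A -> mu.-integrable A (EFin \o g).
  by move=> mA; exact: integrableS intg.
pose F x := \int[mu]_(t in [set` `]-oo, x]]) g t.
have FB x y : x <= y -> F y - F x = \int[mu]_(t in `]x, y[) g t.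
  move=> xy; rewrite Rintegral_itv_bndo_bndc; last exact: intgS.
  by rewrite /F Rintegral_itvB//; exact: intgS.
exists F; last first.
  by rewrite FB//; apply: eq_Rintegral => t tab; rewrite /g patchE tab.
split; last first.
  have : {ae mu, forall x, derivable F x 1 /\ derive1 F x = g x}.
    apply: FTC1Ny; last exact: integrable_locally.
    by move=> y; exact: intgS.
  rewrite /ae_itv; apply: (@filterS _ _ (ae_filter_ringOfSetsType mu)).
  move=> t [dF Fg] tab; apply: DeriveDef => //.
  by rewrite -derive1E Fg /g patchE mem_set.
move=> e e0; have [d [d0 dP]] := integral_normr_continuous intg e0.
exists d => // n u v uv tr uvd.
pose I i := `]u i, v i[%classic.
pose D := \big[setU/set0]_(i < n) I i.
have mI i : measurable (I i) by exact: measurable_itv.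
have mD : measurable D by apply: bigsetU_measurable.
have intn : mu.-integrable setT (EFin \o (fun t => `|g t|)).
  exact: (integrable_norm intg).
have intnS (A : set R) : measurable A ->
    mu.-integrable A (EFin \o (fun t => `|g t|)).
  by move=> mA; exact: integrableS intn.
apply: le_lt_trans (dP D mD _); last first.
  rewrite measure_bigsetU_ord//=.
  rewrite (eq_bigr (fun i => (v i - u i)%:E)).
    by rewrite sumEFin lte_fin.
  move=> i _; have [_ [+ _]] := uv i.
  rewrite lebesgue_measure_itv/= lte_fin le_eqVlt => /predU1P[->|->//].
  by rewrite ltxx subrr.
have -> : \int[mu]_(x in D) `|g x| = \sum_(i < n) \int[mu]_(x in I i) `|g x|.
  rewrite {1}/Rintegral integral_bigsetU_EFin//=.
  - rewrite (eq_bigr (fun i => (\int[mu]_(x in I i) `|g x|)%:E)).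
      by rewrite sumEFin.
    move=> i _; rewrite /Rintegral fineK//; by apply: (integrable_fin_num _
      (intnS _ (mI i))); exact: mI.
  - exact: index_enum_uniq.
  - by apply: sub_trivIset tr.
  - by have /integrableP[] := intnS _ mD.
apply: ler_sum => i _; have [_ [uvi _]] := uv i.
rewrite FB//; apply: le_normr_Rintegral => //.
exact: intgS.
Qed.

Lemma ac_measurable a b F : abs_continuous a b F -> measurable_fun `]a, b[ F.
Proof.
move=> /ac_continuous cF; apply: (@measurable_funS _ _ _ _ `[a, b]) => //.
  exact: subset_itv_oo_cc.
exact: subspace_continuous_measurable_fun.
Qed.

Lemma integrable_itvMb a b f F (C : R) : integrable_itv a b f ->
  measurable_fun `]a, b[ F -> (forall t, t \in `]a, b[ -> `|F t| <= C) ->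
  integrable_itv a b (fun t => f t * F t).
Proof.
move=> intf mF FC.
have h := @integrableMl _ _ _ mu `]a, b[ (measurable_itv _) (EFin \o f) F intf
  mF.
apply: h; exists C; split; first exact: num_real.
move=> z Cz t tab; exact: le_trans (FC t tab) (ltW Cz).
Qed.

Lemma integrable_itvM a b f F : a <= b -> integrable_itv a b f ->
  abs_continuous a b F -> integrable_itv a b (fun t => f t * F t).
Proof.
move=> ab intf acF; have [C C0 CP] := ac_bounded ab acF.
apply: (integrable_itvMb (C := C)) => //; first exact: ac_measurable.
by move=> t /subset_itv_oo_cc; exact: CP.
Qed.

Lemma integrable_itvD a b f g : integrable_itv a b f -> integrable_itv a b g ->
  integrable_itv a b (fun t => f t + g t).
Proof. by move=> /integrableD h /h; exact. Qed.

Lemma integrable_itvZ a b (c : R) f : integrable_itv a b f ->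
  integrable_itv a b (fun t => c * f t).
Proof. by move=> /integrableZl; exact. Qed.

Lemma integrable_itv_norm a b f : integrable_itv a b f ->
  integrable_itv a b (fun t => `|f t|).
Proof. by move=> /integrable_norm; exact. Qed.

(* The truncation that makes an integrable potential bounded below by a multiple
   of the weight, up to an error of small integral. *)
Lemma integrable_negative_part a b f w : a <= b ->
  integrable_itv a b f -> integrable_itv a b w ->
  ae_itv a b (fun t => 0 < w t) ->
  exists k E e, [/\ 0 <= k, primitive a b E e, ae_itv a b (fun t => 0 <= E t),
    ae_itv a b (fun t => 0 <= f t + k * w t + E t) & e a = 0 /\ e b <= 1].
Proof.
move=> ab intf intw w0.
pose h (k : nat) t := f t + k%:R * w t.
(* The negative part of [h k]. Where [w > 0] it vanishes once [k] is large, and it is dominated by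
   |f|, so its integral tends to 0. *)
pose E (k : nat) t := 2^-1 * (`|h k t| + - 1 * h k t).
have inth k : integrable_itv a b (h k).
  by apply: integrable_itvD => //; exact: integrable_itvZ.
have intE k : integrable_itv a b (E k).
  apply: integrable_itvZ; apply: integrable_itvD; last exact: integrable_itvZ.
  exact: integrable_itv_norm.
have E0 k t : 0 <= E k t.
  by rewrite mulr_ge0 ?invr_ge0// mulN1r subr_ge0 ler_norm.
have hE k t : 0 <= h k t + E k t.
  by have := ler_norm (- h k t); rewrite normrN /E; lra.
have aew (P : R -> Prop) : (forall t, 0 < w t -> P t) ->
    {ae mu, forall t, `]a, b[%classic t -> P t}.
  by move=> wP; apply: (ae_itv1 _ w0) => t _; exact: wP.
have cvgE : {ae mu, forall t, `]a, b[%classic t ->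
    (fun k => (E k t)%:E) @ \oo --> 0%E}.
  apply: aew => t wt; apply: cvg_near_cst; near=> k.
  have hk : 0 <= h k t.
    have : `|f t| / w t <= k%:R by near: k; exact: nbhs_infty_ger.
    rewrite ler_pdivrMr// /h; have := ler_norm (- f t); rewrite normrN; lra.
  by rewrite /E ger0_norm// mulN1r subrr mulr0.
have domE : {ae mu, forall t k, `]a, b[%classic t ->
    (`|(E k t)%:E| <= `|f t|%:E)%E}.
  have := aew (fun t => forall k, (`|(E k t)%:E| <= `|f t|%:E)%E) _.
  move=> /(_ _)/(@filterS _ _ (ae_filter_ringOfSetsType mu)); apply.
    by move=> t Ht k tab; exact: Ht.
  move=> t wt k /=; rewrite lee_fin ger0_norm//.
  have kw : 0 <= k%:R * w t by rewrite mulr_ge0// ltW.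
  have := ler_norm (f t); have := ler_norm (- f t);
    rewrite normrN /E /h => h1 h2.
  by have [hk|hk] := ger0P (f t + k%:R * w t); lra.
have [_ _] := @dominated_convergence _ _ _ mu `]a, b[ (measurable_itv _)
  (fun k t => (E k t)%:E) (cst 0%E) (fun t => `|f t|%:E)
  (fun k => (integrableP _ _ _ (intE k)).1) (measurable_cst _) cvgE
  (integrable_itv_norm intf) domE.
rewrite integral_cst//= mul0e => /fine_cvgP[_ /cvgrPdist_lt /(_ _ ltr01)[N _
  NP]].
(* For this index the integral is below 1; this 1 is the margin in the constant [La] of the
   asymptotics. *)
have {NP} := NP N (leqnn N).
rewrite sub0r normrN => /(le_lt_trans (ler_norm _)) lt1.
have [e [pe ea eb]] := integrable_primitive ab (intE N).
exists N%:R, (E N), e; split=> //.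
- by apply: ae_itv0 => t _.
- by apply: ae_itv0 => t _; exact: hE.
- by rewrite eb ltW.
Unshelve. all: by end_near. Qed.

End Integrable.

(** * Linear canonical systems *)

Section Picard.
Context {R : realType}.
Implicit Types (a b x y t : R) (F G f g : R -> R).

Lemma is_derive_exp_coeff n x :
  is_derive x 1 (fun x : R => exp_coeff x n.+1) (exp_coeff x n).
Proof.
have -> : (fun x : R => exp_coeff x n.+1) = n.+1`!%:R^-1 *: ((@id R) ^+ n.+1).
  by apply/funext => y; rewrite /exp_coeff /= mulrC !fctE.
apply: is_derive_eq; rewrite /exp_coeff/= /GRing.scale/= mulr1 factS natrM.
by field; rewrite nat1r !pnatr_eq0 -lt0n fact_gt0.
Qed.

Lemma continuous_exp_coeff n : continuous (fun x : R => exp_coeff x n).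
Proof.
move=> x; apply: cvgM; last exact: cvg_cst.
exact: exprn_continuous.
Qed.

Lemma primitive_exp_coeff a b w W n : a <= b -> primitive a b w W ->
  primitive a b (fun t => exp_coeff (W t) n * w t)
    (fun t => exp_coeff (W t) n.+1).
Proof.
move=> ab; apply: (@primitive_comp _ _ _ _ _ (fun x => exp_coeff x n.+1)
  (fun x => exp_coeff x n)) => //.
  exact: is_derive_exp_coeff.
exact: continuous_exp_coeff.
Qed.

Lemma exp_tail_cvg0 (M C : R) :
  C * (expR M - series (exp_coeff M) n) @[n --> \oo] --> 0.
Proof.
suff : C * (expR M - series (exp_coeff M) n) @[n --> \oo] -->
    C * (expR M - expR M) by rewrite subrr mulr0.
apply: cvgMr; apply: cvgB; first exact: cvg_cst.
exact: is_cvg_series_exp_coeff.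
Qed.

Lemma series_exp_tail (M C : R) (u : R^nat) : 0 <= M ->
  (forall n, `|u n| <= C * exp_coeff M n) ->
  exists2 l : R, series u @ \oo --> l &
    forall n, `|l - series u n| <= C * (expR M - series (exp_coeff M) n).
Proof.
move=> M0 uM.
have e0 n : 0 <= exp_coeff M n by exact: exp_coeff_ge0.
have cu : cvgn (series u).
  apply: normed_cvg; apply: (@series_le_cvg _ _ (fun n => C * exp_coeff M n)).
  - by move=> n; exact: normr_ge0.
  - by move=> n; exact: le_trans (uM n).
  - exact: uM.
  - have -> : series (fun n => C * exp_coeff M n) = C *: series (exp_coeff M).
      by apply/funext => n; rewrite /series /= -mulr_sumr.
    by apply: is_cvgZr; exact: is_cvg_series_exp_coeff.
exists (limn (series u)) => // n.
have h1 : `|series u m - series u n| @[m --> \oo] -->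
  `|limn (series u) - series u n|.
  by apply: cvg_norm; apply: cvgB => //; exact: cvg_cst.
have h2 : C * (series (exp_coeff M) m - series (exp_coeff M) n) @[m --> \oo]
    --> C * (expR M - series (exp_coeff M) n).
  apply: cvgMr; apply: cvgB; last exact: cvg_cst.
  exact: is_cvg_series_exp_coeff.
apply: (ler_cvg_to h1 h2).
near=> m; have nm : (n <= m)%N by near: m; exact: nbhs_infty_ge.
rewrite !sub_series_geq// mulr_sumr (le_trans (ler_norm_sum _ _ _))//.
exact: ler_sum.
Unshelve. all: by end_near. Qed.

(** Picard iteration for an off-diagonal system, [y i] being driven by [y (~~ i)]. The n-th
    correction is dominated by C W^n / n!, with [W] a primitive of |A true| + |A false|, so the
    series converges uniformly even though the coefficients are merely integrable. *)
Lemma linear_system_exists a b (A : bool -> R -> R) (c : bool -> R) : a <= b ->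
  (forall i, integrable_itv a b (A i)) ->
  exists y : bool -> R -> R, forall i,
    primitive a b (fun t => A i t * y (~~ i) t) (y i) /\ y i a = c i.
Proof.
move=> ab intA.
(* [I] picks a primitive vanishing at [a]; its value at a non-integrable function is a dummy. *)
have [I IP] : {I : (R -> R) -> R -> R & forall f, integrable_itv a b f ->
    primitive a b f (I f) /\ I f a = 0}.
  apply: (@choice _ _ (fun f F => integrable_itv a b f ->
    primitive a b f F /\ F a = 0)) => f; have [intf|nintf] :=
      pselect (integrable_itv a b f).
    by have [F [pF Fa _]] := integrable_primitive ab intf; exists F.
  by exists (cst 0).
pose w t := `|A true t| + `|A false t|.
have intw : integrable_itv a b w.
  by apply: integrable_itvD; exact: integrable_itv_norm.
have [pW Wa] := IP _ intw; set W := I w in pW Wa.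
have Aw i t : `|A i t| <= w t.
  by rewrite /w; case: i; rewrite ?lerDl ?lerDr.
have w0 : ae_itv a b (fun t => 0 <= w t).
  by apply: ae_itv0 => t _; rewrite addr_ge0.
have Wmono x y : a <= x -> x <= y -> y <= b -> W x <= W y.
  by move=> *; exact: (primitive_ge0 pW w0).
pose M := W b.
have W0 t : t \in `[a, b] -> 0 <= W t <= M.
  by rewrite in_itv/= => /andP[at_ tb]; rewrite -{1}Wa !Wmono.
pose C := `|c true| + `|c false|.
have C0 : 0 <= C by rewrite addr_ge0.
(* [Y n] is the n-th term of the Picard series; its partial sums are [S] below. *)
pose Y := fix Y n (i : bool) : R -> R := if n is n'.+1
  then I (fun t => A i t * Y n' (~~ i) t) else fun=> c i.
have acY n i : abs_continuous a b (Y n i).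
  elim: n i => [|n IH] i; first exact: ac_cst.
  by have [[]] := IP _ (integrable_itvM ab (intA i) (IH (~~ i))).
have pY n i : primitive a b (fun t => A i t * Y n (~~ i) t) (Y n.+1 i) /\
    Y n.+1 i a = 0.
  exact: IP (integrable_itvM ab (intA i) (acY n (~~ i))).
have YW n i t : t \in `[a, b] -> `|Y n i t| <= C * exp_coeff (W t) n.
  elim: n i t => [|n IH] i t tab.
    rewrite /= /exp_coeff /= expr0 fact0 divr1 mulr1 /C.
    by case: i; rewrite ?lerDl ?lerDr.
  have [pYn Ya] := pY n i; move: (tab); rewrite in_itv/= => /andP[at_ tb].
  have pe := primitiveZ C ab (primitive_exp_coeff n ab pW).
  have bd : ae_itv a b (fun s => `|A i s * Y n (~~ i) s| <=
      C * (exp_coeff (W s) n * w s)).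
    apply: ae_itv0 => s /subset_itv_oo_cc sab; rewrite normrM mulrC mulrA.
    by apply: ler_pM => //; exact: IH.
  have ea : exp_coeff (W a) n.+1 = 0 by rewrite /exp_coeff /= Wa expr0n mul0r.
  by have := primitive_norm_le pYn pe bd (lexx a) at_ tb;
    rewrite Ya ea mulr0 !subr0.
have YM n i t : t \in `[a, b] -> `|Y n i t| <= C * exp_coeff M n.
  move=> tab; apply: (le_trans (YW n i t tab)); rewrite ler_wpM2l//.
  have /andP[Wt0 WtM] : 0 <= W t <= M := W0 t tab.
  by rewrite /exp_coeff ler_wpM2r// lerXn2r// nnegrE (le_trans Wt0).
have M0 : 0 <= M.
  by have /andP[] : 0 <= W b <= M by apply: W0; rewrite in_itv/= lexx ab.
pose tau n := C * (expR M - series (exp_coeff M) n).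
have [U UP] : {U : bool -> R -> R & forall i t, t \in `[a, b] ->
    series (fun n => Y n i t) @ \oo --> U i t /\
    forall n, `|U i t - series (fun n => Y n i t) n| <= tau n}.
  have : forall it : bool * R, exists l : R, it.2 \in `[a, b] ->
    series (fun n => Y n it.1 it.2) @ \oo --> l /\
    forall n, `|l - series (fun n => Y n it.1 it.2) n| <= tau n.
    move=> [i t]/=; have [tab|] := boolP (t \in `[a, b]); last by exists 0.
    have [l cl lP] := series_exp_tail M0 (fun n => YM n i t tab).
    by exists l.
  by move=> /choice[U UP]; exists (fun i t => U (i, t)) => i t;
    exact: (UP (i, t)).
pose S n i t := series (fun n => Y n i t) n.
have acS n i : abs_continuous a b (S n i).
  elim: n => [|n IH].
    rewrite (_ : S _ _ = cst 0); first exact: ac_cst.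
    by apply/funext => t; rewrite /S /series /= big_geq.
  rewrite (_ : S _ _ = (fun t => S n i t + Y n i t)); first exact: acD.
  by apply/funext => t; rewrite /S /series /= big_nat_recr.
have mU i : measurable_fun `]a, b[ (U i).
  apply: (@measurable_fun_cvg _ _ _ _ (fun n => S n i)).
    by move=> n; exact: ac_measurable.
  by move=> t tab; have [] := UP i t (subset_itv_oo_cc tab).
have UM i t : t \in `]a, b[ -> `|U i t| <= tau 0.
  move=> /subset_itv_oo_cc tab; have [_ /(_ 0%N)] := UP i t tab.
  by rewrite [series _ _]big_geq// subr0.
have intAU i : integrable_itv a b (fun t => A i t * U (~~ i) t).
  by apply: (integrable_itvMb (C := tau 0)) => //; exact: UM.
(* The pointwise limit [U] is so far only bounded and measurable. Integrating the equation once more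
   gives an absolutely continuous [V], which is then shown to agree with [U]. *)
pose V i t := c i + I (fun t => A i t * U (~~ i) t) t.
have pV i : primitive a b (fun t => A i t * U (~~ i) t) (V i).
  have := primitiveD (primitive_cst a b (c i)) (IP _ (intAU i)).1.
  by apply: primitive_ext => t; rewrite add0r.
have VS n i t : t \in `[a, b] -> `|V i t - S n.+1 i t| <= tau n * M.
  move=> tab; move: (tab); rewrite in_itv/= => /andP[at_ tb].
  have pS : primitive a b (fun t => A i t * S n (~~ i) t) (S n.+1 i) /\
      S n.+1 i a = c i.
    elim: n => [|n [IH IHa]].
      have -> : S 1%N i = cst (c i).
        by apply/funext => s; rewrite /S /series /= big_nat1.
      split=> //; have := primitive_cst a b (c i); apply: primitive_ext => s.
      by rewrite /S /series /= big_geq// mulr0.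
    have SE j m s : S m.+1 j s = S m j s + Y m j s.
      by rewrite /S /series /= big_nat_recr.
    split; last by rewrite SE IHa (pY n i).2 addr0.
    rewrite (_ : S n.+2 i = (fun t => S n.+1 i t + Y n.+1 i t)); last first.
      by apply/funext => s; rewrite SE.
    have := primitiveD IH (pY n i).1; apply: primitive_ext => s.
    by rewrite -mulrDr -SE.
  have [{}pS Sa] := pS.
  have pd := primitiveB ab (pV i) pS.
  have bd : ae_itv a b (fun s => `|A i s * U (~~ i) s - A i s * S n (~~ i) s|
      <= tau n * w s).
    apply: ae_itv0 => s /subset_itv_oo_cc sab; rewrite -mulrBr normrM mulrC.
    by apply: ler_pM => //; have [_] := UP (~~ i) s sab; apply.
  have da : V i a - S n.+1 i a = 0.
    by rewrite Sa /V (IP _ (intAU i)).2 addr0 subrr.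
  have pe := primitiveZ (tau n) ab pW.
  have tau0 : 0 <= tau n.
    by apply: le_trans ((UP i t tab).2 n).
  apply: (@le_trans _ _ (tau n * W t)); last first.
    by rewrite ler_wpM2l//; have /andP[] := W0 t tab.
  by have := primitive_norm_le pd pe bd (lexx a) at_ tb;
    rewrite da Wa mulr0 !subr0.
have VU i t : t \in `[a, b] -> V i t = U i t.
  move=> tab; apply/eqP; rewrite -subr_eq0 -normr_le0.
  have ct : tau n * M + tau n.+1 @[n --> \oo] --> 0 * M + 0.
    apply: cvgD; last by rewrite (cvg_shiftS tau); exact: exp_tail_cvg0.
    by apply: cvgMl; exact: exp_tail_cvg0.
  rewrite mul0r addr0 in ct.
  apply: (ler_cvg_to (cvg_cst _) ct).
  near=> n; have [_ /(_ n.+1) h] := UP i t tab.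
  rewrite (_ : V i t - U i t = (V i t - S n.+1 i t) - (U i t - S n.+1 i t)).
    by rewrite (le_trans (ler_normB _ _))// lerD// VS.
  by ring.
exists V => i; split; last by rewrite /V (IP _ (intAU i)).2 addr0.
apply: primitive_ae (pV i); apply: ae_itv0 => t /subset_itv_oo_cc tab.
by rewrite VU.
Unshelve. all: by end_near. Qed.

End Picard.

(** * Fundamental solutions and their dependence on the spectral parameter *)

Section Fundamental.
Context {R : realType}.
Implicit Types (a b x y t l : R) (F G f g P Q W u v : R -> R).

Definition canonical_system a b P Q u v : Prop :=
  primitive a b (fun t => P t * v t) u /\ primitive a b (fun t => Q t * u t) v.

(** For equal potentials it makes the Wronskian constant; for [Q - l * W] and [Q - l' * W] it
    governs the dependence on the spectral parameter. *)
Lemma lagrange_identity a b P Q Q' u v u' v' : a <= b ->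
  canonical_system a b P Q u v -> canonical_system a b P Q' u' v' ->
  primitive a b (fun t => (Q' t - Q t) * (u t * u' t))
    (fun t => u t * v' t - v t * u' t).
Proof.
move=> ab [pu pv] [pu' pv'].
apply: primitive_ext (primitiveB ab (primitiveM ab pu pv') (primitiveM ab pv
  pu')).
by move=> t /=; ring.
Qed.

Lemma canonical_systemD a b P Q u v u' v' (c c' : R) : a <= b ->
  canonical_system a b P Q u v -> canonical_system a b P Q u' v' ->
  canonical_system a b P Q (fun t => c * u t + c' * u' t)
    (fun t => c * v t + c' * v' t).
Proof.
move=> ab [pu pv] [pu' pv']; split.
  apply: primitive_ext (primitiveD (primitiveZ c ab pu) (primitiveZ c' ab pu')).
  by move=> t /=; ring.
apply: primitive_ext (primitiveD (primitiveZ c ab pv) (primitiveZ c' ab pv')).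
by move=> t /=; ring.
Qed.

Lemma wronskian_cst a b P Q u v u' v' t : a <= b ->
  canonical_system a b P Q u v -> canonical_system a b P Q u' v' ->
  t \in `[a, b] ->
  u t * v' t - v t * u' t = u a * v' a - v a * u' a.
Proof.
move=> ab s1 s2 tab; apply/eqP; rewrite -subr_eq0; apply/eqP.
rewrite (primitive_unique (lagrange_identity ab s1 s2) (primitive_cst a b 0) _ _
  tab).
- by rewrite subrr.
- by apply: ae_itv0 => s _; rewrite subrr mul0r.
- by rewrite in_itv/= lexx.
Qed.

(** Gronwall: the derivative of u^2 + v^2 is 2 (P + Q) u v, at most g (u^2 + v^2), so (u^2 + v^2)
    exp (- w) does not increase. *)
Lemma canonical_system_bound a b P Q u v g w t : a <= b ->
  canonical_system a b P Q u v -> primitive a b g w -> w a = 0 ->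
  ae_itv a b (fun t => 0 <= g t) ->
  ae_itv a b (fun t => `|P t + Q t| <= g t) -> t \in `[a, b] ->
  u t ^+ 2 + v t ^+ 2 <= (u a ^+ 2 + v a ^+ 2) * expR (w b).
Proof.
move=> ab [pu pv] pw wa g0 PQg; rewrite in_itv/= => /andP[at_ tb].
have pe := primitiveD (primitiveM ab pu pu) (primitiveM ab pv pv).
have pE := primitiveM ab pe (primitive_expR ab (primitiveN ab pw)).
have := primitive_ge0 (primitiveN ab pE) _ (lexx a) at_ tb.
rewrite lerN2 wa oppr0 expR0 mulr1 -!expr2 => h.
have {h} : (u t ^+ 2 + v t ^+ 2) * expR (- w t) <= u a ^+ 2 + v a ^+ 2.
  apply: h; apply: ae_itv1 PQg => s _ /=; rewrite ler_norml => /andP[h1 h2].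
  set e := expR _; have e0 : 0 < e by exact: expR_gt0.
  have -> : - ((u s * u s + v s * v s) * (e * - g s) +
    (u s * (P s * v s) + P s * v s * u s + (v s * (Q s * u s) + Q s * u s * v
      s)) * e)
    = e * ((u s ^+ 2 + v s ^+ 2) * g s - (P s + Q s) * (2 * (u s * v s)))
      by ring.
  rewrite mulr_ge0 ?(ltW e0)//.
  have := sqr_ge0 (u s - v s); have := sqr_ge0 (u s + v s).
  by nra.
move=> h; rewrite -(@ler_pM2r _ (expR (- w t))) ?expR_gt0//.
apply: (le_trans h); rewrite -mulrA -expRD ler_peMr ?addr_ge0 ?sqr_ge0//.
rewrite -expR0 ler_expR subr_ge0.
exact: (primitive_ge0 pw g0).
Qed.

Lemma is_derive_increment F (x d C : R) (G : R -> R) :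
  (forall h, `|h| <= 1 -> F (x + h) - F x = h * G h) ->
  (forall h, `|h| <= 1 -> `|G h - d| <= C * `|h|) ->
  is_derive x 1 F d.
Proof.
move=> FG Gd.
have cF : h^-1 *: ((F \o shift x) (h *: (1 : R)) - F x) @[h --> 0^'] --> d.
  have C1 : 0 < `|C| + 1 by have := normr_ge0 C; lra.
  apply/cvgrPdist_lt => e e0; have eC : 0 < e / (`|C| + 1) by exact: divr_gt0.
  near=> h.
  have h0 : h != 0 by near: h; exact: nbhs_dnbhs_neq.
  have h1 : `|h| < Num.min 1 (e / (`|C| + 1)).
    by near: h; apply: dnbhs0_lt; rewrite lt_min ltr01.
  move: h1; rewrite lt_min => /andP[/ltW h1 h2].
  rewrite /= /GRing.scale/= mulr1 (addrC h) FG// mulKf// distrC.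
  apply: le_lt_trans (Gd _ h1) _.
  rewrite ltr_pdivlMr// in h2; apply: le_lt_trans h2.
  rewrite mulrC ler_wpM2l// ; have := ler_norm C; lra.
apply: DeriveDef; first by apply/cvg_ex; exists d.
exact/cvg_lim.
Unshelve. all: by end_near. Qed.

Section fundamental_system.
Variables (a b : R) (P Q W : R -> R).
Hypotheses (ab : a < b) (intP : integrable_itv a b P)
  (intQ : integrable_itv a b Q) (intW : integrable_itv a b W).

Let leab : a <= b := ltW ab.

(** The Boolean names the column of the fundamental matrix: [false] starts at (1, 0), [true] at (0,
    1). *)
Lemma fundamental_system : exists U V : R -> bool -> R -> R, forall l i,
  [/\ canonical_system a b P (fun t => Q t - l * W t) (U l i) (V l i),
      U l i a = (~~ i)%:R & V l i a = i%:R].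
Proof.
have H (li : R * bool) : exists y : bool -> R -> R,
  [/\ canonical_system a b P (fun t => Q t - li.1 * W t) (y false) (y true),
      y false a = (~~ li.2)%:R & y true a = (li.2)%:R].
  case: li => l i.
  have [|y yP] := @linear_system_exists _ a b
    (fun j => if j then fun t => Q t + - l * W t else P)
    (fun j => if j then i%:R else (~~ i)%:R) leab.
    by case=> //; apply: integrable_itvD => //; exact: integrable_itvZ.
  exists y; have [/= p1 y1] := yP true; have [/= p2 y2] := yP false.
  by split=> //; split=> //; apply: primitive_ext p1 => t /=; ring.
have [Y YP] := choice H.
exists (fun l i => Y (l, i) false), (fun l i => Y (l, i) true) => l i.
exact: YP (l, i).
Qed.

Variables U V : R -> bool -> R -> R.
Hypothesis UV : forall l i,
  [/\ canonical_system a b P (fun t => Q t - l * W t) (U l i) (V l i),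
      U l i a = (~~ i)%:R & V l i a = i%:R].

Lemma fundamental_wronskian l t : t \in `[a, b] ->
  U l false t * V l true t - V l false t * U l true t = 1.
Proof.
move=> tab; have [s1 u1 v1] := UV l false; have [s2 u2 v2] := UV l true.
by rewrite (wronskian_cst leab s1 s2 tab) u1 v1 u2 v2 /=; ring.
Qed.

Lemma solution_expansion l u v t :
  canonical_system a b P (fun t => Q t - l * W t) u v -> t \in `[a, b] ->
  u t = u a * U l false t + v a * U l true t /\
  v t = u a * V l false t + v a * V l true t.
Proof.
move=> s tab; have [s1 u1 v1] := UV l false; have [s2 u2 v2] := UV l true.
have w := fundamental_wronskian l tab.
have h1 := wronskian_cst leab s s1 tab; have h2 := wronskian_cst leab s s2 tab.
rewrite u1 v1 u2 v2 /= in h1 h2.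
by split; [rewrite -[LHS]mulr1 -w|rewrite -[LHS]mulr1 -w]; nra.
Qed.

Lemma fundamental_bound l : exists2 C : R, 0 < C &
  forall l' i t, `|l' - l| <= 1 -> t \in `[a, b] ->
    `|U l' i t| <= C /\ `|V l' i t| <= C.
Proof.
pose g t := `|P t| + (`|Q t| + (`|l| + 1) * `|W t|).
have intg : integrable_itv a b g.
  apply: integrable_itvD; first exact: integrable_itv_norm.
  apply: integrable_itvD; first exact: integrable_itv_norm.
  by apply: integrable_itvZ; exact: integrable_itv_norm.
have g0 : ae_itv a b (fun t => 0 <= g t).
  by apply: ae_itv0 => t _; rewrite !addr_ge0 ?mulr_ge0 ?addr_ge0.
have [w [pw wa _]] := integrable_primitive leab intg.
exists (expR (w b) + 1); first by rewrite addr_gt0// expR_gt0.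
move=> l' i t ll' tab; have [s ua va] := UV l' i.
have := canonical_system_bound leab s pw wa g0 _ tab.
rewrite ua va => h.
have {h} : U l' i t ^+ 2 + V l' i t ^+ 2 <= expR (w b).
  rewrite -[leRHS]mul1r.
  have <- : (~~ i)%:R ^+ 2 + i%:R ^+ 2 = 1 :> R by case: i {s ua va h} => /=;
    ring.
  apply: h; apply: ae_itv0 => x _.
  have l'l : `|l'| <= `|l| + 1.
    by have := ler_normD (l' - l) l; rewrite subrK; lra.
  rewrite (le_trans (ler_normD _ _))// /g lerD// (le_trans (ler_normB _ _))//.
  by rewrite lerD// normrM ler_wpM2r.
have e0 := expR_gt0 (w b); move=> h.
have hU := sqr_ge0 (U l' i t); have hV := sqr_ge0 (V l' i t).
have aux (z : R) : z ^+ 2 <= expR (w b) -> `|z| <= expR (w b) + 1.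
  rewrite -(real_normK (num_real z)) => hz.
  by rewrite leNgt; apply/negP => hz'; have := normr_ge0 z; nra.
by split; apply: aux; lra.
Qed.

(* The columns of the fundamental matrix for [l'] are expanded along those for
   [l], the coefficients being given by the Lagrange identity. *)
Lemma fundamental_increment l : exists J : R -> bool -> bool -> R -> R,
  [/\ forall l' i j, primitive a b (fun t => W t * (U l i t * U l' j t)) (J l' i
    j),
      forall l' i j, J l' i j a = 0,
      forall l' j t, t \in `[a, b] ->
        U l' j t - U l j t = (l' - l) *
          (U l false t * J l' true j t - U l true t * J l' false j t) &
      forall l' j t, t \in `[a, b] ->
        V l' j t - V l j t = (l' - l) *
          (V l false t * J l' true j t - V l true t * J l' false j t)].
Proof.
have H (x : R * bool * bool) : exists J,
  primitive a b (fun t => W t * (U l x.1.2 t * U x.1.1 x.2 t)) J /\ J a = 0.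
  have [[s _] _ _] := UV l x.1.2; have [[s' _] _ _] := UV x.1.1 x.2.
  have [J [pJ Ja _]] := integrable_primitive leab
    (integrable_itvM leab intW (acM leab s.1 s'.1)).
  by exists J.
have [J JP] := choice H.
pose K l' i j := J (l', i, j).
have pK l' i j : primitive a b (fun t => W t * (U l i t * U l' j t)) (K l' i j).
  exact: (JP (l', i, j)).1.
have Ka l' i j : K l' i j a = 0 by exact: (JP (l', i, j)).2.
have lag l' i j t : t \in `[a, b] ->
    U l i t * V l' j t - V l i t * U l' j t =
    (~~ i)%:R * j%:R - i%:R * (~~ j)%:R - (l' - l) * K l' i j t.
  move=> tab; have [s u v] := UV l i; have [s' u' v'] := UV l' j.
  have aab : a \in `[a, b] by rewrite in_itv/= lexx.
  have E : ae_itv a b (fun t => (Q t - l' * W t - (Q t - l * W t)) *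
      (U l i t * U l' j t) = - (l' - l) * (W t * (U l i t * U l' j t))).
    by apply: ae_itv0 => x _; ring.
  have := primitive_unique (lagrange_identity leab s s')
    (primitiveZ (- (l' - l)) leab (pK l' i j)) E aab tab.
  by rewrite Ka u v u' v' mulr0; lra.
exists K; split=> // l' j t tab.
  have w := fundamental_wronskian l tab.
  have e l1 := lag l1 false j t tab; have e' l1 := lag l1 true j t tab.
  have h l1 : U l1 j t = - U l false t *
      (U l true t * V l1 j t - V l true t * U l1 j t) +
      U l true t * (U l false t * V l1 j t - V l false t * U l1 j t).
    by rewrite -[LHS]mulr1 -w; ring.
  by rewrite (h l') (h l) !e !e'; ring.
have w := fundamental_wronskian l tab.
have e l1 := lag l1 false j t tab; have e' l1 := lag l1 true j t tab.
have h l1 : V l1 j t = - V l false t *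
    (U l true t * V l1 j t - V l true t * U l1 j t) +
    V l true t * (U l false t * V l1 j t - V l false t * U l1 j t).
  by rewrite -[LHS]mulr1 -w; ring.
by rewrite (h l') (h l) !e !e'; ring.
Qed.

End fundamental_system.
End Fundamental.

(** * The derivative in the spectral parameter and its Gram matrix *)

Section FundamentalDerivative.
Context {R : realType}.
Implicit Types (a b x y t l : R) (F G f g P Q W u v : R -> R).

Lemma canonical_system_trivial a b P Q u v : a < b ->
  ae_itv a b (fun t => 0 < P t) -> canonical_system a b P Q u v ->
  ae_itv a b (fun t => u t = 0) -> u a = 0 /\ v a = 0.
Proof.
move=> ab P0 [pu pv] u0; have aab : a \in `[a, b] by rewrite in_itv/= lexx ltW.
have uz t : t \in `[a, b] -> u t = 0 by exact: (ac_ae_eq0 ab pu.1).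
split; first exact: uz.
apply: (ac_ae_eq0 ab pv.1) => //.
have := primitive_eq0 pu; rewrite (uz a)// => /(_ uz).
apply: ae_itv2 P0 => t _ Pt /eqP; rewrite mulf_eq0 gt_eqF//= => /eqP; exact.
Qed.

Section fundamental_system.
Variables (a b : R) (P Q W : R -> R).
Hypotheses (ab : a < b) (intP : integrable_itv a b P)
  (intQ : integrable_itv a b Q) (intW : integrable_itv a b W)
  (PW0 : ae_itv a b (fun t => 0 < P t /\ 0 < W t)).

Let leab : a <= b := ltW ab.

Variables U V : R -> bool -> R -> R.
Hypothesis UV : forall l i,
  [/\ canonical_system a b P (fun t => Q t - l * W t) (U l i) (V l i),
      U l i a = (~~ i)%:R & V l i a = i%:R].

Let P0 : ae_itv a b (fun t => 0 < P t).
Proof. by apply: ae_itv1 PW0 => t _ []. Qed.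

(** The quadratic form of the Gram matrix at (x, y) is the integral of W u^2 for a combination u of
    the two columns. If it vanished, u would be 0 almost everywhere, and as P > 0 the solution would
    be trivial. *)
Lemma weighted_gram_pos l (J : bool -> bool -> R -> R) :
  (forall i j, primitive a b (fun t => W t * (U l i t * U l j t)) (J i j)) ->
  (forall i j, J i j a = 0) ->
  [/\ J true false b = J false true b, 0 < J false false b, 0 < J true true b &
      J false true b ^+ 2 < J false false b * J true true b].
Proof.
move=> pJ Ja; have aab : a \in `[a, b] by rewrite in_itv/= lexx.
have bab : b \in `[a, b] by rewrite in_itv/= lexx leab.
have sym : J true false b = J false true b.
  have := primitive_unique (pJ true false) (pJ false true) _ aab bab.
  rewrite !Ja !subr0; apply; apply: ae_itv0 => t _; ring.
have pos (x y : R) : (x != 0) || (y != 0) ->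
    0 < x ^+ 2 * J false false b + 2 * x * y * J false true b +
        y ^+ 2 * J true true b.
  move=> xy; pose F t := x ^+ 2 * J false false t +
    (2 * x * y * J false true t + y ^+ 2 * J true true t).
  pose u t := x * U l false t + y * U l true t.
  have pF : primitive a b (fun t => W t * u t ^+ 2) F.
    have := primitiveD (primitiveZ (x ^+ 2) leab (pJ false false))
      (primitiveD (primitiveZ (2 * x * y) leab (pJ false true))
         (primitiveZ (y ^+ 2) leab (pJ true true))).
    by apply: primitive_ext => t; rewrite /u; ring.
  have Wu0 : ae_itv a b (fun t => 0 <= W t * u t ^+ 2).
    by apply: ae_itv1 PW0 => t _ [_ /ltW W0]; rewrite mulr_ge0 ?sqr_ge0.
  have Fa : F a = 0 by rewrite /F !Ja !mulr0 !addr0.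
  have Fmono := primitive_ge0 pF Wu0.
  have : F a <= F b by exact: Fmono.
  rewrite Fa le_eqVlt => /predU1P[Fb|]; last by rewrite /F addrA.
  have : ae_itv a b (fun t => W t * u t ^+ 2 = 0).
    apply: (primitive_eq0 pF) => t; rewrite in_itv/= Fa => /andP[at_ tb].
    have h1 : F t <= F b by exact: Fmono.
    have h2 : F a <= F t by exact: Fmono.
    by lra.
  move=> Wu; have u0 : ae_itv a b (fun t => u t = 0).
    apply: ae_itv2 Wu PW0 => t _ /eqP + [_ W0].
    by rewrite mulf_eq0 gt_eqF//= expf_eq0/= => /eqP.
  have [s1 u1 v1] := UV l false; have [s2 u2 v2] := UV l true.
  have := canonical_system_trivial ab P0 (canonical_systemD x y leab s1 s2) u0.
  rewrite u1 u2 v1 v2 /= !mulr0 !mulr1 addr0 add0r => -[x0 y0].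
  by rewrite x0 y0 eqxx in xy.
have p1 := pos 1 0; have p2 := pos 0 1.
rewrite oner_eq0 orbT in p2; have {}p2 := p2 isT.
rewrite oner_eq0 in p1; have {}p1 := p1 isT.
have A0 : 0 < J false false b by move: p1; lra.
split=> //; first by move: p2; lra.
(* At this vector the form takes the value A (A C - B^2). *)
have := pos (J false true b) (- J false false b).
rewrite oppr_eq0 (gt_eqF A0) orbT => /(_ isT).
set A := J _ _ b in A0 *; set B := J false true b; set C := J true true b => h.
have : 0 < A * (A * C - B ^+ 2) by move: h; nra.
by rewrite pmulr_rgt0// subr_gt0.
Qed.

(** The increment formula is exact, so it suffices that the integrals [J l'] differ from [J l] by at
    most a multiple of |l' - l|. This is bootstrapped: bounded solutions give bounded integrals,
    these give the Lipschitz bound for the solutions, and that one the bound for the integrals. *)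
Lemma fundamental_derive l : exists A B C : R,
  [/\ 0 < A, 0 < C, B ^+ 2 < A * C,
      is_derive l 1 (fun l => U l false b) (U l false b * B - U l true b * A) &
      is_derive l 1 (fun l => U l true b) (U l false b * C - U l true b * B)] /\
  (is_derive l 1 (fun l => V l false b) (V l false b * B - V l true b * A) /\
   is_derive l 1 (fun l => V l true b) (V l false b * C - V l true b * B)).
Proof.
have bab : b \in `[a, b] by rewrite in_itv/= lexx leab.
have [J [pJ Ja UJ VJ]] := fundamental_increment ab intW UV l.
have [C0 C00 bnd] := fundamental_bound ab intP intQ intW UV l.
have [w [pw wa _]] := integrable_primitive leab intW.
have W0 : ae_itv a b (fun t => 0 <= W t).
  by apply: ae_itv1 PW0 => t _ [_ /ltW].
have wmono x y : a <= x -> x <= y -> y <= b -> w x <= w y.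
  by move=> *; exact: (primitive_ge0 pw W0).
have bl i t : t \in `[a, b] -> `|U l i t| <= C0 /\ `|V l i t| <= C0.
  by apply: bnd; rewrite subrr normr0.
have Jb l' i j t : `|l' - l| <= 1 -> t \in `[a, b] ->
    `|J l' i j t| <= C0 ^+ 2 * w b.
  move=> ll'; rewrite in_itv/= => /andP[at_ tb].
  have E : ae_itv a b (fun t => `|W t * (U l i t * U l' j t)| <= C0 ^+ 2 * W t).
    apply: ae_itv1 W0 => s /subset_itv_oo_cc sab Ws; rewrite normrM ger0_norm//.
    rewrite mulrC ler_wpM2r// normrM expr2.
    by apply: ler_pM => //; [exact: (bl _ _ sab).1|exact: (bnd _ _ _ ll'
      sab).1].
  have := primitive_norm_le (pJ l' i j) (primitiveZ _ leab pw) E (lexx a) at_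
    tb.
  rewrite Ja wa mulr0 !subr0 => /le_trans; apply.
  by rewrite ler_wpM2l ?sqr_ge0// wmono.
pose M1 := 2 * (C0 * (C0 ^+ 2 * w b)).
have wb0 : 0 <= w b by rewrite -wa wmono.
have M10 : 0 <= M1 by rewrite !mulr_ge0// ltW// exprn_gt0.
have Ub l' j t : `|l' - l| <= 1 -> t \in `[a, b] ->
    `|U l' j t - U l j t| <= M1 * `|l' - l|.
  move=> ll' tab; rewrite UJ// normrM mulrC ler_wpM2r//.
  rewrite (le_trans (ler_normB _ _))// /M1 mulr_natl mulr2n !normrM.
  by apply: lerD; apply: ler_pM => //; rewrite ?Jb ?(bl _ _ tab).1.
pose M2 := C0 * M1 * w b.
have JB l' i j : `|l' - l| <= 1 ->
    `|J l' i j b - J l i j b| <= M2 * `|l' - l|.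
  move=> ll'.
  have E : ae_itv a b (fun t =>
     `|W t * (U l i t * U l' j t) - W t * (U l i t * U l j t)| <=
     C0 * M1 * `|l' - l| * W t).
    apply: ae_itv1 W0 => s /subset_itv_oo_cc sab Ws.
    rewrite -mulrBr normrM ger0_norm// mulrC ler_wpM2r// -mulrBr normrM -mulrA.
    by apply: ler_pM => //; [exact: (bl _ _ sab).1|exact: Ub].
  have := primitive_norm_le (primitiveB leab (pJ l' i j) (pJ l i j))
    (primitiveZ _ leab pw) E (lexx a) leab (lexx b).
  by rewrite !Ja wa mulr0 !subr0 /M2 => /le_trans; apply; rewrite mulrAC.
have [sym A0 Cpos BAC] := weighted_gram_pos (pJ l) (Ja l).
have D (Z : R -> bool -> R -> R) j :
    (forall l' t, t \in `[a, b] -> Z l' j t - Z l j t = (l' - l) *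
          (Z l false t * J l' true j t - Z l true t * J l' false j t)) ->
    (forall i t, t \in `[a, b] -> `|Z l i t| <= C0) ->
    is_derive l 1 (fun l => Z l j b)
      (Z l false b * J l true j b - Z l true b * J l false j b).
  move=> ZJ Zb; apply: (@is_derive_increment _ _ _ _ (2 * C0 * M2) (fun h =>
    Z l false b * J (l + h) true j b - Z l true b * J (l + h) false j b)).
    by move=> h _; rewrite ZJ// [l + h]addrC addrK.
  move=> h h1.
  have hl : `|l + h - l| <= 1 by rewrite [l + h]addrC addrK.
  rewrite (_ : _ - _ = Z l false b * (J (l + h) true j b - J l true j b) -
    Z l true b * (J (l + h) false j b - J l false j b)); last by ring.
  rewrite (le_trans (ler_normB _ _))// !normrM.
  rewrite (_ : 2 * C0 * M2 * `|h| = C0 * (M2 * `|h|) + C0 * (M2 * `|h|));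
    last ring.
  have JBh i i' : `|J (l + h) i i' b - J l i i' b| <= M2 * `|h|.
    by have := JB _ i i' hl; rewrite [l + h]addrC addrK.
  by apply: lerD; apply: ler_pM => //; first [exact: Zb|exact: JBh].
exists (J l false false b), (J l false true b), (J l true true b).
have bU i t : t \in `[a, b] -> `|U l i t| <= C0 by move=> /(bl i)[].
have bV i t : t \in `[a, b] -> `|V l i t| <= C0 by move=> /(bl i)[].
have DU j := D U j (fun l' => UJ l' j) bU.
have DV j := D V j (fun l' => VJ l' j) bV.
split; split=> //; try exact: DU; try exact: DV.
  by rewrite -sym; exact: DU.
by rewrite -sym; exact: DV.
Qed.

End fundamental_system.
End FundamentalDerivative.

(** * Behaviour as the spectral parameter tends to minus infinity *)

Section Positive.
Context {R : realType}.
Implicit Types (a b x y t l : R) (F G f g P Q W u v : R -> R).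

Lemma primitive_gt0 a b f F : a < b -> primitive a b f F ->
  ae_itv a b (fun t => 0 < f t) -> F a < F b.
Proof.
move=> ab pF f0; have f0' : ae_itv a b (fun t => 0 <= f t).
  by apply: ae_itv1 f0 => t _ /ltW.
have Fm := primitive_ge0 pF f0'.
have leF : F a <= F b by apply: Fm => //; exact: ltW.
rewrite lt_neqAle leF andbT; apply/eqP => Fab.
have := primitive_eq0 pF; move=> /(_ _) h.
have {h} : ae_itv a b (fun t => f t = 0).
  apply: h => t; rewrite in_itv/= => /andP[at_ tb].
  have h1 : F t <= F b by exact: Fm.
  have h2 : F a <= F t by exact: Fm.
  by lra.
move=> fz; have [] := @ae_itv_witness _ a b a b (fun t => False) _ _ ab _ => //.
by apply: ae_itv2 fz f0 => t _ ->; rewrite ltxx.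
Qed.

(** First z w and then z^2 are nondecreasing, with derivatives q z^2 + p w^2 and 2 p z w. So |z| >=
    1, and [z], which starts at 1, cannot change sign. *)
Lemma positive_system_ge1 a b p q z w : a <= b ->
  canonical_system a b p q z w ->
  ae_itv a b (fun t => 0 <= p t) -> ae_itv a b (fun t => 0 <= q t) ->
  z a = 1 -> w a = 0 ->
  forall t, t \in `[a, b] -> 1 <= z t /\ 0 <= w t.
Proof.
move=> ab [pz pw] p0 q0 za wa.
have zw0 t : t \in `[a, b] -> 0 <= z t * w t.
  rewrite in_itv/= => /andP[at_ tb].
  rewrite (_ : 0 = z a * w a); last by rewrite wa mulr0.
  apply: (primitive_ge0 (primitiveM ab pz pw)) => //.
  apply: ae_itv2 p0 q0 => s _ ps qs.
  rewrite (_ : _ + _ = q s * (z s ^+ 2) + p s * (w s ^+ 2)); last by ring.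
  by rewrite addr_ge0// mulr_ge0// sqr_ge0.
have zz1 t : t \in `[a, b] -> 1 <= z t * z t.
  rewrite in_itv/= => /andP[at_ tb].
  rewrite (_ : 1 = z a * z a); last by rewrite za mulr1.
  apply: (primitive_ge0 (primitiveM ab pz pz)) => //.
  apply: ae_itv1 p0 => s /subset_itv_oo_cc sab ps.
  rewrite (_ : _ + _ = p s * (2 * (z s * w s))); last by ring.
  by apply: mulr_ge0 => //; apply: mulr_ge0 => //; exact: zw0.
have z1 t : t \in `[a, b] -> 1 <= z t.
  move=> tab; rewrite leNgt; apply/negP => zt1.
  have zt : z t <= -1 by have := zz1 t tab; nra.
  move: tab; rewrite in_itv/= => /andP[at_ tb].
  have [|s sat zs] := @IVT _ z a t 0 at_ (ac_continuous (ac_sub pz.1 (lexx a)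
    tb)).
    have zt0 : z t <= 0 by lra.
    by rewrite za ge_min le_max ler01 zt0 orbT.
  have := zz1 s; rewrite zs mulr0 ler10 => h; suff : false by [].
  by apply: h; move: sat; rewrite !in_itv/= => /andP[-> /le_trans ->].
move=> t tab; split; first exact: z1.
move: tab; rewrite in_itv/= => /andP[at_ tb]; rewrite -wa.
apply: (primitive_ge0 pw) => //; apply: ae_itv1 q0 => s /subset_itv_oo_cc sab
  qs.
by rewrite mulr_ge0// (le_trans ler01)// z1.
Qed.

(** For large [s] the component [w] dominates at [b]. Over a short last interval [[t0, b]], [z]
    gains at most w(b) times the integral of p, hence at most w(b) eps / 2; and w(b) is at least s
    z(t0) times the integral of om, which bounds z(t0) by w(b) eps / 2 too. The threshold [s0]
    depends on [p], [om] and [eps] only. *)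
Lemma positive_system_ratio a b p om Pi Om (eps : R) : a < b ->
  primitive a b p Pi -> primitive a b om Om ->
  ae_itv a b (fun t => 0 < p t) -> ae_itv a b (fun t => 0 < om t) -> 0 < eps ->
  exists2 s0, 0 < s0 & forall s q z w, s0 <= s ->
    canonical_system a b p q z w -> ae_itv a b (fun t => s * om t <= q t) ->
    (forall t, t \in `[a, b] -> 0 <= z t /\ 0 <= w t) ->
    z b <= eps * w b.
Proof.
move=> ab pPi pOm p0 om0 e0.
have p0' : ae_itv a b (fun t => 0 <= p t) by apply: ae_itv1 p0 => t _ /ltW.
have e20 : 0 < eps / 2 by lra.
have [d d0 dP] := ac_pieces pPi.1 e20.
pose t0 := Num.max ((a + b) / 2) (b - d / 2).
have at0 : a < t0 by rewrite /t0 lt_max; apply/orP; left; lra.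
have t0b : t0 < b by rewrite /t0 gt_max; apply/andP; split; lra.
have dt0 : b - t0 < d.
  by have : b - d / 2 <= t0; [rewrite /t0 le_max lexx orbT|lra].
have Pit : Pi b - Pi t0 <= eps / 2.
  apply/ltW; apply: le_lt_trans (ler_norm _) _.
  have := dP [:: (t0, b)]; rewrite /= lexx !ltW// => /(_ isT).
  by rewrite !big_cons !big_nil /= !addr0; apply.
have Omt : Om t0 < Om b.
  apply: (primitive_gt0 t0b (primitive_sub (ltW at0) (lexx b) pOm)).
  exact: ae_itv_sub (ltW at0) (lexx b) om0.
have dO : 0 < Om b - Om t0 by rewrite subr_gt0.
exists (2 / (eps * (Om b - Om t0))); first by rewrite divr_gt0// mulr_gt0.
move=> s q z w ss [pz pw] qom zw0.
have s0 : 0 < s by apply: lt_le_trans ss; rewrite divr_gt0// mulr_gt0.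
have q0 : ae_itv a b (fun t => 0 <= q t).
  apply: ae_itv2 qom om0 => t _ qt ot; apply: le_trans qt.
  by rewrite mulr_ge0// ltW.
have zm x y : a <= x -> x <= y -> y <= b -> z x <= z y.
  apply: (primitive_ge0 pz); apply: ae_itv1 p0' => t /subset_itv_oo_cc tab pt.
  by rewrite mulr_ge0//; have [] := zw0 t tab.
have wm x y : a <= x -> x <= y -> y <= b -> w x <= w y.
  apply: (primitive_ge0 pw); apply: ae_itv1 q0 => t /subset_itv_oo_cc tab qt.
  by rewrite mulr_ge0//; have [] := zw0 t tab.
have t0ab : t0 \in `[a, b] by rewrite in_itv/= !ltW.
have [zt0 wt0] := zw0 t0 t0ab.
have sub t : t \in `]t0, b[ -> [/\ a <= t, t0 <= t, t <= b & t \in `[a, b]].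
  rewrite !in_itv/= => /andP[t0t tb]; split; rewrite ?ltW//.
    exact: lt_trans t0t.
  by rewrite (lt_trans at0 t0t).
have h1 : s * z t0 * (Om b - Om t0) <= w b.
  have := primitive_le (primitiveZ (s * z t0) (ltW t0b)
    (primitive_sub (ltW at0) (lexx b) pOm))
    (primitive_sub (ltW at0) (lexx b) pw) _ (lexx t0) (ltW t0b) (lexx b).
  rewrite -mulrBr => h; have {h} : s * z t0 * (Om b - Om t0) <= w b - w t0.
    apply: h.
    have := ae_itv2 _ (ae_itv_sub (ltW at0) (lexx b) qom)
      (ae_itv_sub (ltW at0) (lexx b) om0); apply.
    move=> t /sub[at_ t0t tb tab] qt ot.
    rewrite mulrAC; apply: ler_pM => //; last exact: zm (ltW at0) t0t tb.
    by rewrite mulr_ge0// ltW.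
  by move: wt0; lra.
have h2 : z b - z t0 <= w b * (Pi b - Pi t0).
  have := primitive_le (primitive_sub (ltW at0) (lexx b) pz)
    (primitiveZ (w b) (ltW t0b) (primitive_sub (ltW at0) (lexx b) pPi))
    _ (lexx t0) (ltW t0b) (lexx b).
  rewrite -mulrBr; apply.
  apply: ae_itv1 (ae_itv_sub (ltW at0) (lexx b) p0') => t /sub[at_ t0t tb tab]
    pt.
  by rewrite mulrC ler_wpM2r// wm.
have wb0 : 0 <= w b by apply: (zw0 b _).2; rewrite in_itv/= lexx ltW.
have h3 : 2 * z t0 <= eps * w b.
  rewrite ler_pdivrMr ?mulr_gt0// in ss.
  have : z t0 * 2 <= z t0 * (s * (eps * (Om b - Om t0))) by rewrite ler_wpM2l.
  have : eps * (s * z t0 * (Om b - Om t0)) <= eps * w b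
    by rewrite ler_wpM2l// ltW.
  by lra.
have : w b * (Pi b - Pi t0) <= w b * (eps / 2) by rewrite ler_wpM2l.
by lra.
Qed.

Section asymptotics.
Variables (a b : R) (P Q W : R -> R).
Hypotheses (ab : a < b) (intP : integrable_itv a b P)
  (intQ : integrable_itv a b Q) (intW : integrable_itv a b W)
  (PW0 : ae_itv a b (fun t => 0 < P t /\ 0 < W t)).

Let leab : a <= b := ltW ab.

Variables U V : R -> bool -> R -> R.
Hypothesis UV : forall l i,
  [/\ canonical_system a b P (fun t => Q t - l * W t) (U l i) (V l i),
      U l i a = (~~ i)%:R & V l i a = i%:R].

(* The lower triangular gauge [u = e^L z], [v = m e^L z + e^-L w], where
   [m' = - E] and [L' = P m], turns the equation into [z' = p w], [w' = q z]
   with nonnegative [p] and [q], for all sufficiently negative [l]. *)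
Lemma fundamental_asymptotics (kap : R) : 0 <= kap -> exists2 e, 0 < e &
  exists m, forall eps, 0 < eps -> exists l0, forall l, l <= l0 ->
    let u1 := U l false b - kap * U l true b in
    let v1 := V l false b - kap * V l true b in
    [/\ 1 <= u1 / e, u1 / e <= eps * (e * (v1 - m * u1)),
        0 < U l true b / e, 1 <= e * (V l true b - m * U l true b) &
        U l true b / e <= eps * (e * (V l true b - m * U l true b))].
Proof.
(* [m] will stay between [- kap - 1] and [- kap], so [La] bounds |m|. Subtracting [La ^+ 2 * P] from
   the potential in advance pays for the term - m^2 P that the gauge creates. *)
move=> kap0; pose La := kap + 1.
have P0 : ae_itv a b (fun t => 0 < P t) by apply: ae_itv1 PW0 => t _ [].
have W0 : ae_itv a b (fun t => 0 < W t) by apply: ae_itv1 PW0 => t _ [].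
have intQ' : integrable_itv a b (fun t => Q t + - La ^+ 2 * P t).
  by apply: integrable_itvD => //; exact: integrable_itvZ.
have [k [E [e [k0 pe E0 QE [ea e1]]]]] := integrable_negative_part leab intQ'
  intW W0.
pose m t := - kap - e t.
have pm : primitive a b (fun t => - E t) m.
  have := primitiveB leab (primitive_cst a b (- kap)) pe.
  by apply: primitive_ext => t; rewrite sub0r.
have ma : m a = - kap by rewrite /m ea subr0.
have mP t : t \in `[a, b] -> m t ^+ 2 <= La ^+ 2.
  rewrite in_itv/= => /andP[at_ tb].
  have h1 : e a <= e t by exact: primitive_ge0 pe E0 _ _ _.
  have h2 : e t <= e b by exact: primitive_ge0 pe E0 _ _ _.
  by rewrite /m /La; nra.
have [L [pL La0 _]] := integrable_primitive leab (integrable_itvM leab intP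
  pm.1).
have peL := primitive_expR leab pL.
have peNL := primitive_expR leab (primitiveN leab pL).
pose p t := P t * (expR (- L t) * expR (- L t)).
pose om t := W t * (expR (L t) * expR (L t)).
have intp : integrable_itv a b p.
  by apply: integrable_itvM => //; exact: (acM leab peNL.1 peNL.1).
have intom : integrable_itv a b om.
  by apply: integrable_itvM => //; exact: (acM leab peL.1 peL.1).
have [Pi [pPi _ _]] := integrable_primitive leab intp.
have [Om [pOm _ _]] := integrable_primitive leab intom.
have p0 : ae_itv a b (fun t => 0 < p t).
  by apply: ae_itv1 P0 => t _ Pt; rewrite !mulr_gt0// expR_gt0.
have om0 : ae_itv a b (fun t => 0 < om t).
  by apply: ae_itv1 W0 => t _ Pt; rewrite !mulr_gt0// expR_gt0.
exists (expR (L b)); first exact: expR_gt0.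
exists (m b) => eps eps0.
have [s0 s00 sP] := positive_system_ratio ab pPi pOm p0 om0 eps0.
exists (- k - s0) => l ll0.
have ls : s0 <= - l - k by lra.
pose q t := (Q t - l * W t + E t - m t ^+ 2 * P t) * (expR (L t) * expR (L t)).
have qom : ae_itv a b (fun t => (- l - k) * om t <= q t).
  apply: ae_itv2 QE P0 => t /subset_itv_oo_cc /mP mt Qt Pt.
  rewrite /q /om [leLHS]mulrA; apply: ler_wpM2r.
    by rewrite mulr_ge0 ?expR_ge0.
  have : m t ^+ 2 * P t <= La ^+ 2 * P t by rewrite ler_wpM2r// ltW.
  by lra.
have q0 : ae_itv a b (fun t => 0 <= q t).
  apply: ae_itv2 qom om0 => t _ qt ot; apply: le_trans qt.
  by rewrite mulr_ge0 ?ltW//; lra.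
have p0' : ae_itv a b (fun t => 0 <= p t) by apply: ae_itv1 p0 => t _ /ltW.
have gauge u v : canonical_system a b P (fun t => Q t - l * W t) u v ->
    canonical_system a b p q (fun t => expR (- L t) * u t)
      (fun t => expR (L t) * (v t - m t * u t)).
  move=> [pu pv]; split.
    apply: primitive_ext (primitiveM leab peNL pu) => t; rewrite /p.
    have -> : P t * (expR (- L t) * expR (- L t)) *
        (expR (L t) * (v t - m t * u t)) =
      P t * expR (- L t) * (v t - m t * u t) * (expR (- L t) * expR (L t))
        by ring.
    by rewrite -expRD addNr expR0; ring.
  apply: primitive_ext
    (primitiveM leab peL (primitiveB leab pv (primitiveM leab pm pu))) => t.
  rewrite /q.
  have -> : (Q t - l * W t + E t - m t ^+ 2 * P t) * (expR (L t) * expR (L t)) *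
     (expR (- L t) * u t) = (Q t - l * W t + E t - m t ^+ 2 * P t) *
       expR (L t) * u t * (expR (L t) * expR (- L t)) by ring.
  by rewrite -expRD subrr expR0; ring.
have bab : b \in `[a, b] by rewrite in_itv/= lexx leab.
have [s1 u1 v1] := UV l false; have [s2 u2 v2] := UV l true.
(* This solution starts at (1, - kap), and [m a = - kap], so its gauged form starts at z = 1, w = 0.
   The second column starts at z = 0, w = 1 and is treated with the components exchanged ([g2']). *)
have g1 := gauge _ _ (canonical_systemD 1 (- kap) leab s1 s2).
have g2 := gauge _ _ s2.
have h1 := positive_system_ge1 leab g1 p0' q0.
have {}h1 t : t \in `[a, b] -> _ := h1 _ _ t.
have g2' : canonical_system a b q p _ _ := conj g2.2 g2.1.
have h2 := positive_system_ge1 leab g2' q0 p0'.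
rewrite /= La0 ma oppr0 expR0 u1 v1 u2 v2 /= in h1 h2.
have {}h1 := h1 ltac:(ring) ltac:(ring).
have {}h2 := h2 ltac:(ring) ltac:(ring).
have h1' t (tab : t \in `[a, b]) := h1 t tab.
have r1 := sP _ _ _ _ ls g1 qom (fun t tab => conj
  (le_trans ler01 (h1 t tab).1) (h1 t tab).2).
have r2 := sP _ _ _ _ ls g2 qom (fun t tab => conj (h2 t tab).2
  (le_trans ler01 (h2 t tab).1)).
have z2 : 0 < expR (- L b) * U l true b.
  have h := primitive_le pPi g2.1 _ (lexx a) leab (lexx b).
  have Piab := primitive_gt0 ab pPi p0.
  rewrite u2 mulr0 subr0 in h; rewrite -subr_gt0 in Piab.
  apply: lt_le_trans Piab _; apply: h.
  apply: ae_itv1 p0' => t /subset_itv_oo_cc tab pt.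
  by rewrite ler_peMr//; have [] := h2 t tab.
have [h1b _] := h1 b bab; have [h2b _] := h2 b bab.
move: h1b h2b r1 r2 z2; rewrite /= expRN !mul1r !mulNr !(mulrC _^-1).
by split.
Qed.

End asymptotics.
End Positive.

(** * Curves in SL(2, R) rotating in a fixed direction *)

Section RealFunctions.
Context {R : realType}.
Implicit Types (x y z t e d : R) (f : R -> R).

Lemma is_derive_continuous f x d : is_derive x 1 f d -> {for x, continuous f}.
Proof.
move=> df; apply: differentiable_continuous; apply/derivable1_diffP.
exact: ex_derive.
Qed.

Lemma continuous_near f x e : {for x, continuous f} -> 0 < e ->
  exists2 d, 0 < d & forall t, x - d < t < x + d -> `|f t - f x| < e.
Proof.
move=> cf e0; have /cvgrPdist_lt /(_ e e0)[d /= d0 dP] := cf.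
exists d => // t /andP[t1 t2]; rewrite distrC; apply: dP => /=.
by rewrite ltr_norml; apply/andP; split; lra.
Qed.

Lemma is_derive_gt0 f x d : is_derive x 1 f d -> 0 < d ->
  exists2 e, 0 < e & forall t, (x < t < x + e -> f x < f t) /\
    (x - e < t < x -> f t < f x).
Proof.
move=> df d0; have dF : derivable f x 1 by exact: ex_derive.
have cF : h^-1 *: (f (h *: 1 + x) - f x) @[h --> 0^'] --> d.
  by rewrite -(@derive_val _ _ _ _ _ _ _ df); exact: dF.
move/cvgrPdist_lt: cF => /(_ d d0); rewrite near_withinE => -[r /= r0 rP].
have incr h : `|h| < r -> h != 0 -> 0 < h^-1 * (f (x + h) - f x).
  move=> hr h0; have := rP h; rewrite /ball/= sub0r normrN => /(_ hr h0).
  rewrite /GRing.scale/= mulr1 (addrC h) ltr_norml => /andP[_].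
  by lra.
exists r => // t; split => /andP[t1 t2].
  have h0 : 0 < t - x by lra.
  have := incr (t - x); rewrite gtr0_norm// gt_eqF// subrKC => h.
  have {h} : 0 < (t - x)^-1 * (f t - f x) by apply: h => //; lra.
  by rewrite pmulr_rgt0 ?invr_gt0// subr_gt0.
have h0 : t - x < 0 by lra.
have := incr (t - x); rewrite ltr0_norm// lt_eqF// subrKC => h.
have {h} : 0 < (t - x)^-1 * (f t - f x) by apply: h => //; lra.
by rewrite nmulr_rgt0 ?invr_lt0// subr_lt0.
Qed.

Lemma is_derive_lt0 f x d : is_derive x 1 f d -> d < 0 ->
  exists2 e, 0 < e & forall t, (x < t < x + e -> f t < f x) /\
    (x - e < t < x -> f x < f t).
Proof.
move=> df d0; have df' : is_derive x 1 (- f) (- d) by exact: is_deriveN.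
have d0' : 0 < - d by lra.
have [e e0 eP] := is_derive_gt0 df' d0'; exists e => // t.
by have := eP t; rewrite !fctE !ltrN2.
Qed.

Lemma between_near_left x z e : x < z -> 0 < e ->
  exists2 t, x < t < z & z - e < t.
Proof.
move=> xz e0; exists (Num.max ((x + z) / 2) (z - e / 2)).
  by rewrite lt_max gt_max !midf_lt//= gtrBl divr_gt0.
by rewrite lt_max; apply/orP; right; lra.
Qed.

Lemma between_near_right x z e : x < z -> 0 < e ->
  exists2 t, x < t < z & t < x + e.
Proof.
move=> xz e0; exists (Num.min ((x + z) / 2) (x + e / 2)).
  by rewrite lt_min gt_min !midf_lt//= ltrDl divr_gt0.
by rewrite gt_min; apply/orP; right; lra.
Qed.

(** The gap of length [e] keeps the infimum of the zeros strictly to the right of [x], where [f]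
    itself may vanish. *)
Lemma first_zero f x y e : continuous f -> 0 < e ->
  (forall t, x < t < x + e -> f t != 0) -> x < y -> f y = 0 ->
  exists z, [/\ x < z, z <= y, f z = 0 & forall t, x < t < z -> f t != 0].
Proof.
move=> cf e0 nf xy fy; pose S := [set t | x < t /\ f t = 0].
have Sxe t : S t -> x + e <= t.
  by move=> [xt ft]; rewrite leNgt; apply/negP => te; have := nf t;
    rewrite xt te ft eqxx => /(_ isT).
have hS : has_inf S by split; [exists y|exists (x + e) => t /Sxe].
have infS t : S t -> inf S <= t by move=> St; apply: (inf_lbound hS.2).
have xz : x + e <= inf S by apply: lb_le_inf; [exists y|move=> t /Sxe].
exists (inf S); split.
- by apply: lt_le_trans xz; lra.
- exact: infS.
- apply/eqP; apply: contrapT => /negP fz.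
  have fz0 : 0 < `|f (inf S)| by rewrite normr_gt0.
  have [d d0 dP] := continuous_near (cf (inf S)) fz0.
  have [t St td] := inf_adherent d0 hS.
  have := dP t; rewrite St.2 sub0r normrN ltxx; apply/implyP.
  by have := infS t St; rewrite td; lra.
- move=> t /andP[xt tz]; apply/eqP => ft.
  by move: tz; rewrite ltNge infS.
Qed.

Lemma ivt_zero f x y : continuous f -> x <= y -> 0 <= f x -> f y <= 0 ->
  exists2 z, x <= z <= y & f z = 0.
Proof.
move=> cf xy fx fy.
have [|z zxy fz] := @IVT _ f x y 0 xy (continuous_subspaceT cf).
  by rewrite ge_min le_max fx fy orbT.
by exists z => //; rewrite in_itv in zxy.
Qed.

Lemma nonzero_sign f x z s t : continuous f ->
  (forall t, x < t < z -> f t != 0) -> x < s < z -> x < t < z ->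
  0 < f s -> 0 < f t.
Proof.
move=> cf nf /andP[xs sz] /andP[xt tz] fs; rewrite ltNge; apply/negP => ft.
have cNf : continuous (fun x => - f x) by move=> u; apply: cvgN; exact: cf.
have [u /andP[u1 u2] fu] : exists2 u, Num.min s t <= u <= Num.max s t & f u = 0.
  have [st|/ltW ts] := leP s t; first by apply: ivt_zero => //; exact: ltW.
  have [||u uts /eqP] := @ivt_zero (fun x => - f x) t s cNf ts.
  - by rewrite oppr_ge0.
  - by rewrite oppr_le0 ltW.
  by rewrite oppr_eq0 => /eqP; exists u.
have := nf u; rewrite fu eqxx; apply/implyP.
rewrite (lt_le_trans _ u1) ?lt_min ?xs//= (le_lt_trans u2)// gt_max sz.
by [].
Qed.

Lemma decreasing_zero_unique f x y s t : continuous f ->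
  (forall u, x <= u <= y -> f u = 0 -> exists2 d, d < 0 & is_derive u 1 f d) ->
  x <= s <= y -> x <= t <= y -> f s = 0 -> f t = 0 -> s = t.
Proof.
move=> cf df; wlog st : s t / s < t.
  move=> h sxy txy fs ft; have [st|ts|//] := ltgtP s t; first exact: h.
  by apply/esym; exact: h.
move=> /andP[xs sy] /andP[xt ty] fs ft; exfalso.
have [d d0 dfs] := df s (introT andP (conj xs sy)) fs.
have [e e0 eP] := is_derive_lt0 dfs d0.
have nf u : s < u < s + e -> f u != 0.
  by move=> /(eP u).1; rewrite fs => /lt_eqF ->.
have [z [sz zt fz nfz]] := first_zero cf e0 nf st ft.
have [|d' d'0 dfz] := df z _ fz.
  by rewrite (le_trans xs (ltW sz)) (le_trans zt ty).
have [e' e'0 e'P] := is_derive_lt0 dfz d'0.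
have [u1 su1z u1e] := between_near_right sz e0.
have [u2 su2z e'u2] := between_near_left sz e'0.
have /andP[su1 _] := su1z; have /andP[_ u2z] := su2z.
have f1 : f u1 < 0 by rewrite -fs; apply: (eP u1).1; rewrite su1.
have f2 : 0 < f u2 by rewrite -fz; apply: (e'P u2).2; rewrite e'u2.
by have := nonzero_sign cf nfz su2z su1z f2; rewrite ltNge ltW.
Qed.

End RealFunctions.

(** * Local behaviour of the trace and of the off-diagonal entries *)

Section Rotating.
Context {R : realType}.
Implicit Types (x y z t e d : R).

(* A curve [N] in SL(2, R) with [N' = N G], where [G] is the infinitesimal
   rotation [[B, C], [- A, - B]] of a positive definite form. *)
Definition rotating (n11 n12 n21 n22 : R -> R) : Prop :=
  (forall x, n11 x * n22 x - n12 x * n21 x = 1) /\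
  forall x, exists A B C : R, [/\ 0 < A, 0 < C & B ^+ 2 < A * C] /\
    [/\ is_derive x 1 n11 (n11 x * B - n12 x * A),
        is_derive x 1 n12 (n11 x * C - n12 x * B),
        is_derive x 1 n21 (n21 x * B - n22 x * A) &
        is_derive x 1 n22 (n21 x * C - n22 x * B)].

Lemma rotatingN n11 n12 n21 n22 : rotating n11 n12 n21 n22 ->
  rotating (fun x => - n11 x) (fun x => - n12 x) (fun x => - n21 x)
    (fun x => - n22 x).
Proof.
move=> [det1 rot]; split=> x; first by rewrite !mulrNN.
have [A [B [C [ABC [d11 d12 d21 d22]]]]] := rot x.
by exists A, B, C; split=> //; split; apply: is_derive_eq; ring.
Qed.

Section curve.
Variables n11 n12 n21 n22 : R -> R.
Hypothesis rot : rotating n11 n12 n21 n22.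

Let det1 x : n11 x * n22 x - n12 x * n21 x = 1. Proof. exact: rot.1. Qed.

Definition trace x := n11 x + n22 x.

Lemma continuous_n12 : continuous n12.
Proof.
move=> x; have [A [B [C [_ [_ d _ _]]]]] := rot.2 x;
  exact: is_derive_continuous d.
Qed.

Lemma continuous_n21 : continuous n21.
Proof.
move=> x; have [A [B [C [_ [_ _ d _]]]]] := rot.2 x;
  exact: is_derive_continuous d.
Qed.

Lemma continuous_trace : continuous trace.
Proof.
move=> x; have [A [B [C [_ [d _ _ d']]]]] := rot.2 x.
by apply: cvgD; [exact: is_derive_continuous d|exact: is_derive_continuous d'].
Qed.

(** At such a zero det N = 1 reads n11 n22 = 1, so [n11] has the sign of the trace, while the
    derivative reduces to n11 C. *)
Lemma n12_zero_derive x : n12 x = 0 ->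
  exists2 d, 0 < trace x * d & is_derive x 1 n12 d.
Proof.
move=> nx; have [A [B [C [[A0 C0 _] [_ d _ _]]]]] := rot.2 x.
exists (n11 x * C - n12 x * B) => //; have := det1 x; rewrite /trace nx.
move=> h; have {}h : n11 x * n22 x = 1 by lra.
have -> : (n11 x + n22 x) * (n11 x * C - 0 * B) = C * (n11 x ^+ 2 + n11 x * n22
  x).
  by ring.
by rewrite mulr_gt0// h; have := sqr_ge0 (n11 x); lra.
Qed.

Lemma n21_zero_derive x : n21 x = 0 ->
  exists2 d, trace x * d < 0 & is_derive x 1 n21 d.
Proof.
move=> nx; have [A [B [C [[A0 C0 _] [_ _ d _]]]]] := rot.2 x.
exists (n21 x * B - n22 x * A) => //; have := det1 x; rewrite /trace nx.
move=> h; have {}h : n11 x * n22 x = 1 by lra.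
have -> : (n11 x + n22 x) * (0 * B - n22 x * A) = - (A * (n22 x ^+ 2 + n11 x *
  n22 x)).
  by ring.
by rewrite oppr_lt0 mulr_gt0// h; have := sqr_ge0 (n22 x); lra.
Qed.

(** The discriminant of the characteristic polynomial, written in two ways. In particular n12 n21 <
    0 wherever |tr N| < 2. *)
Lemma trace_sqr x : trace x ^+ 2 - 4 = (n11 x - n22 x) ^+ 2 + 4 * (n12 x * n21
  x).
Proof. by have := det1 x; rewrite /trace; lra. Qed.

Lemma n12_zero_trace x : n12 x = 0 -> 4 <= trace x ^+ 2.
Proof.
move=> nx; have := trace_sqr x; rewrite nx; have := sqr_ge0 (n11 x - n22 x);
  lra.
Qed.

Lemma n21_zero_trace x : n21 x = 0 -> 4 <= trace x ^+ 2.
Proof.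
move=> nx; have := trace_sqr x; rewrite nx; have := sqr_ge0 (n11 x - n22 x);
  lra.
Qed.

(* The derivative of the trace is a value of the definite form, with the sign
   of [n21]; it vanishes only at the points where [N = 1] or [N = - 1]. *)
Lemma trace_derive x : trace x ^+ 2 <= 4 -> ~ (n12 x = 0 /\ n21 x = 0) ->
  exists d, [/\ is_derive x 1 trace d, d != 0, d < 0 -> 0 <= n12 x /\ n21 x <=
    0 &
    0 < d -> n12 x <= 0 /\ 0 <= n21 x].
Proof.
move=> tr nz; have [A [B [C [[A0 C0 BAC] [d1 _ _ d4]]]]] := rot.2 x.
have trs := trace_sqr x.
set a := n11 x in d1 d4 trs *; set b := n12 x in d1 d4 trs nz *.
set c := n21 x in d1 d4 trs nz *; set e := n22 x in d1 d4 trs *.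
pose X := a - e.
have bc : 4 * (b * c) + X ^+ 2 <= 0 by rewrite /X; lra.
exists (c * C + X * B - b * A).
have dt : is_derive x 1 trace (c * C + X * B - b * A).
  have -> : trace = n11 \+ n22 by [].
  by apply: is_derive_eq; rewrite /X; ring.
(* If [n21] vanishes, so does n11 - n22, and the derivative is - n12 A. *)
have [c0|c0] := eqVneq c 0.
  have X0 : X = 0.
    apply/eqP; rewrite -sqrf_eq0; apply/eqP.
    by have := sqr_ge0 X; rewrite c0 in bc; lra.
  have b0 : b != 0 by apply/eqP => b0; apply: nz.
  rewrite c0 X0 !mul0r !add0r in dt *; split=> //.
  - by rewrite oppr_eq0 mulf_neq0// gt_eqF.
  - by rewrite oppr_lt0 pmulr_lgt0// => /ltW.
  - by rewrite oppr_gt0 pmulr_llt0// => /ltW.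
(* By [bc], - b c is at least X^2 / 4, so c times the derivative is at least C c^2 + B X c + A X^2 /
   4, the positive definite form at (c, X / 2). *)
have h1 : 0 < c * (c * C + X * B - b * A).
  have q : 0 < c ^+ 2 * C + X * B * c + A * (X ^+ 2 / 4).
    have : 0 < C * (c ^+ 2 * C + X * B * c + A * (X ^+ 2 / 4)).
      have -> : C * (c ^+ 2 * C + X * B * c + A * (X ^+ 2 / 4)) =
        (C * c + B * X / 2) ^+ 2 + (A * C - B ^+ 2) * (X / 2) ^+ 2 by field.
      have hX := sqr_ge0 (X / 2); have hc := sqr_ge0 (C * c + B * X / 2).
      have [X0|X0] := eqVneq X 0.
        have : 0 < (C * c) ^+ 2 by rewrite exprn_even_gt0//= mulf_neq0// gt_eqF.
        by rewrite X0; lra.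
      have : 0 < (A * C - B ^+ 2) * (X / 2) ^+ 2.
        by rewrite mulr_gt0 ?subr_gt0// exprn_even_gt0//= mulf_neq0// invr_eq0.
      by lra.
    by rewrite pmulr_rgt0.
  have : A * (X ^+ 2 / 4) <= A * (- (b * c)).
    by rewrite ler_wpM2l ?(ltW A0)//; lra.
  by lra.
have dn : c * C + X * B - b * A != 0.
  by apply/eqP => h; rewrite h mulr0 ltxx in h1.
have X2 := sqr_ge0 X.
split=> // hd.
  have c1 : c < 0 by rewrite nmulr_lgt0 in h1.
  split; last exact: ltW.
  rewrite leNgt; apply/negP => b0.
  have bc0 : 0 < b * c by rewrite nmulr_lgt0.
  by lra.
have c1 : 0 < c by rewrite pmulr_lgt0 in h1.
split; last exact: ltW.
rewrite leNgt; apply/negP => b0.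
have bc0 : 0 < b * c by rewrite mulr_gt0.
by lra.
Qed.

(** The first derivative of the trace vanishes here, and only first derivatives of [N] are
    available. But [trace_sqr] makes tr^2 - 4 quadratic in functions that vanish at [x]; divided by
    (t - x)^2 it tends to 4 (B^2 - A C) < 0. *)
Lemma trace_near_scalar x : trace x ^+ 2 = 4 -> n12 x = 0 -> n21 x = 0 ->
  exists2 e, 0 < e & forall t, t != x -> x - e < t < x + e -> trace t ^+ 2 < 4.
Proof.
move=> tr b0 c0; have [A [B [C [[A0 C0 BAC] [d1 d2 d3 d4]]]]] := rot.2 x.
have trs := trace_sqr x; have det := det1 x.
rewrite b0 c0 in d1 d2 d3 d4 trs det.
have ae : n11 x = n22 x.
  apply/eqP; rewrite -subr_eq0 -sqrf_eq0; apply/eqP; lra.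
have a1 : n22 x ^+ 2 = 1 by rewrite ae in det; lra.
pose sl (f : R -> R) h := h^-1 *: (f (h *: (1 : R) + x) - f x).
have slope (f : R -> R) d : is_derive x 1 f d -> sl f h @[h --> 0^'] --> d.
  move=> df; have dF : derivable f x 1 by exact: ex_derive.
  by rewrite -(@derive_val _ _ _ _ _ _ _ df); exact: dF.
have dX : is_derive x 1 (fun t => n11 t - n22 t) (2 * n22 x * B).
  by apply: is_derive_eq; rewrite ae; ring.
have sX := slope _ _ dX; have s2 := slope _ _ d2; have s3 := slope _ _ d3.
have cq : sl (fun t => n11 t - n22 t) h * sl (fun t => n11 t - n22 t) h +
    4 * sl n12 h * sl n21 h @[h --> 0^'] --> 2 * n22 x * B * (2 * n22 x * B) +
    4 * (n11 x * C - 0 * B) * (0 * B - n22 x * A).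
  by apply: cvgD; apply: cvgM => //; apply: cvgM => //; exact: cvg_cst.
have lim_lt0 : 2 * n22 x * B * (2 * n22 x * B) +
    4 * (n11 x * C - 0 * B) * (0 * B - n22 x * A) < 0.
  have -> : 2 * n22 x * B * (2 * n22 x * B) +
    4 * (n11 x * C - 0 * B) * (0 * B - n22 x * A) =
    4 * (n22 x ^+ 2) * (B ^+ 2 - A * C) by rewrite ae; ring.
  by rewrite a1; lra.
set q := (X in X < 0) in lim_lt0; rewrite -/q in cq.
have nq0 : 0 < - q by rewrite oppr_gt0.
move/cvgrPdist_lt: cq => /(_ _ nq0); rewrite near_withinE => -[e /= e0 eP].
exists e => // t tx /andP[xe te].
have h0 : t - x != 0 by rewrite subr_eq0.
have := eP (t - x); rewrite /ball/= sub0r normrN => /(_ _ h0).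
have -> : `|t - x| < e by rewrite ltr_norml; apply/andP; split; lra.
rewrite /sl /GRing.scale /= mulr1 subrK b0 c0 ae subrr !subr0 => /(_ isT).
rewrite ltr_norml => /andP[h _].
have {h} : (t - x)^-1 * (n11 t - n22 t) * ((t - x)^-1 * (n11 t - n22 t)) +
  4 * ((t - x)^-1 * n12 t) * ((t - x)^-1 * n21 t) < 0 by move: h; rewrite /q;
    lra.
have -> : (t - x)^-1 * (n11 t - n22 t) * ((t - x)^-1 * (n11 t - n22 t)) +
  4 * ((t - x)^-1 * n12 t) * ((t - x)^-1 * n21 t) =
  (t - x)^-1 ^+ 2 * (trace t ^+ 2 - 4) by rewrite trace_sqr; ring.
rewrite pmulr_rlt0 ?subr_lt0//.
by rewrite exprn_even_gt0//= invr_eq0.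
Qed.

End curve.
End Rotating.

(** * One sweep of the trace from 2 to - 2 *)

Section HalfStep.
Context {R : realType}.
Implicit Types (x y z t e d : R).

(** Just before an upward crossing [f] is not positive, which forces an earlier zero; but all zeros
    have positive slope, and two such zeros cannot coexist. *)
Lemma no_zero_of_increasing (f : R -> R) x y : continuous f -> 0 < f x ->
  (forall u, x <= u <= y -> f u = 0 -> exists2 d, 0 < d & is_derive u 1 f d) ->
  forall s, x <= s <= y -> f s != 0.
Proof.
move=> cf fx df s /andP[xs sy]; apply/eqP => fs.
have {}xs : x < s.
  by rewrite lt_neqAle xs andbT; apply/eqP => xs'; rewrite xs' fs ltxx in fx.
have [|d d0 dfs] := df s _ fs; first by rewrite (ltW xs).
have [e e0 eP] := is_derive_gt0 dfs d0.
have [u /andP[/ltW xu us] eu] := between_near_left xs e0.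
have fu : f u <= 0 by rewrite -fs; apply/ltW/(eP u).2; rewrite eu.
have [z /andP[xz zu] fz] := ivt_zero cf xu (ltW fx) fu.
have zs : z < s := le_lt_trans zu us.
have cNf : continuous (fun x => - f x) by move=> w; apply: cvgN; exact: cf.
suff zsE : z = s by rewrite zsE ltxx in zs.
apply: (decreasing_zero_unique cNf (x := x) (y := y)); rewrite ?fz ?fs ?oppr0//.
- move=> w wxy /eqP; rewrite oppr_eq0 => /eqP /(df w wxy)[d' d'0 dw].
  by exists (- d'); [rewrite oppr_lt0|exact: is_deriveN].
- by rewrite xz (le_trans (ltW zs)).
- by rewrite (ltW xs).
Qed.

Section curve.
Variables n11 n12 n21 n22 : R -> R.
Hypothesis rot : rotating n11 n12 n21 n22.

Let tr := trace n11 n22.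

Let ctr : continuous tr. Proof. exact: continuous_trace rot. Qed.
Let c12 : continuous n12. Proof. exact: continuous_n12 rot. Qed.
Let c21 : continuous n21. Proof. exact: continuous_n21 rot. Qed.

Lemma trace_mvt x y : x < y -> exists2 c, x < c < y &
  exists2 d, is_derive c 1 tr d & tr y - tr x = d * (y - x).
Proof.
move=> xy; have [|c cxy ->] := @MVT _ tr (fun t => 'D_1 tr t) x y xy _
  (continuous_subspaceT ctr).
  move=> t _; apply: derivableP.
  have [A [B [C [_ [d1 _ _ d4]]]]] := rot.2 t.
  by apply: derivableD; exact: ex_derive.
exists c; first by rewrite in_itv in cxy.
exists ('D_1 tr c) => //; apply: derivableP.
have [A [B [C [_ [d1 _ _ d4]]]]] := rot.2 c.
by apply: derivableD; exact: ex_derive.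
Qed.

(** In the open band the off-diagonal entries cannot vanish, so they keep their signs, and by
    [trace_derive] these fix the sign of the derivative of the trace. *)
Lemma band_monotone x z : x < z -> (forall t, x < t < z -> tr t ^+ 2 < 4) ->
  (forall t, x < t < z -> 0 < n12 t /\ n21 t < 0) /\
    (forall s t, x <= s -> s < t -> t <= z -> tr t < tr s) \/
  (forall t, x < t < z -> n12 t < 0 /\ 0 < n21 t) /\
    (forall s t, x <= s -> s < t -> t <= z -> tr s < tr t).
Proof.
move=> xz band.
have n12n t : x < t < z -> n12 t != 0.
  move=> /band b; apply/eqP => /(n12_zero_trace rot); by rewrite leNgt b.
have n21n t : x < t < z -> n21 t != 0.
  move=> /band b; apply/eqP => /(n21_zero_trace rot); by rewrite leNgt b.
have cN21 : continuous (fun x => - n21 x) by move=> w; apply: cvgN; exact: c21.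
have sgn t : x < t < z -> exists d, [/\ is_derive t 1 tr d,
    n21 t < 0 -> d < 0 /\ 0 < n12 t & 0 < n21 t -> 0 < d /\ n12 t < 0].
  move=> xtz; have [|d [dt d0 dn dp]] := trace_derive rot (ltW (band t xtz)).
    by move=> [n0 _]; have := n12n t xtz; rewrite n0 eqxx.
  exists d; split=> // h.
    have d1 : d < 0.
      by case: ltgtP d0 => // /dp[_]; rewrite leNgt h.
    by split=> //; rewrite lt_neqAle eq_sym n12n//= (dn d1).1.
  have d1 : 0 < d.
    by case: ltgtP d0 => // /dn[_]; rewrite leNgt h.
  by split=> //; rewrite lt_neqAle n12n//= (dp d1).1.
have m_ : x < (x + z) / 2 < z by apply/andP; split; lra.
have inner s t c : x <= s -> t <= z -> s < c < t -> x < c < z.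
  by move=> xs tz /andP[sc ct]; rewrite (le_lt_trans xs sc) (lt_le_trans ct tz).
have := n21n _ m_; case: ltgtP => // nm _.
  left; have neg t : x < t < z -> n21 t < 0.
    move=> xtz; rewrite -oppr_gt0.
    apply: (nonzero_sign cN21 _ m_ xtz); last by rewrite oppr_gt0.
    by move=> u /n21n; rewrite oppr_eq0.
  split=> [t xtz|s t xs st tz].
    have n0 := neg t xtz; split=> //.
    by have [d [_ /(_ n0)[]]] := sgn t xtz.
  have [c sct [d dc E]] := trace_mvt st.
  have xcz := inner _ _ _ xs tz sct.
  have [d' [dc' /(_ (neg c xcz))[d'0 _] _]] := sgn c xcz.
  rewrite -subr_lt0 E pmulr_llt0 ?subr_gt0//.
  by rewrite -(@derive_val _ _ _ _ _ _ _ dc) (@derive_val _ _ _ _ _ _ _ dc').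
right; have neg t : x < t < z -> 0 < n21 t.
  by move=> xtz; exact: (nonzero_sign c21 n21n m_ xtz).
split=> [t xtz|s t xs st tz].
  have n0 := neg t xtz; split=> //.
  by have [d [_ _ /(_ n0)[]]] := sgn t xtz.
have [c sct [d dc E]] := trace_mvt st.
have xcz := inner _ _ _ xs tz sct.
have [d' [dc' _ /(_ (neg c xcz))[d'0 _]]] := sgn c xcz.
rewrite -subr_gt0 E pmulr_lgt0 ?subr_gt0//.
by rewrite -(@derive_val _ _ _ _ _ _ _ dc) (@derive_val _ _ _ _ _ _ _ dc').
Qed.

Lemma closed_left (f : R -> R) x z : continuous f -> x < z ->
  (forall t, x < t < z -> 0 <= f t) -> 0 <= f z.
Proof.
move=> cf xz f0; rewrite leNgt; apply/negP => fz.
have fz' : 0 < - f z by rewrite oppr_gt0.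
have [d d0 dP] := continuous_near (cf z) fz'.
have [t /andP[t1 t2] t3] := between_near_left xz d0.
have := dP t; rewrite t3 (lt_trans t2) ?ltrDl// => /(_ isT).
have := f0 t; rewrite t1 t2 => /(_ isT) ft.
by rewrite ltr_norml => /andP[_]; lra.
Qed.

Lemma closed_right (f : R -> R) x z : continuous f -> x < z ->
  (forall t, x < t < z -> 0 <= f t) -> 0 <= f x.
Proof.
move=> cf xz f0; rewrite leNgt; apply/negP => fz.
have fz' : 0 < - f x by rewrite oppr_gt0.
have [d d0 dP] := continuous_near (cf x) fz'.
have [t /andP[t1 t2] t3] := between_near_right xz d0.
have := dP t; rewrite t3 (lt_trans _ t1) ?gtrBl// => /(_ isT).
have := f0 t; rewrite t1 t2 => /(_ isT) ft.
by rewrite ltr_norml => /andP[_]; lra.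
Qed.

(** Used where the trace is 2 or - 2; there it means that [N] is 1 or - 1. *)
Definition scalar_at x := n12 x = 0 /\ n21 x = 0.

(* Just after the trace leaves the value 2 downwards the two
   off-diagonal entries have a definite sign. *)
Lemma exit_down_sign x e : tr x = 2 -> 0 < e ->
  (forall t, x < t < x + e -> tr t < 2) ->
  exists2 z, x < z & (forall t, x < t < z -> tr t ^+ 2 < 4 /\ 0 < n12 t /\ n21 t
    < 0).
Proof.
move=> trx e0 ex; have [d d0 dP] := continuous_near (@ctr x) (ltr01 : 0 < 1 :>
  R).
have xz : x < x + Num.min d e by rewrite ltrDl lt_min d0.
have near t : x < t < x + Num.min d e -> 1 < tr t < 2.
  rewrite minEle; case: ifP => de /andP[xt td].
    rewrite ex ?xt ?(lt_le_trans td) ?lerD2l// andbT.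
    by have := dP t; rewrite td (lt_trans _ xt) ?gtrBl// => /(_ isT);
      rewrite trx ltr_norml => /andP[]; lra.
  rewrite ex ?xt//= andbT.
  move/negbT: de; rewrite -ltNge => ed.
  have := dP t; rewrite (lt_trans _ xt) ?gtrBl//= => h.
  have {h} : `|tr t - tr x| < 1 by apply: h; lra.
  by rewrite trx ltr_norml => /andP[]; lra.
have band t : x < t < x + Num.min d e -> tr t ^+ 2 < 4.
  by move=> /near/andP[]; nra.
exists (x + Num.min d e) => // t xtz; split; first exact: band.
have [[h _]|[_ inc]] := band_monotone xz band; first exact: h.
move: (xtz) => /andP[xt tz].
by have := inc x t (lexx x) xt (ltW tz); have /andP[_] := near t xtz; lra.
Qed.

End curve.

Lemma exit_up_sign n11 n12 n21 n22 x e : rotating n11 n12 n21 n22 ->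
  trace n11 n22 x = -2 -> 0 < e ->
  (forall t, x < t < x + e -> -2 < trace n11 n22 t) ->
  exists2 z, x < z & forall t, x < t < z ->
    trace n11 n22 t ^+ 2 < 4 /\ n12 t < 0 /\ 0 < n21 t.
Proof.
move=> rot trx e0 ex.
have trN t : trace (fun x => - n11 x) (fun x => - n22 x) t = - trace n11 n22 t.
  by rewrite /trace opprD.
have [||z xz zP] := exit_down_sign (rotatingN rot) (x := x) _ e0.
- by rewrite trN trx opprK.
- by move=> t /ex; rewrite trN; lra.
by exists z => // t /zP; rewrite trN sqrrN oppr_gt0 oppr_lt0.
Qed.

Section excursion.
Variables n11 n12 n21 n22 : R -> R.
Hypothesis rot : rotating n11 n12 n21 n22.

Let tr := trace n11 n22.

Let ctr : continuous tr. Proof. exact: continuous_trace rot. Qed.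
Let c12 : continuous n12. Proof. exact: continuous_n12 rot. Qed.
Let c21 : continuous n21. Proof. exact: continuous_n21 rot. Qed.

Local Notation scalar_at := (scalar_at n12 n21).

(** The trace falls from 2 to - 2 at [z], then stays below - 2 until [z']. The stay is empty exactly
    when N = - 1 at [z], where the trace only touches - 2. The points at level - 2 beyond any bound
    will be eigenvalues for [- K]. *)
Lemma half_step x : tr x = 2 ->
  (exists2 e, 0 < e & forall t, x < t < x + e -> tr t < 2) ->
  (forall y, exists2 z, y < z & tr z = -2) ->
  exists z z', [/\ x < z, z <= z', tr z = -2 & tr z' = -2] /\
  [/\ forall t, x < t < z -> [/\ tr t ^+ 2 < 4, n12 t != 0 & n21 t != 0],
      forall s t, x <= s -> s < t -> t <= z -> tr t < tr s,
      forall t, z < t < z' -> tr t < -2,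
      (z < z' -> ~ scalar_at z /\ ~ scalar_at z') /\ (z = z' -> scalar_at z) &
      exists2 e, 0 < e & forall t, z' < t < z' + e -> -2 < tr t] /\
  (exists2 s, z <= s <= z' &
     n12 s = 0 /\ forall t, z <= t <= z' -> n12 t = 0 -> t = s) /\
  (exists2 s, z <= s <= z' &
     n21 s = 0 /\ forall t, z <= t <= z' -> n21 t = 0 -> t = s).
Proof.
move=> trx [e e0 ex] unb.
have [w xw wP] := exit_down_sign rot trx e0 ex.
pose f t := 4 - tr t ^+ 2.
have cf : continuous f.
  move=> t; apply: cvgB; first exact: cvg_cst.
  by apply: cvgM; exact: ctr.
have [y xy try] := unb x.
have fy : f y = 0 by rewrite /f try; ring.
have wx0 : 0 < w - x by rewrite subr_gt0.
have nf0 t : x < t < x + (w - x) -> f t != 0.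
  rewrite subrKC => /wP[h _]; rewrite /f subr_eq0 eq_sym.
  by rewrite lt_eqF.
have [z [xz zy fz nf]] := first_zero cf wx0 nf0 xy fy.
have wz : w <= z.
  by rewrite leNgt; apply/negP => zw; have := nf0 z;
    rewrite subrKC xz zw fz eqxx;
    move=> /(_ isT).
have mw : x < (x + w) / 2 < w by apply/andP; split; lra.
have mz : x < (x + w) / 2 < z by apply/andP; split; lra.
have band t : x < t < z -> tr t ^+ 2 < 4.
  move=> xtz; rewrite -subr_gt0; apply: (nonzero_sign cf nf mz xtz).
  by rewrite subr_gt0; have [] := wP _ mw.
have [[sg dec]|[sg _]] := band_monotone rot xz band; last first.
  by have [n12m _] := sg _ mz; have [_ []] := wP _ mw; rewrite ltNge (ltW n12m).
have trz : tr z = -2.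
  have h : tr z < 2 by rewrite -trx; exact: dec.
  have : (tr z - 2) * (tr z + 2) = 0 by move: fz; rewrite /f; lra.
  by move=> /eqP; rewrite mulf_eq0 => /orP[] /eqP; lra.
have sband t : x < t < z -> [/\ tr t ^+ 2 < 4, n12 t != 0 & n21 t != 0].
  move=> xtz; have [h1 h2] := sg t xtz; split; first exact: band.
    by rewrite gt_eqF.
  by rewrite lt_eqF.
have trz4 : tr z ^+ 2 = 4 by rewrite trz; ring.
exists z.
(* At N = - 1 the trace returns into the band at once, so [z' = z], where both off-diagonal entries
   vanish. *)
have [sz|nsz] := pselect (scalar_at z).
  exists z; split=> //; split.
    split=> //; first by move=> t /andP[h1 h2]; have := lt_trans h1 h2;
      rewrite ltxx.
    - by split=> //; rewrite ltxx.
    - have [e' e'0 e'P] := trace_near_scalar rot trz4 sz.1 sz.2.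
      exists e' => // t /andP[zt te].
      have := e'P t; rewrite gt_eqF// te (lt_trans _ zt) ?gtrBl// => /(_ isT
        isT).
      by rewrite -/(tr t); nra.
  split; exists z; rewrite ?lexx//; split; [exact: sz.1| |exact: sz.2|];
    by move=> t /andP[h1 h2] _; apply/eqP; rewrite eq_le h1 h2.
have [|d [dz d0 _ _]] := trace_derive rot _ nsz; first by rewrite -/(tr z) trz4.
(* The trace reaches - 2 from above with a nonzero derivative, hence passes below it. *)
have dz0 : d < 0.
  case: ltgtP d0 => // d1 _; have [e' e'0 e'P] := is_derive_gt0 dz d1.
  have [t /andP[t1 t2] t3] := between_near_left xz e'0.
  have := (e'P t).2; rewrite t3 t2 => /(_ isT).
  have := dec t z (ltW t1) t2 (lexx z).
  by rewrite -/(tr t) -/(tr z); lra.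
have [e' e'0 e'P] := is_derive_lt0 dz dz0.
pose g t := - (tr t + 2).
have cg : continuous g.
  by move=> t; apply: cvgN; apply: cvgD; [exact: ctr|exact: cvg_cst].
have g0 t : z < t < z + e' -> 0 < g t.
  by move=> /(e'P t).1; rewrite -/(tr t) -/(tr z) /g trz; lra.
have [y' zy' try'] := unb z.
have gy' : g y' = 0 by rewrite /g try'; ring.
have ng0 t : z < t < z + e' -> g t != 0 by move=> /g0 /gt_eqF ->.
have [z' [zz' z'y' gz' ng]] := first_zero cg e'0 ng0 zy' gy'.
have trz' : tr z' = -2 by move: gz'; rewrite /g; lra.
have ze' : z + e' <= z'.
  by rewrite leNgt; apply/negP => h; have := ng0 z'; rewrite zz' h gz' eqxx;
    move=> /(_ isT).
have below t : z < t < z' -> tr t < -2.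
  move=> ztz'; suff : 0 < g t by rewrite /g; lra.
  apply: (nonzero_sign cg ng (s := z + e' / 2)) => //.
    by apply/andP; split; lra.
  by apply: g0; apply/andP; split; lra.
have trz'4 : tr z' ^+ 2 = 4 by rewrite trz'; ring.
have left e1 : 0 < e1 -> exists2 t, z' - e1 < t < z' & tr t < -2.
  move=> e10; have [t ztz' t3] := between_near_left zz' e10.
  by exists t; [rewrite t3; case/andP: ztz'|exact: below].
(* Near a point with N = - 1 the trace is above - 2 on both sides, while [z'] is approached from
   below - 2. *)
have nsz' : ~ scalar_at z'.
  move=> [h1 h2]; have [e1 e10 e1P] := trace_near_scalar rot trz'4 h1 h2.
  have [t /andP[t1 t2] t3] := left e1 e10.
  have := e1P t; rewrite lt_eqF// t1 (lt_trans t2) ?ltrDl// => /(_ isT isT).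
  by rewrite -/(tr t); nra.
have [|d' [dz' d'0 _ _]] := trace_derive rot _ nsz'; first
  by rewrite -/(tr z') trz'4.
have d'1 : 0 < d'.
  case: ltgtP d'0 => // d1 _; have [e1 e10 e1P] := is_derive_lt0 dz' d1.
  have [t t12 t3] := left e1 e10.
  by have := (e1P t).2 t12; rewrite -/(tr t) -/(tr z') trz'; lra.
have [e1 e10 e1P] := is_derive_gt0 dz' d'1.
have up t : z' < t < z' + e1 -> -2 < tr t by move=> /(e1P t).1; rewrite -trz'.
have [w' z'w' w'P] := exit_up_sign rot trz' e10 up.
exists z'; split; first by split=> //; exact: ltW.
split.
  split=> //; last by exists e1.
  by split=> // zz'E; move: zz'; rewrite zz'E ltxx.
(* Since the trace is negative, [n12] has negative slope at its zeros, hence at most one zero; its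
   signs at [z] and [z'], inherited from the two adjacent bands, provide one. The same holds for
   [- n21]. *)
have trle u : z <= u <= z' -> tr u < 0.
  move=> /andP[]; rewrite le_eqVlt => /predU1P[<-|zu]; first by rewrite trz;
    lra.
  rewrite le_eqVlt => /predU1P[->|uz']; first by rewrite trz'; lra.
  by have := below u; rewrite zu uz' => /(_ isT); lra.
have cN12 : continuous (fun x => - n12 x) by move=> u; apply: cvgN; exact: c12.
have cN21 : continuous (fun x => - n21 x) by move=> u; apply: cvgN; exact: c21.
split.
  have n12z : 0 <= n12 z.
    by apply: (closed_left c12 xz) => t /sg[/ltW].
  have n12z' : n12 z' <= 0.
    rewrite -oppr_ge0; apply: (closed_right cN12 z'w') => t /w'P[_ [+ _]].
    by rewrite oppr_ge0 => /ltW.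
  have [s szz' ns] := ivt_zero c12 (ltW zz') n12z n12z'.
  exists s => //; split=> // t tzz' nt.
  apply: (decreasing_zero_unique c12 _ tzz' szz' nt ns) => u uzz' nu.
  have [du h du'] := n12_zero_derive rot nu; exists du => //.
  by rewrite nmulr_rgt0 in h => //; exact: trle.
have n21z : 0 <= - n21 z.
  by apply: (closed_left cN21 xz) => t /sg[_ /ltW]; rewrite oppr_ge0.
have n21z' : - n21 z' <= 0.
  rewrite oppr_le0; apply: (closed_right c21 z'w') => t /w'P[_ [_ +]].
  by move/ltW.
have [s szz' ns] := ivt_zero cN21 (ltW zz') n21z n21z'.
exists s => //; split=> [|t tzz' nt]; first by move/eqP: ns;
  rewrite oppr_eq0 => /eqP.
have nt' : - n21 t = 0 by rewrite nt oppr0.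
apply: (decreasing_zero_unique cN21 _ tzz' szz' nt' ns) => u uzz' /eqP.
rewrite oppr_eq0 => /eqP nu.
have [du h du'] := n21_zero_derive rot nu; exists (- du);
  last exact: is_deriveN.
by rewrite oppr_lt0; rewrite nmulr_rlt0 in h => //; exact: trle.
Qed.

(** On [[l0, x]] the trace is positive, so [n12] can only cross 0 upwards and [n21] only downwards.
    Hence [n12], positive at [l0], never vanishes, while [n21], which is at most 0 at the exit, has
    one zero or none according to its sign at [l0]: this separates cases (a) and (b). *)
Lemma first_exit l0 : (forall t, t <= l0 -> 2 < tr t) -> 0 < n12 l0 ->
  (exists x, tr x = 2) ->
  exists x, [/\ l0 < x, tr x = 2, forall t, t < x -> 2 < tr t &
    exists2 e, 0 < e & forall t, x < t < x + e -> tr t < 2] /\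
  [/\ ~ scalar_at x,
      forall t, l0 <= t <= x -> n12 t != 0,
      n21 l0 < 0 -> forall t, l0 <= t <= x -> n21 t != 0 &
      0 < n21 l0 -> exists2 s, l0 <= s <= x &
        n21 s = 0 /\ forall t, l0 <= t <= x -> n21 t = 0 -> t = s].
Proof.
move=> trl n12l [y try].
have ly : l0 < y by rewrite ltNge; apply/negP => /trl; rewrite try ltxx.
pose f t := tr t - 2.
have cf : continuous f by move=> t; apply: cvgB; [exact: ctr|exact: cvg_cst].
have fy : f y = 0 by rewrite /f try subrr.
have fl0 : 0 < f l0 by rewrite subr_gt0 trl.
have [d d0 dP] := continuous_near (cf l0) fl0.
have fd t : l0 < t < l0 + d -> 0 < f t.
  move=> /andP[t1 t2]; have := dP t; rewrite t2 (lt_trans _ t1) ?gtrBl// => /(_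
    isT).
  by rewrite ltr_norml => /andP[+ _]; lra.
have nf0 t : l0 < t < l0 + d -> f t != 0 by move=> /fd /gt_eqF ->.
have [x [lx xy fx nf]] := first_zero cf d0 nf0 ly fy.
have dx : l0 + d <= x.
  by rewrite leNgt; apply/negP => h; have := nf0 x; rewrite lx h fx eqxx;
    move=> /(_ isT).
have trx : tr x = 2 by move: fx; rewrite /f; lra.
have above t : t < x -> 2 < tr t.
  move=> tx; have [/trl//|lt] := leP t l0.
  rewrite -subr_gt0; apply: (nonzero_sign cf nf (s := l0 + d / 2));
    rewrite ?lt//.
    by apply/andP; split; lra.
  by apply: fd; apply/andP; split; lra.
have trx4 : tr x ^+ 2 = 4 by rewrite trx; ring.
have nsx : ~ scalar_at x.
  move=> [h1 h2]; have [e1 e10 e1P] := trace_near_scalar rot trx4 h1 h2.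
  have lt2 : 2 < tr (x - e1 / 2) by apply: above; lra.
  have : tr (x - e1 / 2) ^+ 2 < 4.
    by apply: e1P; [rewrite lt_eqF//; lra|apply/andP; split; lra].
  by nra.
have [|d' [dx' d'0 _ _]] := trace_derive rot _ nsx; first
  by rewrite -/(tr x) trx4.
have d'1 : d' < 0.
  case: ltgtP d'0 => // d1 _; have [e1 e10 e1P] := is_derive_gt0 dx' d1.
  have := (e1P (x - e1 / 2)).2.
  have -> : x - e1 < x - e1 / 2 < x by apply/andP; split; lra.
  move=> /(_ isT); rewrite -/(tr x) -/(tr (x - e1 / 2)) trx.
  have h : 2 < tr (x - e1 / 2) by apply: above; lra.
  by rewrite ltNge (ltW h).
have [e1 e10 e1P] := is_derive_lt0 dx' d'1.
have down t : x < t < x + e1 -> tr t < 2 by move=> /(e1P t).1; rewrite -trx.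
have [w xw wP] := exit_down_sign rot trx e10 down.
have trpos u : l0 <= u <= x -> 0 < tr u.
  move=> /andP[_]; rewrite le_eqVlt => /predU1P[->|/above]; last lra.
  by rewrite trx; lra.
exists x; split; first by split=> //; exists e1.
split=> //.
- apply: no_zero_of_increasing => // u ulx nu.
  have [du h du'] := n12_zero_derive rot nu; exists du => //.
  by rewrite pmulr_rgt0 in h => //; exact: trpos.
- move=> n21l t tlx; rewrite -oppr_eq0.
  have cN21 : continuous (fun x => - n21 x) by move=> u; apply: cvgN;
    exact: c21.
  apply: (no_zero_of_increasing cN21 _ _ tlx); first by rewrite oppr_gt0.
  move=> u ulx /eqP; rewrite oppr_eq0 => /eqP nu.
  have [du h du'] := n21_zero_derive rot nu; exists (- du);
    last exact: is_deriveN.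
  by rewrite oppr_gt0; rewrite pmulr_rlt0 in h => //; exact: trpos.
- move=> n21l; have n21x : n21 x <= 0.
    rewrite -oppr_ge0.
    have cN21 : continuous (fun x => - n21 x) by move=> u; apply: cvgN;
      exact: c21.
    by apply: (closed_right cN21 xw) => t /wP[_ [_ +]];
      rewrite oppr_ge0 => /ltW.
  have [s slx ns] := ivt_zero c21 (ltW lx) (ltW n21l) n21x.
  exists s => //; split=> // t tlx nt.
  apply: (decreasing_zero_unique c21 _ tlx slx nt ns) => u ulx nu.
  have [du h du'] := n21_zero_derive rot nu; exists du => //.
  by rewrite pmulr_rlt0 in h => //; exact: trpos.
Qed.

End excursion.
End HalfStep.

(** * Numbering a sequence by its multiplicities *)

Section Counting.
Context {R : realType}.
Implicit Types (x y t : R) (lam : nat -> R) (mult : R -> nat).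

(** What remains of [eigenvalue_sequence] once the multiplicity is known as a function on the line
    and the boundary value problem is forgotten. *)
Definition enumerates lam mult : Prop :=
  [/\ {homo lam : m n / (m <= n)%N >-> m <= n}, lam n @[n --> \oo] --> +oo,
      forall x, (0 < mult x)%N -> exists n, lam n = x &
      forall n, ([set k | lam k = lam n] #= `I_(mult (lam n)))%card].

Definition counted lam x n : Prop := forall k, (lam k <= x) = (k < n)%N.

Lemma enumerates_mult lam mult n : enumerates lam mult -> (0 < mult (lam n))%N.
Proof.
move=> [_ _ _ card]; rewrite lt0n; apply/eqP => m0; have := card n.
rewrite m0 II0 card_eq0 => /eqP e.
by have : [set k | lam k = lam n] n by []; rewrite e.
Qed.

Lemma enumerates_unbounded lam mult y : enumerates lam mult ->
  exists n, y < lam n.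
Proof.
move=> [_ /cvgryPgt /(_ y)[n _ nP] _ _]; exists n; exact: (nP n (leqnn n)).
Qed.

Lemma counted_exists lam mult y : enumerates lam mult ->
  exists n, counted lam y n.
Proof.
move=> en; have [homo _ _ _] := en.
case: (ex_minnP (enumerates_unbounded y en)) => N yN minN; exists N => k.
have [kN|Nk] := ltnP k N.
  by rewrite leNgt; apply/negP => /minN; rewrite leqNgt kN.
by apply/negbTE; rewrite -ltNge (lt_le_trans yN)// homo.
Qed.

Lemma counted_zero lam mult x : enumerates lam mult ->
  (forall t, t <= x -> mult t = 0%N) -> counted lam x 0.
Proof.
move=> en m0 k; rewrite ltn0; apply/negbTE/negP => /m0.
by have := enumerates_mult k en; rewrite lt0n => /eqP.
Qed.

Lemma counted_none lam mult x y n : enumerates lam mult -> counted lam x n ->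
  x <= y -> (forall t, x < t <= y -> mult t = 0%N) -> counted lam y n.
Proof.
move=> en cx xy m0 k; rewrite -cx; apply/idP/idP => [ky|kx];
  last exact: le_trans xy.
rewrite leNgt; apply/negP => xk.
by have := enumerates_mult k en; rewrite m0// xk.
Qed.

(** The indices between the counts at [x] and at [y] all carry the value [t] and exhaust its
    preimage, so the cardinality in [enumerates] gives their number. *)
Lemma counted_one lam mult x y n t : enumerates lam mult -> counted lam x n ->
  x < t -> t <= y -> (0 < mult t)%N ->
  (forall u, x < u <= y -> u != t -> mult u = 0%N) ->
  counted lam y (n + mult t) /\
  forall k, (n <= k < n + mult t)%N -> lam k = t.
Proof.
move=> en cx xt ty mt m0; have [N cy] := counted_exists y en.
have lamE k : (n <= k < N)%N -> lam k = t.
  rewrite leqNgt -cx -cy -ltNge => xky; apply/eqP; apply/negP => /negP kt.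
  by have := enumerates_mult k en; rewrite m0.
have nN : (n <= N)%N.
  rewrite leqNgt; apply/negP; rewrite -cx => /le_trans /(_ (le_trans (ltW xt)
    ty)).
  by rewrite cy ltnn.
have E : [set k | lam k = t] = [set (n + i)%N | i in `I_(N - n)].
  apply/seteqP; split=> [k /= kt|k [i /=] iN <-]; last first.
    by apply: lamE; rewrite leq_addr -ltn_subRL.
  have nk : (n <= k)%N by rewrite leqNgt -cx kt -ltNge.
  have kN : (k < N)%N by rewrite -cy kt.
  by exists (k - n)%N; rewrite ?subnKC//= ltn_sub2r// (leq_ltn_trans nk).
have [_ _ /(_ t mt)[j jt] card] := en.
have := card j; rewrite jt E => cE.
have {}cE : (`I_(N - n) #= `I_(mult t))%card.
  apply: card_eq_trans cE; rewrite card_eq_sym; apply: inj_card_eq => //.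
  by move=> i i' _ _ /addnI.
have mN : (N - n)%N = mult t by apply/card_eq_II.
by rewrite -mN subnKC//.
Qed.

End Counting.

(** * Interlacing over successive sweeps *)

Section Interlacing.
Context {R : realType}.
Implicit Types (x y t : R) (lam : nat -> R) (mult : R -> nat).

(** For c = 2 cos g this is the dimension of the kernel of N - e^(i g), see [trace_mult_rank]. *)
Definition trace_mult (n11 n12 n21 n22 : R -> R) (c x : R) : nat :=
  if trace n11 n22 x == c then (if (n12 x == 0) && (n21 x == 0) then 2%N else
    1%N)
  else 0%N.

Definition zero_mult (f : R -> R) x : nat := nat_of_bool (f x == 0).

Lemma trace_multN n11 n12 n21 n22 c :
  trace_mult (fun x => - n11 x) (fun x => - n12 x) (fun x => - n21 x)
    (fun x => - n22 x) (- c) = trace_mult n11 n12 n21 n22 c.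
Proof.
apply/funext => x; rewrite /trace_mult /trace -opprD eqr_opp !oppr_eq0.
by [].
Qed.

Lemma zero_multN f : zero_mult (fun x => - f x) = zero_mult f.
Proof. by apply/funext => x; rewrite /zero_mult oppr_eq0. Qed.

Section step.
Variables (I : Type).

(** The state between two sweeps: [lamX] belongs to the level being left, whose term at [x] is
    already counted, and [lamY] to the opposite level. [nu] has its own index because it may run one
    ahead of [mu]. *)
Definition level_at n11 n12 n21 n22 (lamX lamY : nat -> R)
    (lamG : I -> nat -> R) (mu nu : nat -> R) (n m : nat) x : Prop :=
  [/\ trace n11 n22 x = 2,
      exists2 e, 0 < e & forall t, x < t < x + e -> trace n11 n22 t < 2,
      rotating n11 n12 n21 n22 & lamX n = x] /\
  [/\ counted lamX x n.+1, counted lamY x n, forall i, counted (lamG i) x n,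
      counted mu x n & counted nu x m].

Definition interlaced (c : I -> R) (lamX lamY : nat -> R)
    (lamG : I -> nat -> R) (mu nu : nat -> R) (n m : nat) : Prop :=
  [/\ forall i, lamX n < lamG i n < lamY n,
      lamY n <= mu n <= lamY n.+1, lamY n <= nu m <= lamY n.+1 &
      forall i j, c j < c i -> lamG i n < lamG j n].

(** A sweep consumes one term of each [lamG i], of [mu] and of [nu], and two of [lamY], at [z] and
    [z'], which form one double eigenvalue if they coincide. At [z'] the curve [- N] is in the same
    state with [lamX] and [lamY] exchanged. *)
Lemma level_step n11 n12 n21 n22 (c : I -> R) lamX lamY lamG mu nu n m x :
  (forall i, c i ^+ 2 < 4) ->
  enumerates lamX (trace_mult n11 n12 n21 n22 2) ->
  enumerates lamY (trace_mult n11 n12 n21 n22 (- 2)) ->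
  (forall i, enumerates (lamG i) (trace_mult n11 n12 n21 n22 (c i))) ->
  enumerates mu (zero_mult n12) -> enumerates nu (zero_mult n21) ->
  level_at n11 n12 n21 n22 lamX lamY lamG mu nu n m x ->
  interlaced c lamX lamY lamG mu nu n m /\
  exists x', level_at (fun x => - n11 x) (fun x => - n12 x) (fun x => - n21 x)
    (fun x => - n22 x) lamY lamX lamG mu nu n.+1 m.+1 x'.
Proof.
move=> c4 eX eY eG emu enu [[trx ex rot lamXn] [cX cY cG cmu cnu]].
have unb y : exists2 z, y < z & trace n11 n22 z = - 2.
  have [k yk] := enumerates_unbounded y eY; exists (lamY k) => //.
  by have := enumerates_mult k eY; rewrite /trace_mult; case: eqP.
have [z [z' [[xz zz' trz trz'] [[band dec below [nsc sc] exz'] [smu snu]]]]] :=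
  half_step rot trx ex unb.
have xz' := lt_le_trans xz zz'.
have caseP t : x < t <= z' -> [\/ x < t < z, z < t < z', t = z | t = z'].
  move=> /andP[xt tz']; have [tz|zt|->] := ltgtP t z.
  - by apply: Or41; rewrite xt.
  - move: tz'; rewrite le_eqVlt => /predU1P[->|tz']; first exact: Or44.
    by apply: Or42.
  - exact: Or43.
have cX' : counted lamX z' n.+1.
  apply: (counted_none eX cX (ltW xz')) => t /caseP h; rewrite /trace_mult.
  case: eqP => // tr2; exfalso; case: h => [/band[+ _ _]|/below|tz|tz].
  - by rewrite tr2 -natrX ltxx.
  - by rewrite tr2 => h; lra.
  - by move: tr2; rewrite tz trz; lra.
  - by move: tr2; rewrite tz trz'; lra.
have [cY' lamYn lamYn1] : [/\ counted lamY z' n.+2, lamY n = z & lamY n.+1 =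
  z'].
  have [zz|zz] := eqVneq z z'.
    have [s1 s2] := sc zz.
    have mz : trace_mult n11 n12 n21 n22 (- 2) z = 2%N.
      by rewrite /trace_mult trz eqxx s1 s2 eqxx.
    have mz0 : (0 < trace_mult n11 n12 n21 n22 (- 2) z)%N by rewrite mz.
  have [|cz lz] := counted_one eY cY xz zz' mz0.
    move=> t /caseP h tz; rewrite /trace_mult; case: eqP => // tr2; exfalso.
    case: h => [/band[+ _ _]|/below|tz'|tz'].
    - by rewrite tr2 sqrrN -natrX ltxx.
    - by rewrite tr2 ltxx.
    - by rewrite tz' eqxx in tz.
    - by rewrite tz' zz eqxx in tz.
  rewrite mz addn2 in cz lz; split=> //; first by apply: lz;
    rewrite leqnn ltnS leqnSn.
    by rewrite -zz; apply: lz; rewrite leqnSn ltnS leqnn.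
  have {}zz : z < z' by rewrite lt_neqAle zz.
  have [ns ns'] := nsc zz.
  have m1 t : trace n11 n22 t = - 2 -> ~ scalar_at n12 n21 t ->
      trace_mult n11 n12 n21 n22 (- 2) t = 1%N.
    move=> trt nst; rewrite /trace_mult trt eqxx;
      case: ifP => // /andP[/eqP ? /eqP ?].
    by exfalso; apply: nst.
  have mz := m1 _ trz ns; have mz' := m1 _ trz' ns'.
  have mz0 : (0 < trace_mult n11 n12 n21 n22 (- 2) z)%N by rewrite mz.
  have mz'0 : (0 < trace_mult n11 n12 n21 n22 (- 2) z')%N by rewrite mz'.
  have [|cz lz] := counted_one eY cY xz (lexx z) mz0.
    move=> t /andP[xt tz] tz_; rewrite /trace_mult; case: eqP => // tr2;
      exfalso.
    have [] := band t; first by rewrite xt lt_neqAle tz_.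
    by rewrite tr2 sqrrN -natrX ltxx.
  rewrite mz addn1 in cz lz.
  have [|cz' lz'] := counted_one eY cz zz (lexx z') mz'0.
    move=> t /andP[xt tz] tz_; rewrite /trace_mult; case: eqP => // tr2;
      exfalso.
    have := below t; rewrite xt lt_neqAle tz_ tz tr2 ltxx.
    by move=> /(_ isT).
  rewrite mz' addn1 in cz' lz'; split=> //; first by apply: lz;
    rewrite leqnn ltnSn.
  by apply: lz'; rewrite leqnn ltnSn.
have ctr := continuous_trace rot.
have G i : exists2 g, x < g < z & trace n11 n22 g = c i /\ counted (lamG i) z'
  n.+1 /\ lamG i n = g.
  have ci := c4 i.
  have cg : continuous (fun t => trace n11 n22 t - c i).
    by move=> t; apply: cvgB; [exact: ctr|exact: cvg_cst].
  have cx : 0 <= trace n11 n22 x - c i by rewrite trx subr_ge0; nra.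
  have cz : trace n11 n22 z - c i <= 0 by rewrite trz subr_le0; nra.
  have [g /andP[xg gz] trg] := ivt_zero cg (ltW xz) cx cz.
  have {}trg : trace n11 n22 g = c i by lra.
  have {}xg : x < g.
    by rewrite lt_neqAle xg andbT; apply/eqP => xg'; move: trg;
      rewrite -xg' trx; nra.
  have {}gz : g < z.
    by rewrite lt_neqAle gz andbT; apply/eqP => xg'; move: trg; rewrite xg' trz;
      nra.
  have xgz : x < g < z by rewrite xg.
  have mg : trace_mult n11 n12 n21 n22 (c i) g = 1%N.
    have [_ /negbTE n12g _] := band g xgz.
    by rewrite /trace_mult trg eqxx n12g.
  have mg0 : (0 < trace_mult n11 n12 n21 n22 (c i) g)%N by rewrite mg.
  have gz' : g <= z' by rewrite (le_trans (ltW gz)).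
  have [|cntg lg] := counted_one (eG i) (cG i) xg gz' mg0.
    move=> t /caseP h tg; rewrite /trace_mult; case: eqP => // tri; exfalso.
    case: h => [/andP[xt tz]|/below|tz|tz].
    - case: ltgtP tg => // tg _.
        by have := dec t g (ltW xt) tg (ltW gz); rewrite tri trg ltxx.
      by have := dec g t (ltW xg) tg (ltW tz); rewrite tri trg ltxx.
    - by rewrite tri; nra.
    - by move: tri; rewrite tz trz; nra.
    - by move: tri; rewrite tz trz'; nra.
  rewrite mg addn1 in cntg lg.
  by exists g => //; split=> //; split=> //; apply: lg; rewrite leqnn ltnSn.
have Z (f : R -> R) lam k : enumerates lam (zero_mult f) -> counted lam x k ->
    (forall t, x < t < z -> f t != 0) ->
    (exists2 s, z <= s <= z' & f s = 0 /\ forall t, z <= t <= z' -> f t = 0 ->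
      t = s) ->
    counted lam z' k.+1 /\ z <= lam k <= z'.
  move=> ef cf fn [s /andP[zs sz'] [fs us]].
  have ms : zero_mult f s = 1%N by rewrite /zero_mult fs eqxx.
  have ms0 : (0 < zero_mult f s)%N by rewrite ms.
  have [|cs ls] := counted_one ef cf (lt_le_trans xz zs) sz' ms0.
    move=> t /andP[xt tz'] ts; rewrite /zero_mult; case: eqP => // ft.
    have [tz|zt] := ltP t z; first by have := fn t;
      rewrite xt tz ft eqxx => /(_ isT).
    by have := us t; rewrite zt tz' => /(_ isT ft) tss; rewrite tss eqxx in ts.
  rewrite ms addn1 in cs ls; split=> //.
  by rewrite ls ?zs ?sz'// leqnn ltnSn.
have [cmu' lmu] := Z n12 mu n emu cmu (fun t xt => let: And3 _ h _ :=
  band t xt in h) smu.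
have [cnu' lnu] := Z n21 nu m enu cnu (fun t xt => let: And3 _ _ h :=
  band t xt in h) snu.
split.
  split; rewrite ?lamXn ?lamYn ?lamYn1//.
  - by move=> i; have [g xgz [_ [_ ->]]] := G i.
  - move=> i j cij; have [g /andP[xg gz] [trg [_ ->]]] := G i.
    have [h /andP[xh hz] [trh [_ ->]]] := G j.
    rewrite ltNge; apply/negP; rewrite le_eqVlt => /predU1P[hg|hg].
      by rewrite -trg -trh hg ltxx in cij.
    have := dec h g (ltW xh) hg (ltW gz); rewrite trg trh => /(lt_trans cij).
    by rewrite ltxx.
exists z'; split; split=> //.
- by rewrite /trace -opprD -[X in - X]/(trace n11 n22 z') trz' opprK.
- have [e e0 eP] := exz'; exists e => // t /eP; rewrite /trace.
  by lra.
- exact: rotatingN.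
- by move=> i; have [g _ [_ []]] := G i.
Qed.

(** A sweep for [N] and one for [- N] lead back to [N], whence the period two of the chains. The
    second sweep meets the levels [- c], as its trace has the opposite sign. *)
Lemma level_interlaced n11 n12 n21 n22 (c : I -> R) lamX lamY lamG mu nu d x :
  (forall i, c i ^+ 2 < 4) ->
  enumerates lamX (trace_mult n11 n12 n21 n22 2) ->
  enumerates lamY (trace_mult n11 n12 n21 n22 (- 2)) ->
  (forall i, enumerates (lamG i) (trace_mult n11 n12 n21 n22 (c i))) ->
  enumerates mu (zero_mult n12) -> enumerates nu (zero_mult n21) ->
  level_at n11 n12 n21 n22 lamX lamY lamG mu nu 0 d x ->
  forall k, let n := k.*2 in interlaced c lamX lamY lamG mu nu n (n + d)%N /\
    interlaced (fun i => - c i) lamY lamX lamG mu nu n.+1 (n.+1 + d)%N.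
Proof.
move=> c4 eX eY eG emu enu l0 k n.
have cN4 i : (- c i) ^+ 2 < 4 by rewrite sqrrN.
have step m y : level_at n11 n12 n21 n22 lamX lamY lamG mu nu m (m + d)%N y ->
   [/\ interlaced c lamX lamY lamG mu nu m (m + d)%N,
    interlaced (fun i => - c i) lamY lamX lamG mu nu m.+1 (m.+1 + d)%N &
    exists y', level_at n11 n12 n21 n22 lamX lamY lamG mu nu m.+2 (m.+2 + d)%N
      y'].
  move=> lm; have [int1 [y1 l1]] := level_step c4 eX eY eG emu enu lm.
  have [||i|||int2 [y2 l2]] := level_step cN4 _ _ _ _ _ l1.
  - by rewrite -[X in trace_mult _ _ _ _ X]opprK trace_multN.
  - by rewrite trace_multN.
  - by rewrite trace_multN.
  - by rewrite zero_multN.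
  - by rewrite zero_multN.
  split=> //; exists y2; move: l2.
  have NN (f : R -> R) : (fun x => - - f x) = f by apply/funext => t;
    rewrite opprK.
  by rewrite !NN.
suff [y /step[]] : exists y, level_at n11 n12 n21 n22 lamX lamY lamG mu nu n (n
  + d)%N y.
  by [].
rewrite {}/n; elim: k => [|k [y /step[_ _]]]; first by exists x.
by rewrite doubleS.
Qed.


End step.
End Interlacing.

(** * Reduction of the Sturm-Liouville problem *)

Section Gauge.
Context {R : realType}.
Implicit Types (a b x y t l : R) (u v : R -> R).

Definition real_SL_solution a b (p q r s : R -> R) l u u1 : Prop :=
  [/\ abs_continuous a b u, abs_continuous a b u1 &
      ae_itv a b (fun t => [/\ derivable u t 1, derivable u1 t 1,
        u1 t = p t * (derive1 u t + s t * u t) &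
        - derive1 u1 t + s t * u1 t + q t * u t = l * r t * u t])].

(** With a real parameter all coefficients are real, so the two parts of a solution decouple. *)
Lemma SL_solution_ReIm a b (p q r s : R -> R) l (y y1 : R -> R[i]) :
  SL_solution a b p q r s l%:C y y1 <->
  real_SL_solution a b p q r s l (fun t => complex.Re (y t))
    (fun t => complex.Re (y1 t)) /\
  real_SL_solution a b p q r s l (fun t => complex.Im (y t))
    (fun t => complex.Im (y1 t)).
Proof.
split.
  move=> [[ac1 ac2] [ac3 ac4] h]; split; split=> //.
    apply: ae_itv1 h => t _ [[d1 d2] [d3 d4]].
    rewrite /cderive; case: (y t) => yr yi; case: (y1 t) => zr zi /=.
    by move=> /eqP + /eqP; rewrite !eq_complex /= => /andP[/eqP e1 _] /andP[/eqP
      e2 _];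
      split=> //; lra.
  apply: ae_itv1 h => t _ [[d1 d2] [d3 d4]].
  rewrite /cderive; case: (y t) => yr yi; case: (y1 t) => zr zi /=.
  by move=> /eqP + /eqP; rewrite !eq_complex /= => /andP[_ /eqP e1] /andP[_ /eqP
    e2];
    split=> //; lra.
move=> [[ac1 ac2 h] [ac3 ac4 h']]; split=> //.
apply: ae_itv2 h h' => t _ [d1 d2 e1 e2] [d3 d4 e3 e4]; split=> //.
  move: e1 e3; rewrite /cderive; case: (y t) => yr yi;
    case: (y1 t) => zr zi /= e1 e3.
  by apply/eqP; rewrite eq_complex /=; apply/andP; split; apply/eqP; lra.
move: e2 e4; rewrite /cderive; case: (y t) => yr yi;
  case: (y1 t) => zr zi /= e2 e4.
by apply/eqP; rewrite eq_complex /=; apply/andP; split; apply/eqP; lra.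
Qed.

Section gauge.
Variables (a b : R) (p q r s S : R -> R).
Hypotheses (ab : a < b) (pS : primitive a b s S) (Sa : S a = 0)
  (p0 : ae_itv a b (fun t => 0 < p t)).

Let leab : a <= b := ltW ab.

Definition gauge_P t := (p t)^-1 * (expR (S t) * expR (S t)).
(** The coefficient is an argument because the potential and the weight [r] are transformed
    alike. *)
Definition gauge_Q (q : R -> R) t := q t * (expR (- S t) * expR (- S t)).

Let eS t : expR (S t) * expR (- S t) = 1.
Proof. by rewrite -expRD subrr expR0. Qed.

Let peS := primitive_expR leab pS.
Let peNS := primitive_expR leab (primitiveN leab pS).

Lemma real_SL_canonical l u u1 : real_SL_solution a b p q r s l u u1 ->
  canonical_system a b gauge_P (fun t => gauge_Q q t - l * gauge_Q r t)
    (fun t => expR (S t) * u t) (fun t => expR (- S t) * u1 t).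
Proof.
move=> [acu acu1 h].
have pu : primitive a b (fun t => derive1 u t) u.
  by split=> //; apply: ae_itv1 h => t _ [d _ _ _]; rewrite derive1E;
    exact: derivableP.
have pu1 : primitive a b (fun t => derive1 u1 t) u1.
  by split=> //; apply: ae_itv1 h => t _ [_ d _ _]; rewrite derive1E;
    exact: derivableP.
split.
  apply: primitive_ae (primitiveM leab peS pu).
  apply: ae_itv2 h p0 => t _ [_ _ e _] pt; rewrite e /gauge_P.
  have -> : (p t)^-1 * (expR (S t) * expR (S t)) *
    (expR (- S t) * (p t * (derive1 u t + s t * u t))) =
    ((p t)^-1 * p t) * (expR (S t) * expR (- S t)) * expR (S t) *
     (derive1 u t + s t * u t) by ring.
  by rewrite eS mulVf ?gt_eqF//; ring.
apply: primitive_ae (primitiveM leab peNS pu1).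
apply: ae_itv1 h => t _ [_ _ _ e]; rewrite /gauge_Q.
have -> : (q t * (expR (- S t) * expR (- S t)) - l * (r t * (expR (- S t) * expR
  (- S t))))
  * (expR (S t) * u t) = (q t * u t - l * r t * u t) * expR (- S t) *
   (expR (S t) * expR (- S t)) by ring.
by rewrite eS mulr1 -e; ring.
Qed.

Lemma canonical_real_SL l u v :
  canonical_system a b gauge_P (fun t => gauge_Q q t - l * gauge_Q r t) u v ->
  real_SL_solution a b p q r s l (fun t => expR (- S t) * u t)
    (fun t => expR (S t) * v t).
Proof.
move=> [pu pv]; have hu := primitiveM leab peNS pu; have hv :=
  primitiveM leab peS pv.
split; [exact: hu.1|exact: hv.1|].
apply: ae_itv3 hu.2 hv.2 p0 => t _ du dv pt; split.
- exact: ex_derive.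
- exact: ex_derive.
- rewrite derive1E (@derive_val _ _ _ _ _ _ _ du) /gauge_P.
  have -> : p t * (expR (- S t) * ((p t)^-1 * (expR (S t) * expR (S t)) * v t) +
     expR (- S t) * - s t * u t + s t * (expR (- S t) * u t)) =
     (p t / p t) * (expR (S t) * expR (- S t)) * (expR (S t) * v t) by ring.
  by rewrite eS divff ?gt_eqF// !mul1r.
- rewrite derive1E (@derive_val _ _ _ _ _ _ _ dv) /gauge_Q.
  have -> : expR (S t) * ((q t * (expR (- S t) * expR (- S t)) -
      l * (r t * (expR (- S t) * expR (- S t)))) * u t) =
    (q t - l * r t) * (expR (- S t) * u t) * (expR (S t) * expR (- S t))
      by ring.
  by rewrite eS; ring.
Qed.

Hypotheses (intp : integrable_itv a b (fun t => (p t)^-1))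
  (intq : integrable_itv a b q) (intr : integrable_itv a b r)
  (r0 : ae_itv a b (fun t => 0 < r t)).

Lemma integrable_gauge_P : integrable_itv a b gauge_P.
Proof. exact: (integrable_itvM leab intp (acM leab peS.1 peS.1)). Qed.

Lemma integrable_gauge_Q f : integrable_itv a b f ->
  integrable_itv a b (gauge_Q f).
Proof. by move=> intf; exact: (integrable_itvM leab intf (acM leab peNS.1
  peNS.1)). Qed.

Lemma gauge_pos : ae_itv a b (fun t => 0 < gauge_P t /\ 0 < gauge_Q r t).
Proof.
apply: ae_itv2 p0 r0 => t _ pt rt.
by split; rewrite !mulr_gt0 ?invr_gt0 ?expR_gt0.
Qed.

Variables U V : R -> bool -> R -> R.
Hypothesis UV : forall l i,
  [/\ canonical_system a b gauge_P (fun t => gauge_Q q t - l * gauge_Q r t)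
        (U l i) (V l i),
      U l i a = (~~ i)%:R & V l i a = i%:R].

Lemma SL_solution_repr l (y y1 : R -> R[i]) t :
  SL_solution a b p q r s l%:C y y1 -> t \in `[a, b] ->
  y t = (expR (- S t))%:C *
    ((U l false t)%:C * y a + (U l true t)%:C * y1 a) /\
  y1 t = (expR (S t))%:C *
    ((V l false t)%:C * y a + (V l true t)%:C * y1 a).
Proof.
move=> /SL_solution_ReIm[/real_SL_canonical s1 /real_SL_canonical s2] tab.
have [h1 h2] := solution_expansion ab UV s1 tab.
have [h3 h4] := solution_expansion ab UV s2 tab.
rewrite Sa oppr0 expR0 !mul1r in h1 h2 h3 h4.
have inv (x : R) : x = expR (- S t) * (expR (S t) * x).
  by rewrite mulrA (mulrC (expR (- _))) eS mul1r.
have inv' (x : R) : x = expR (S t) * (expR (- S t) * x).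
  by rewrite mulrA eS mul1r.
split; apply/eqP; rewrite eq_complex; apply/andP; split; apply/eqP.
- by rewrite [LHS]inv h1; case: (y a) (y1 a) => [? ?] [? ?] /=; ring.
- by rewrite [LHS]inv h3; case: (y a) (y1 a) => [? ?] [? ?] /=; ring.
- by rewrite [LHS]inv' h2; case: (y a) (y1 a) => [? ?] [? ?] /=; ring.
- by rewrite [LHS]inv' h4; case: (y a) (y1 a) => [? ?] [? ?] /=; ring.
Qed.

Lemma SL_solution_exists l (c0 c1 : R[i]) : exists y y1 : R -> R[i],
  [/\ SL_solution a b p q r s l%:C y y1, y a = c0 & y1 a = c1].
Proof.
case: c0 c1 => [x0 y0] [x1 y1].
have [s1 u1 v1] := UV l false; have [s2 u2 v2] := UV l true.
have h1 := canonical_real_SL (canonical_systemD x0 x1 leab s1 s2).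
have h2 := canonical_real_SL (canonical_systemD y0 y1 leab s1 s2).
exists (fun t => (expR (- S t) * (x0 * U l false t + x1 * U l true t)) +i*
  (expR (- S t) * (y0 * U l false t + y1 * U l true t))).
exists (fun t => (expR (S t) * (x0 * V l false t + x1 * V l true t)) +i*
  (expR (S t) * (y0 * V l false t + y1 * V l true t))).
split; first by apply/SL_solution_ReIm; split.
  by rewrite Sa oppr0 expR0 u1 u2 /= !mulr1 !mulr0 !addr0 !mul1r.
by rewrite Sa expR0 v1 v2 /= !mulr1 !mulr0 !add0r !mul1r.
Qed.

Lemma fundamental_free l (c0 c1 : R[i]) :
  (forall t, t \in `[a, b] -> (U l false t)%:C * c0 + (U l true t)%:C * c1 = 0)
    ->
  c0 = 0 /\ c1 = 0.
Proof.
case: c0 c1 => [x0 y0] [x1 y1] h.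
have [s1 u1 v1] := UV l false; have [s2 u2 v2] := UV l true.
have P0 : ae_itv a b (fun t => 0 < gauge_P t) by apply: ae_itv1 gauge_pos => t _
  [].
have free (x x' : R) : (forall t, t \in `[a, b] ->
  x * U l false t + x' * U l true t = 0) ->
    x = 0 /\ x' = 0.
  move=> hx; have := canonical_system_trivial ab P0 (canonical_systemD x x' leab
    s1 s2).
  rewrite u1 u2 v1 v2 /= !mulr0 !mulr1 addr0 add0r; apply.
  by apply: ae_itv0 => t /subset_itv_oo_cc; exact: hx.
have [-> ->] : x0 = 0 /\ x1 = 0.
  apply: free => t /h /eqP; rewrite eq_complex /= => /andP[/eqP e _].
  by move: e; lra.
have [-> ->] : y0 = 0 /\ y1 = 0.
  apply: free => t /h /eqP; rewrite eq_complex /= => /andP[_ /eqP e].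
  by move: e; lra.
by [].
Qed.

End gauge.
End Gauge.

(** * Multiplicity as the corank of a boundary matrix *)

Section Multiplicity.
Context {R : realType}.
Variables (a b : R) (p q r s : R -> R) (l : R) (f0 f1 : R -> R[i]).

Local Notation solution := (SL_solution a b p q r s l%:C).

Hypotheses (sol_repr : forall (y y1 : R -> R[i]) t, solution y y1 ->
  t \in `[a, b] ->
    y t = f0 t * y a + f1 t * y1 a)
  (sol_exists : forall c0 c1 : R[i], exists y y1 : R -> R[i],
    [/\ solution y y1, y a = c0 & y1 a = c1])
  (sol_free : forall c0 c1 : R[i],
    (forall t, t \in `[a, b] -> f0 t * c0 + f1 t * c1 = 0) -> c0 = 0 /\ c1 = 0).

Variables (B : @boundary_condition R) (E : 'M[R[i]]_2).
Hypothesis BE : forall y y1, solution y y1 ->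
  B (qvec y y1 a) (qvec y y1 b) <-> E *m qvec y y1 a = 0.

(** A solution is determined by its initial vector, so the initial vectors of a basis of the
    eigenspace, taken as the rows of [X], form a basis of the kernel of [E]. The transposes are
    there because [kermx] acts on rows. *)
Lemma multiplicity_rank m : has_multiplicity a b p q r s B l%:C m ->
  m = (2 - \rank E)%N.
Proof.
move=> [e [eE eF eS]].
have /choice[e1 e1P] : forall i, exists y1, solution (e i) y1 /\
    B (qvec (e i) y1 a) (qvec (e i) y1 b) by exact: eE.
pose X : 'M[R[i]]_(m, 2) := \matrix_(i, j) (if j == 0 then e i a else e1 i a).
have rowX i : row i X = (qvec (e i) (e1 i) a)^T.
  by apply/rowP => j; rewrite !mxE.
have X_free : row_free X.
  apply/inj_row_free => v vX; apply/rowP => i; rewrite mxE.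
  have v0 : \sum_i v 0 i * e i a = 0.
    have /rowP /(_ 0) := vX; rewrite !mxE; apply: etrans.
    by apply: eq_bigr => j _; rewrite mxE.
  have v1 : \sum_i v 0 i * e1 i a = 0.
    have /rowP /(_ 1) := vX; rewrite !mxE; apply: etrans.
    by apply: eq_bigr => j _; rewrite mxE.
  apply: (eF (fun i => v 0 i)) => t tab.
  rewrite (eq_bigr (fun i => f0 t * (v 0 i * e i a) + f1 t * (v 0 i * e1 i a))).
    by rewrite big_split /= -!mulr_sumr v0 v1 !mulr0 addr0.
  by move=> j _; rewrite (sol_repr (e1P j).1 tab); ring.
have XE : (X <= kermx E^T)%MS.
  apply/sub_kermxP/row_matrixP => i; rewrite row_mul rowX row0 -trmx_mul.
  by have [sol /(BE sol) ->] := e1P i; rewrite trmx0.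
have EX : (kermx E^T <= X)%MS.
  apply/row_subP => k.
  have : row k (kermx E^T) *m E^T = 0 by rewrite -row_mul mulmx_ker row0.
  move: (row k _) => w wE.
  have [y [y1 [sol ya y1a]]] := sol_exists (w 0 0) (w 0 1).
  have qw : qvec y y1 a = w^T.
    apply/colP => i; rewrite !mxE; case: i => -[|[|//]] ilt /=.
      by rewrite ya; congr (w _ _); exact: val_inj.
    by rewrite y1a; congr (w _ _); exact: val_inj.
  have [|c cP] := eS y.
    exists y1; split=> //; apply/BE => //.
    by rewrite qw -[E]trmxK -trmx_mul wE trmx0.
  have [/subr0_eq h0 /subr0_eq h1] :
      w 0 0 - \sum_i c i * e i a = 0 /\ w 0 1 - \sum_i c i * e1 i a = 0.
    apply: sol_free => t tab; have := cP t tab.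
    rewrite (sol_repr sol tab) ya y1a.
    rewrite (eq_bigr (fun i => f0 t * (c i * e i a) + f1 t * (c i * e1 i a)));
      last first.
      by move=> j _; rewrite (sol_repr (e1P j).1 tab); ring.
    by rewrite big_split /= -!mulr_sumr !mulrBr addrACA -opprD => ->;
      rewrite subrr.
  apply/submxP; exists (\row_i c i); apply/rowP => j; rewrite !mxE.
  under eq_bigr do rewrite !mxE.
  case: j => -[|[|//]] jlt /=.
    by rewrite -h0; congr (w _ _); exact: val_inj.
  by rewrite -h1; congr (w _ _); exact: val_inj.
have rXE : \rank X = \rank (kermx E^T) by apply/eqP; rewrite eqn_leq !mxrankS.
by rewrite -(eqP X_free) rXE mxrank_ker mxrank_tr.
Qed.

Lemma rank_eigenvalue : (\rank E < 2)%N -> is_eigenvalue a b p q r s B l%:C.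
Proof.
move=> rE.
have : kermx E^T != 0 by rewrite -mxrank_eq0 mxrank_ker mxrank_tr -lt0n
  subn_gt0.
move=> /rowV0Pn[w /sub_kermxP wE w0].
have [y [y1 [sol ya y1a]]] := sol_exists (w 0 0) (w 0 1).
have qw : qvec y y1 a = w^T.
  apply/colP => i; rewrite !mxE; case: i => -[|[|//]] ilt /=.
    by rewrite ya; congr (w _ _); exact: val_inj.
  by rewrite y1a; congr (w _ _); exact: val_inj.
exists y.
  exists y1; split=> //; apply/BE => //.
  by rewrite qw -[E]trmxK -trmx_mul wE trmx0.
apply: contrapT => nz; move: w0 => /negP; apply.
have [w00 w01] : w 0 0 = 0 /\ w 0 1 = 0.
  apply: sol_free => t tab; apply/eqP/negPn/negP => yt; apply: nz;
    exists t => //.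
  by rewrite (sol_repr sol tab) ya y1a.
apply/eqP/rowP => j; rewrite mxE; case: j => -[|[|//]] jlt.
  by rewrite -[RHS]w00; congr (w _ _); exact: val_inj.
by rewrite -[RHS]w01; congr (w _ _); exact: val_inj.
Qed.

End Multiplicity.

(** * Two by two matrices *)

Section Rank2.
Context {F : fieldType}.

Lemma det_mx2 (M : 'M[F]_2) : \det M = M 0 0 * M 1 1 - M 0 1 * M 1 0.
Proof.
rewrite (expand_det_row _ 0) !big_ord_recl big_ord0 addr0 /cofactor !det_mx11
  !mxE.
rewrite !lift0 /= expr0 expr1 mul1r mulN1r mulrN.
by congr (_ * M _ _ - M _ _ * M _ _); exact: val_inj.
Qed.

Lemma rank_mx2 (M : 'M[F]_2) : \rank M =
  if \det M != 0 then 2%N else if M == 0 then 0%N else 1%N.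
Proof.
case: ifPn => [dM|/negPn/eqP dM].
  by apply/eqP; rewrite -[_ == _]/(row_free M) row_free_unit unitmxE unitfE.
case: eqP => [->|/eqP M0]; first by rewrite mxrank0.
have : (\rank M < 2)%N.
  rewrite ltn_neqAle rank_leq_row andbT -[_ == _]/(row_free M) row_free_unit.
  by rewrite unitmxE unitfE dM eqxx.
by have := M0; rewrite -mxrank_eq0; case: (\rank M) => [|[|]].
Qed.

End Rank2.

Section Assembly.
Context {R : realType}.

Lemma enumerates_of_rank a b (p q r s : R -> R) B lam mult (E : R ->
  'M[R[i]]_2) :
  (forall l m, has_multiplicity a b p q r s B l%:C m ->
    m = (2 - \rank (E l))%N) ->
  (forall l, (\rank (E l) < 2)%N -> is_eigenvalue a b p q r s B l%:C) ->
  (forall l, mult l = (2 - \rank (E l))%N) ->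
  eigenvalue_sequence a b p q r s B lam -> enumerates lam mult.
Proof.
move=> mE eE mult_rank [homo cvg eig card]; split=> //.
  move=> x; rewrite mult_rank subn_gt0 => /eE/eig[n [xn]]; exists n.
  by rewrite xn.
by move=> n; have [m /mE ->] := card n; rewrite mult_rank.
Qed.

Definition mx2 (F : fieldType) (x y z w : F) : 'M[F]_2 :=
  \matrix_(i, j) if i == 0 then (if j == 0 then x else y)
                 else (if j == 0 then z else w).

Lemma ord2P (i : 'I_2) : i = 0 \/ i = 1.
Proof. by case: i => -[|[|//]] h; [left|right]; exact: val_inj. Qed.

Lemma det_mx2E (F : fieldType) (x y z w : F) : \det (mx2 x y z w) = x * w - y *
  z.
Proof. by rewrite det_mx2 !mxE. Qed.

Lemma mx2_eq0 (F : fieldType) (x y z w : F) :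
  (mx2 x y z w == 0) = [&& x == 0, y == 0, z == 0 & w == 0].
Proof.
apply/eqP/and4P => [/matrixP h|[/eqP-> /eqP-> /eqP-> /eqP->]].
  by have := (h 0 0, h 0 1, h 1 0, h 1 1); rewrite !mxE /= => -[[[->
    ->] ->] ->].
by apply/matrixP => i j; rewrite !mxE; do 2!case: ifP.
Qed.

Lemma mx2_mul_eq0 (F : fieldType) (x y z w : F) (Y : 'cV[F]_2) :
  mx2 x y z w *m Y = 0 <->
  x * Y 0 0 + y * Y 1 0 = 0 /\ z * Y 0 0 + w * Y 1 0 = 0.
Proof.
split=> [/colP h|[h0 h1]].
  have := (h 0, h 1); rewrite !mxE !big_ord_recl !big_ord0 !mxE /= !addr0.
  rewrite (_ : lift _ _ = 1 :> 'I_2) //; first by move=> [].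
  exact: val_inj.
apply/colP => i; rewrite !mxE !big_ord_recl !big_ord0 !mxE /= addr0.
rewrite (_ : lift _ _ = 1 :> 'I_2); last exact: val_inj.
by have [->|->] := ord2P i.
Qed.

Lemma cV2P (F : fieldType) (Y Z : 'cV[F]_2) :
  Y = Z <-> Y 0 0 = Z 0 0 /\ Y 1 0 = Z 1 0.
Proof.
split=> [->//|[h0 h1]]; apply/colP => i.
by have [->|->] := ord2P i.
Qed.

Lemma mulmx2E (F : fieldType) (K : 'M[F]_2) (Y : 'cV[F]_2) i :
  (K *m Y) i 0 = K i 0 * Y 0 0 + K i 1 * Y 1 0.
Proof.
rewrite !mxE !big_ord_recl !big_ord0 /= addr0.
by rewrite (_ : lift _ _ = 1 :> 'I_2)//; exact: val_inj.
Qed.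

(** With det N = 1 and z = e^(i g), det (N - z) = z (2 cos g - tr N). The kernel is two-dimensional
    only if N = z, and then z is real. *)
Lemma trace_mult_rank (n11 n12 n21 n22 : R -> R) (g x : R) :
  n11 x * n22 x - n12 x * n21 x = 1 ->
  trace_mult n11 n12 n21 n22 (2 * cos g) x =
  (2 - \rank (mx2 ((n11 x)%:C - (cos g +i* sin g)) (n12 x)%:C (n21 x)%:C
     ((n22 x)%:C - (cos g +i* sin g))))%N.
Proof.
move=> det1; rewrite /trace_mult rank_mx2 det_mx2E mx2_eq0 /trace.
have sc := cos2Dsin2 g.
set d := (X in if X != 0 then _ else _).
have dE : d = (cos g +i* sin g) * ((2 * cos g - (n11 x + n22 x))%:C).
  apply/eqP; rewrite /d eq_complex /=; apply/andP; split; apply/eqP; last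
    by ring.
  by move: det1 sc; rewrite !expr2; lra.
have z0 : cos g +i* sin g != 0.
  by apply/eqP => -[c0 s0]; move: sc; rewrite c0 s0 expr0n /= addr0 => /eqP;
    rewrite eq_sym oner_eq0.
rewrite {}dE mulf_eq0 (negbTE z0) /= eq_complex /= eqxx andbT subr_eq0 eq_sym.
case: eqP => //= trE.
rewrite !eq_complex /= !eqxx !andbT !sub0r !oppr_eq0 !subr_eq0.
case: (eqVneq (n12 x) 0) => [n12x|]; last by rewrite !andbF.
case: (eqVneq (n21 x) 0) => [n21x|]; last by rewrite !andbF.
rewrite /=.
have h : n11 x * n22 x = 1 by move: det1; rewrite n12x; lra.
have c1 : (cos g) ^+ 2 <= 1 by have := sqr_ge0 (sin g); move: sc; lra.
have e1 : n11 x = n22 x.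
  apply/eqP; rewrite -subr_eq0 -sqrf_eq0 eq_le sqr_ge0 andbT.
  have -> : (n11 x - n22 x) ^+ 2 = (n11 x + n22 x) ^+ 2 - 4 * (n11 x * n22 x)
    by ring.
  by rewrite -trE h; lra.
have e2 : n22 x = cos g by move: trE; rewrite e1; lra.
have s0 : sin g = 0.
  by apply/eqP; rewrite -sqrf_eq0; apply/eqP; move: sc h; rewrite e1 e2; lra.
by rewrite e1 e2 s0 !eqxx.
Qed.

End Assembly.

(** * From the boundary value problem to the curve *)

Section Reduction.
Context {R : realType}.

(** The hypothesis on [u] and [v] says that v - m u dominates u, so A u + B v has the sign of B, or
    of A if B = 0. The constant [C] exceeds - (A + B m), which keeps the inequality strict. *)
Lemma linear_form_gt0 (e m A B : R) : 0 < e -> 0 < B \/ B = 0 /\ 0 < A ->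
  exists2 eps, 0 < eps & forall u v, 0 < u / e -> u / e <=
    eps * (e * (v - m * u)) ->
    0 < A * u + B * v.
Proof.
move=> e0 [B0|[-> A0]]; last first.
  by exists 1 => // u v; rewrite pmulr_lgt0 ?invr_gt0// mul0r addr0 => u0 _;
    rewrite mulr_gt0.
pose C := `|A + B * m| + 1.
have C0 : 0 < C by have := normr_ge0 (A + B * m); rewrite /C; lra.
exists (B / (e ^+ 2 * C)); first by rewrite divr_gt0// mulr_gt0// exprn_gt0.
move=> u v; rewrite pmulr_lgt0 ?invr_gt0// => u0.
rewrite ler_pdivrMr// mulrAC -mulrA.
have -> : B / (e ^+ 2 * C) * (e * (e * (v - m * u))) = B * (v - m * u) / C.
  by field; rewrite !gt_eqF.
rewrite ler_pdivlMr// => h.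
have : - (A + B * m) <= `|A + B * m| by rewrite -normrN ler_norm.
by move: h; rewrite /C; nra.
Qed.

(** The hypotheses give x w > 1; conclude by the inequality of the arithmetic and geometric
    means. *)
Lemma trace_gt2 (x y z w : R) : 0 < x -> 0 < y -> 0 < z -> x * w - y * z = 1 ->
  2 < x + w.
Proof.
move=> x0 y0 z0 det1; have yz0 : 0 < y * z by exact: mulr_gt0.
have xw : x * w = 1 + y * z by lra.
have w0 : 0 < w by rewrite -(pmulr_rgt0 _ x0) xw; lra.
have := sqr_ge0 (x - w); nra.
Qed.

Variables (a b : R) (p q r s : R -> R) (K : 'M[R]_2).
Hypotheses (ab : a < b) (hpqrs : SL_coefficients a b p q r s) (hK : \det K = 1).

Let k11 := K 0 0.
Let k12 := K 0 1.
Let k21 := K 1 0.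
Let k22 := K 1 1.

Let detK : k11 * k22 - k12 * k21 = 1. Proof. by rewrite -hK det_mx2. Qed.

(* The entries of [K^-1 M(l)], where [M(l)] maps [Y(a)] to [Y(b)]. *)
Lemma sturm_liouville_reduction : exists n11 n12 n21 n22 : R -> R,
  [/\ rotating n11 n12 n21 n22,
      forall l m, has_multiplicity a b p q r s (bc_real K) l%:C m ->
        m = trace_mult n11 n12 n21 n22 2 l,
      forall g B lam, (forall Ya Yb, B Ya Yb <-> bc_complex g K Ya Yb) ->
        eigenvalue_sequence a b p q r s B lam ->
        enumerates lam (trace_mult n11 n12 n21 n22 (2 * cos g)),
      forall mu, eigenvalue_sequence a b p q r s (bc_mu K) mu ->
        enumerates mu (zero_mult n12) &
      forall nu, eigenvalue_sequence a b p q r s (bc_nu K) nu ->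
        enumerates nu (zero_mult n21)] /\
  (case_a K \/ case_b K -> exists l0, forall l, l <= l0 ->
    [/\ 2 < trace n11 n22 l, 0 < n12 l, case_a K -> 0 < n21 l &
        case_b K -> n21 l < 0]).
Proof.
have leab : a <= b := ltW ab.
have [[intp intq intr ints] pr0] := hpqrs.
have p0 : ae_itv a b (fun t => 0 < p t) by apply: ae_itv1 pr0 => t _ [].
have r0 : ae_itv a b (fun t => 0 < r t) by apply: ae_itv1 pr0 => t _ [].
have [S [pS Sa _]] := integrable_primitive leab ints.
have iP := integrable_gauge_P ab pS intp.
have iQ := integrable_gauge_Q ab pS intq.
have iW := integrable_gauge_Q ab pS intr.
have PW0 := gauge_pos S p0 r0.
have [U [V UV]] := fundamental_system ab iP iQ iW.
have bab : b \in `[a, b] by rewrite in_itv/= lexx leab.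
pose al := expR (- S b); pose be := expR (S b).
have al0 : 0 < al by exact: expR_gt0.
have be0 : 0 < be by exact: expR_gt0.
have albe : al * be = 1 by rewrite /al /be -expRD addNr expR0.
(* [n1] and [n2] are the rows of [N] and [i] names the column; the factors [al] and [be] undo the
   gauge at [b]. *)
pose n1 i l := k22 * al * U l i b - k12 * be * V l i b.
pose n2 i l := - k21 * al * U l i b + k11 * be * V l i b.
have wr l := fundamental_wronskian ab UV l bab.
have det1 l : n1 false l * n2 true l - n1 true l * n2 false l = 1.
  rewrite (_ : _ - _ = (k11 * k22 - k12 * k21) * (al * be) *
    (U l false b * V l true b - V l false b * U l true b)); last
      by rewrite /n1 /n2; ring.
  by rewrite detK albe wr !mulr1.
pose f0 l t : R[i] := (expR (- S t))%:C * (U l false t)%:C.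
pose f1 l t : R[i] := (expR (- S t))%:C * (U l true t)%:C.
have repr l (y y1 : R -> R[i]) t : SL_solution a b p q r s l%:C y y1 ->
    t \in `[a, b] -> y t = f0 l t * y a + f1 l t * y1 a.
  move=> sol tab; have [-> _] := SL_solution_repr ab pS Sa p0 UV sol tab.
  by rewrite /f0 /f1; ring.
have exist l := SL_solution_exists ab pS Sa p0 UV l.
have free l (c0 c1 : R[i]) : (forall t, t \in `[a, b] ->
  f0 l t * c0 + f1 l t * c1 = 0) ->
    c0 = 0 /\ c1 = 0.
  move=> h; apply: (fundamental_free ab p0 r0 UV (l := l)) => t /h.
  rewrite /f0 /f1 -!mulrA -mulrDr => /eqP; rewrite mulf_eq0 => /orP[|/eqP//].
  by rewrite eq_complex /= (gt_eqF (expR_gt0 _)).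
(* K^-1 Y(b) = N Y(a), row by row *)
have qb l (y y1 : R -> R[i]) : SL_solution a b p q r s l%:C y y1 ->
    k22%:C * y b - k12%:C * y1 b = (n1 false l)%:C * y a + (n1 true l)%:C * y1 a
      /\
    - k21%:C * y b + k11%:C * y1 b = (n2 false l)%:C * y a + (n2 true l)%:C * y1
      a.
  move=> sol; have [-> ->] := SL_solution_repr ab pS Sa p0 UV sol bab.
  rewrite /n1 /n2 -/al -/be; split.
    by rewrite !rmorphB !rmorphM /=; ring.
  by rewrite !rmorphD !rmorphM !rmorphN /=; ring.
have qvec0 (y y1 : R -> R[i]) t : qvec y y1 t 0 0 = y t by rewrite mxE.
have qvec1 (y y1 : R -> R[i]) t : qvec y y1 t 1 0 = y1 t by rewrite mxE.
have detC : k11%:C * k22%:C - k12%:C * k21%:C = 1 :> R[i].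
  by rewrite -!rmorphM -rmorphB detK.
pose Et g l : 'M[R[i]]_2 := mx2 ((n1 false l)%:C - (cos g +i* sin g)) (n1 true
  l)%:C
  (n2 false l)%:C ((n2 true l)%:C - (cos g +i* sin g)).
have kt g B : (forall Ya Yb, B Ya Yb <-> bc_complex g K Ya Yb) ->
    forall l (y y1 : R -> R[i]), SL_solution a b p q r s l%:C y y1 ->
    B (qvec y y1 a) (qvec y y1 b) <-> Et g l *m qvec y y1 a = 0.
  move=> BE l y y1 /qb[e1 e2]; rewrite BE /bc_complex cV2P mx2_mul_eq0.
  rewrite [X in _ = X /\ _]mxE [X in _ /\ _ = X]mxE !mulmx2E !mxE /= -/k11 -/k12
    -/k21 -/k22.
  set z := _ +i* _; rewrite !mulrBl.
  rewrite -addrA (addrC (- _)) addrA -e1 addrA -e2.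
  split=> [[-> ->]|[h1 h2]].
    split.
      rewrite (_ : _ - _ = (k11%:C * k22%:C - k12%:C * k21%:C) * (z * y a) - z *
        y a);
        last by ring.
      by rewrite detC mul1r subrr.
    rewrite (_ : _ - _ = (k11%:C * k22%:C - k12%:C * k21%:C) * (z * y1 a) - z *
      y1 a);
      last by ring.
    by rewrite detC mul1r subrr.
  move/subr0_eq: h1 => h1; move/subr0_eq: h2 => h2; split.
    rewrite mulrDr !(mulrCA z) -h1 -h2.
    rewrite [RHS](_ : _ = (k11%:C * k22%:C - k12%:C * k21%:C) * y b); last
      by ring.
    by rewrite detC mul1r.
  rewrite mulrDr !(mulrCA z) -h1 -h2.
  rewrite [RHS](_ : _ = (k11%:C * k22%:C - k12%:C * k21%:C) * y1 b); last
    by ring.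
  by rewrite detC mul1r.
have kmu l (y y1 : R -> R[i]) : SL_solution a b p q r s l%:C y y1 ->
    bc_mu K (qvec y y1 a) (qvec y y1 b) <->
    mx2 1 0 (n1 false l)%:C (n1 true l)%:C *m qvec y y1 a = 0.
  by move=> /qb[e1 _]; rewrite /bc_mu mx2_mul_eq0 !qvec0 !qvec1 e1 mul1r mul0r
    addr0.
have knu l (y y1 : R -> R[i]) : SL_solution a b p q r s l%:C y y1 ->
    bc_nu K (qvec y y1 a) (qvec y y1 b) <->
    mx2 0 1 (n2 false l)%:C (n2 true l)%:C *m qvec y y1 a = 0.
  move=> /qb[_ e2]; rewrite /bc_nu mx2_mul_eq0 !qvec0 !qvec1 mul1r mul0r add0r
    -e2.
  rewrite -/k21 -/k11.
  rewrite (_ : k21%:C * y b - k11%:C * y1 b = - (- k21%:C * y b + k11%:C * y1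
    b));
    last by ring.
  by split=> -[-> /eqP]; rewrite ?oppr_eq0 => /eqP h; split=> //; apply/eqP;
    rewrite ?oppr_eq0 h.
have mE B l m (E : 'M[R[i]]_2) : (forall y y1 : R ->
  R[i], SL_solution a b p q r s l%:C y y1 ->
    B (qvec y y1 a) (qvec y y1 b) <-> E *m qvec y y1 a = 0) ->
    has_multiplicity a b p q r s B l%:C m -> m = (2 - \rank E)%N.
  by move=> BE; exact: (multiplicity_rank (repr l) (exist l) (free l) BE).
have eE B l (E : 'M[R[i]]_2) : (forall y y1 : R ->
  R[i], SL_solution a b p q r s l%:C y y1 ->
    B (qvec y y1 a) (qvec y y1 b) <-> E *m qvec y y1 a = 0) ->
    (\rank E < 2)%N -> is_eigenvalue a b p q r s B l%:C.
  by move=> BE; exact: (rank_eigenvalue (repr l) (exist l) (free l) BE).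
have rmu l : zero_mult (n1 true) l =
    (2 - \rank (mx2 (1 : R[i]) 0 (n1 false l)%:C (n1 true l)%:C))%N.
  rewrite rank_mx2 det_mx2E mx2_eq0 oner_eq0 mul1r mul0r subr0 eq_complex /=
    eqxx andbT.
  by rewrite /zero_mult; case: eqP.
have rnu l : zero_mult (n2 false) l =
    (2 - \rank (mx2 (0 : R[i]) 1 (n2 false l)%:C (n2 true l)%:C))%N.
  rewrite rank_mx2 det_mx2E mx2_eq0 oner_eq0 andbF mul1r mul0r sub0r oppr_eq0.
  by rewrite eq_complex /= eqxx andbT /zero_mult; case: eqP.
have rt g l := @trace_mult_rank _ (n1 false) (n1 true) (n2 false) (n2 true) g l
  (det1 l).
exists (n1 false), (n1 true), (n2 false), (n2 true); split.
  split.
  - split=> // l; have [A [B [C [[A0 C0 BAC dU0 dU1] [dV0 dV1]]]]] :=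
      fundamental_derive ab iP iQ iW PW0 UV l.
    exists A, B, C; split=> //; rewrite /n1 /n2.
    have lc (f g : R -> R) (x y f' g' : R) : is_derive l 1 f f' ->
      is_derive l 1 g g' ->
        is_derive l 1 (fun l => x * f l + y * g l) (x * f' + y * g').
      move=> df dg; have := is_deriveD (is_deriveZ x df) (is_deriveZ y dg).
      exact.
    have sb (x y : R) i : (fun l => x * U l i b - y * V l i b) =
        (fun l => x * U l i b + (- y) * V l i b).
      by apply/funext => t; rewrite mulNr.
    split; rewrite ?sb.
    + by apply: (is_derive_eq (lc _ _ _ _ _ _ dU0 dV0)); ring.
    + by apply: (is_derive_eq (lc _ _ _ _ _ _ dU1 dV1)); ring.
    + by apply: (is_derive_eq (lc _ _ _ _ _ _ dU0 dV0)); ring.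
    + by apply: (is_derive_eq (lc _ _ _ _ _ _ dU1 dV1)); ring.
  - move=> l m; have bcE Ya Yb : bc_real K Ya Yb <-> bc_complex 0 K Ya Yb.
      by rewrite /bc_real /bc_complex cos0 sin0 scale1r.
    by move=> /(mE _ _ _ _ (kt 0 _ bcE l)) ->; rewrite -rt cos0 mulr1.
  - move=> g B lam BE; apply: enumerates_of_rank (rt g).
      by move=> l m; exact: mE (kt g B BE l).
    by move=> l; exact: eE (kt g B BE l).
  - move=> mu; apply: enumerates_of_rank rmu; first by move=> l m;
    exact: mE (kmu l).
    by move=> l; exact: eE (kmu l).
  - move=> nu; apply: enumerates_of_rank rnu; first by move=> l m;
    exact: mE (knu l).
    by move=> l; exact: eE (knu l).
move=> Kcase.
(* For very negative [l] this gives the sign of a linear form at [b] on the solutions starting at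
   (1, - kap) and at (0, 1). *)
have asym kap A B : 0 <= kap -> 0 < B \/ B = 0 /\ 0 < A -> exists l0, forall l,
    l <= l0 -> 0 < A * (U l false b - kap * U l true b) +
      B * (V l false b - kap * V l true b) /\ 0 < A * U l true b + B * V l true
        b.
  move=> kap0 AB.
  have [e e0 [m mP]] := fundamental_asymptotics ab iP iQ iW PW0 UV kap0.
  have [eps eps0 epsP] := linear_form_gt0 m e0 AB.
  have [l0 l0P] := mP eps eps0; exists l0 => l /l0P[h1 h2 h3 _ h4].
  by split; apply: epsP => //; exact: lt_le_trans h1.
(* The dominant coefficient of [n12] is - k12; if it vanishes, det K = 1 and k11 > 0 make k22
   positive. *)
have B1 : 0 < - (k12 * be) \/ - (k12 * be) = 0 /\ 0 < k22 * al.
  have k22pos : k12 = 0 -> 0 < k11 -> 0 < k22.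
    by move=> k120 k11p; move: detK; rewrite k120 mul0r subr0 => h;
      rewrite -(pmulr_rgt0 _ k11p) h.
  case: Kcase => -[c1 c2]; last by left; rewrite oppr_gt0 pmulr_llt0.
  move: c2; rewrite le_eqVlt => /predU1P[k120|k12n]; last first.
    by left; rewrite oppr_gt0 pmulr_llt0.
  by right; rewrite /k12 k120 mul0r oppr0; split=> //;
    rewrite mulr_gt0// k22pos.
(* In case (b) [k11] is not positive; a shear replaces it by k11 - kap k12, which this choice of
   [kap] makes equal to 1. *)
have [kap kap0 kapP] : exists2 kap, 0 <= kap & 0 < k11 - kap * k12.
  case: Kcase => -[c1 c2]; first by exists 0; rewrite ?mul0r ?subr0.
  have c2' : 0 < - k12 by rewrite oppr_gt0.
  have c1' : 0 <= 1 - k11 by move: c1; rewrite -/k11; lra.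
  exists ((1 - k11) / - k12); first by rewrite divr_ge0// ltW.
  have -> : (1 - k11) / - k12 * k12 = - (1 - k11) by field; rewrite lt_eqF.
  by lra.
have B2 : 0 < (k11 - kap * k12) * be \/ (k11 - kap * k12) * be = 0 /\
    0 < (kap * k22 - k21) * al by left; rewrite mulr_gt0.
have [l1 l1P] := asym _ _ _ kap0 B1; have [l2 l2P] := asym _ _ _ kap0 B2.
have [l3 l3P] : exists l3, forall l, l <= l3 ->
    (case_a K -> 0 < n2 false l) /\ (case_b K -> n2 false l < 0).
  case: Kcase => -[c1 c2].
    have Ba : 0 < k11 * be \/ k11 * be = 0 /\ 0 < - (k21 * al).
      by left; rewrite mulr_gt0.
    have [l3 l3P] := asym _ _ _ (lexx 0) Ba; exists l3 => l /l3P[h _]; split.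
      by move=> _; move: h; rewrite /n2 !mul0r !subr0 !mulNr.
    by move=> [c1' _]; move: c1; rewrite ltNge c1'.
  have Bb : 0 < - (k11 * be) \/ - (k11 * be) = 0 /\ 0 < k21 * al.
    move: c1; rewrite le_eqVlt => /predU1P[k110|k11n]; last first.
      by left; rewrite oppr_gt0 pmulr_llt0.
    right; rewrite /k11 k110 mul0r oppr0; split=> //; rewrite mulr_gt0//.
    have h : k12 * k21 = - 1 by move: detK; rewrite /k11 k110; lra.
    by rewrite -(nmulr_rlt0 _ (c2 : k12 < 0)) h oppr_lt0.
  have [l3 l3P] := asym _ _ _ (lexx 0) Bb; exists l3 => l /l3P[h _]; split.
    by move=> [c1' _]; move: c1'; rewrite ltNge c1.
  by move=> _; move: h; rewrite /n2 !mul0r !subr0; lra.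
exists (Num.min l1 (Num.min l2 l3)) => l.
rewrite !le_min => /and3P[/l1P[h1 h2] /l2P[h3 _] /l3P[h4 h5]].
have n12p : 0 < n1 true l by move: h2; rewrite /n1; lra.
split=> //.
have X0 : 0 < n1 false l - kap * n1 true l by move: h1; rewrite /n1; lra.
have Z0 : 0 < n2 false l - kap * n2 true l + kap * (n1 false l - kap * n1 true
  l).
  by move: h3; rewrite /n1 /n2; lra.
(* Conjugating [N] by the lower triangular shear with entry [- kap] preserves trace and determinant,
   and makes the first row and the lower left entry positive. *)
have -> : trace (n1 false) (n2 true) l =
    (n1 false l - kap * n1 true l) + (n2 true l + kap * n1 true l).
  by rewrite /trace; ring.
by apply: (trace_gt2 X0 n12p Z0); rewrite -[RHS](det1 l); ring.
Qed.

End Reduction.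

(** * The first level, and the theorem *)

Section Base.
Context {R : realType}.

Lemma cos_lt1 (g : R) : - pi < g < 0 \/ 0 < g < pi -> (2 * cos g) ^+ 2 < 4.
Proof.
move=> hg; have s2 : 0 < sin g ^+ 2.
  rewrite exprn_even_gt0//=; case: hg => [hg|/sin_gt0_pi/gt_eqF ->//].
  rewrite -oppr_eq0 -sinN gt_eqF// sin_gt0_pi//.
  by move: hg => /andP[? ?]; apply/andP; split; lra.
by have := cos2Dsin2 g; rewrite exprMn; lra.
Qed.

(** [d] counts the zeros of [n21] up to the first eigenvalue for [K]: one in case (a), none in case
    (b). That eigenvalue is simple because the trace exceeds 2 before it, which excludes N = 1. *)
Lemma level_base (I : Type) n11 n12 n21 n22 (c : I -> R) lamX lamY
    (lamG : I -> nat -> R) mu nu (l0 : R) :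
  rotating n11 n12 n21 n22 -> (forall i, c i ^+ 2 < 4) ->
  enumerates lamX (trace_mult n11 n12 n21 n22 2) ->
  enumerates lamY (trace_mult n11 n12 n21 n22 (- 2)) ->
  (forall i, enumerates (lamG i) (trace_mult n11 n12 n21 n22 (c i))) ->
  enumerates mu (zero_mult n12) -> enumerates nu (zero_mult n21) ->
  (forall l, l <= l0 -> 2 < trace n11 n22 l /\ 0 < n12 l) ->
  forall d : bool, (forall l, l <= l0 -> if d then 0 < n21 l else n21 l < 0) ->
  level_at n11 n12 n21 n22 lamX lamY lamG mu nu 0 d (lamX 0) /\
  trace_mult n11 n12 n21 n22 2 (lamX 0) = 1%N.
Proof.
move=> rot c4 eX eY eG emu enu low d sgn.
have trX : exists x, trace n11 n22 x = 2.
  by exists (lamX 0); have := enumerates_mult 0 eX; rewrite /trace_mult;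
    case: eqP.
have low1 t : t <= l0 -> 2 < trace n11 n22 t by move=> /low[].
have [x [[l0x trx above ex] [nsx n12x n21x n21x']]] :=
  first_exit rot low1 (low l0 (lexx l0)).2 trX.
have ge2 t : t <= x -> 2 <= trace n11 n22 t.
  by rewrite le_eqVlt => /predU1P[->|/above/ltW//]; rewrite trx.
have cl0 lam c' : enumerates lam (trace_mult n11 n12 n21 n22 c') -> c' < 2 ->
    counted lam x 0.
  move=> e c2; apply: (counted_zero e) => t /ge2; rewrite /trace_mult.
  by case: eqP => // ->; rewrite leNgt c2.
have n12t t : t <= x -> n12 t != 0.
  move=> tx; have [tl|/ltW lt] := leP t l0; first by rewrite gt_eqF//;
    exact: (low t tl).2.
  by apply: n12x; rewrite lt.
have mx : trace_mult n11 n12 n21 n22 2 x = 1%N.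
  rewrite /trace_mult trx eqxx; case: ifP => // /andP[/eqP ? /eqP ?].
  by exfalso; apply: nsx.
have cX0 : counted lamX l0 0.
  apply: (counted_zero eX) => t /low1; rewrite /trace_mult.
  by case: eqP => // ->; rewrite ltxx.
have mx0 : (0 < trace_mult n11 n12 n21 n22 2 x)%N by rewrite mx.
have [|cX lamX0] := counted_one eX cX0 l0x (lexx x) mx0.
  move=> t /andP[_ tx] ntx; rewrite /trace_mult; case: eqP => // trt; exfalso.
  have : t < x by rewrite lt_neqAle ntx.
  by move=> /above; rewrite trt ltxx.
rewrite mx add0n in cX lamX0; have {}lamX0 := lamX0 0%N isT.
rewrite lamX0; split=> //; split; split=> //.
- by apply: cl0 eY _; lra.
- by move=> i; apply: cl0 (eG i) _; have := c4 i; nra.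
- by apply: (counted_zero emu) => t /n12t; rewrite /zero_mult => /negbTE ->.
- have n21l := sgn l0 (lexx l0); case: d sgn n21l => sgn n21l; last first.
    apply: (counted_zero enu) => t tx; rewrite /zero_mult.
    have [tl|/ltW lt] := leP t l0; first by rewrite lt_eqF//; exact: sgn.
    by rewrite (negbTE (n21x n21l t _))// lt.
  have [s /andP[ls sx] [ns us]] := n21x' n21l.
  have c0 : counted nu l0 0.
    by apply: (counted_zero enu) => t tl; rewrite /zero_mult gt_eqF//;
      exact: sgn.
  have ms : zero_mult n21 s = 1%N by rewrite /zero_mult ns eqxx.
  have ms0 : (0 < zero_mult n21 s)%N by rewrite ms.
  have {}ls : l0 < s.
    by rewrite lt_neqAle ls andbT; apply/eqP => ls'; move: n21l;
      rewrite ls' ns ltxx.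
  have [|cs _] := counted_one enu c0 ls sx ms0; last by rewrite ms in cs.
  move=> t /andP[lt tx] ts; rewrite /zero_mult; case: eqP => // nt.
  by rewrite (us t) ?eqxx ?(ltW lt) in ts.
Qed.

End Base.

Theorem theorem4p1 (R : realType) (a b : R) (p q r s : R -> R)
    (hab : a < b) (hpqrs : SL_coefficients a b p q r s)
    (K : 'M[R]_2) (hK : \det K = 1)
    (lamK lamNK : nat -> R) (lamG : R -> nat -> R) (mu nu : nat -> R)
    (hlamK : eigenvalue_sequence a b p q r s (bc_real K) lamK)
    (hlamNK : eigenvalue_sequence a b p q r s (bc_real (- K)) lamNK)
    (hlamG : forall g : R, (- pi < g < 0 \/ 0 < g < pi) ->
       eigenvalue_sequence a b p q r s (bc_complex g K) (lamG g))
    (hmu : eigenvalue_sequence a b p q r s (bc_mu K) mu)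
    (hnu : eigenvalue_sequence a b p q r s (bc_nu K) nu) :
  [/\ (* (a) *)
      case_a K ->
      forall g : R, (- pi < g < 0 \/ 0 < g < pi) ->
      [/\ has_multiplicity a b p q r s (bc_real K) (lamK 0%N)%:C 1,
          nu 0%N <= lamK 0%N &
          forall m : nat, let n := m.*2 in
            (lamK n < lamG g n < lamNK n) /\
            (lamNK n <= mu n <= lamNK n.+1) /\
            (lamNK n <= nu n.+1 <= lamNK n.+1) /\
            (lamNK n.+1 < lamG g n.+1 < lamK n.+1) /\
            (lamK n.+1 <= mu n.+1 <= lamK n.+2) /\
            (lamK n.+1 <= nu n.+2 <= lamK n.+2)],
      (* (b) *)
      case_b K ->
      forall g : R, (- pi < g < 0 \/ 0 < g < pi) ->
      forall m : nat, let n := m.*2 in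
        (lamK n < lamG g n < lamNK n) /\
        (lamNK n <= mu n <= lamNK n.+1) /\
        (lamNK n <= nu n <= lamNK n.+1) /\
        (lamNK n.+1 < lamG g n.+1 < lamK n.+1) /\
        (lamK n.+1 <= mu n.+1 <= lamK n.+2) /\
        (lamK n.+1 <= nu n.+1 <= lamK n.+2),
      (* (c), in the cases treated by (a) and (b) *)
      case_a K \/ case_b K ->
      forall g1 g2 : R, 0 < g1 -> g1 < g2 -> g2 < pi ->
      forall m : nat, let n := m.*2 in
        lamG g1 n < lamG g2 n /\
        lamG g2 n < lamG g2 n.+1 /\
        lamG g2 n.+1 < lamG g1 n.+1 /\
        lamG g1 n.+1 < lamG g1 n.+2 &
      (* (d) *)
      ~ (case_a K \/ case_b K) -> case_a (- K) \/ case_b (- K)].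
Proof.
have [n11 [n12 [n21 [n22 [[rot mK tE muE nuE] low]]]]] :=
  sturm_liouville_reduction hab hpqrs hK.
(* The conditions for [K] and [- K] are the coupled ones with gamma = 0 and gamma = pi. *)
have eK : enumerates lamK (trace_mult n11 n12 n21 n22 2).
  have := tE 0 _ lamK _ hlamK; rewrite cos0 mulr1; apply => Ya Yb.
  by rewrite /bc_real /bc_complex cos0 sin0 scale1r.
have eNK : enumerates lamNK (trace_mult n11 n12 n21 n22 (- 2)).
  have := tE pi _ lamNK _ hlamNK; rewrite cospi mulrN1; apply => Ya Yb.
  rewrite /bc_real /bc_complex cospi sinpi.
  by rewrite (_ : -1 +i* 0 = -1) ?scaleN1r ?map_mxN ?mulNmx//; apply/eqP;
    rewrite eq_complex /= oppr0 !eqxx.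
(* All admissible gamma are carried along together, since (c) compares two of them on the same
   sweep. *)
pose I := {g : R | - pi < g < 0 \/ 0 < g < pi}.
pose c (i : I) := 2 * cos (sval i).
have c4 i : c i ^+ 2 < 4 by exact: cos_lt1 (svalP i).
pose G (i : I) := lamG (sval i).
have eG i : enumerates (G i) (trace_mult n11 n12 n21 n22 (c i)).
  exact: tE _ _ _ (fun Ya Yb => iff_refl _) (hlamG _ (svalP i)).
have emu := muE _ hmu; have enu := nuE _ hnu.
have levels : case_a K \/ case_b K -> exists d : bool,
    [/\ case_a K -> d, case_b K -> ~~ d,
        level_at n11 n12 n21 n22 lamK lamNK G mu nu 0 d (lamK 0%N) &
        trace_mult n11 n12 n21 n22 2 (lamK 0%N) = 1%N].
  move=> Kab; have [l0 l0P] := low Kab.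
  have base := level_base rot c4 eK eNK eG emu enu.
  have low12 l : l <= l0 -> 2 < trace n11 n22 l /\ 0 < n12 l by move=> /l0P[].
  case: (Kab) => Kc.
    exists true; have [|lev mlt] := base l0 low12 true.
      by move=> l /l0P[_ _ + _]; exact.
    by split=> //; move: Kc => [c1 _] [c2 _]; move: c1; rewrite ltNge c2.
  exists false; have [|lev mlt] := base l0 low12 false.
    by move=> l /l0P[_ _ _]; exact.
  by split=> //; move: Kc => [c1 _] [c2 _]; move: c2; rewrite ltNge c1.
have inter := level_interlaced c4 eK eNK eG emu enu.
split.
- move=> Ka g hg; have [d [/(_ Ka) + _ lev mlt]] := levels (or_introl Ka).
  case: d lev => // lev _.
  split.
  + have [_ _ _ /(_ 0%N)[m hm _]] := hlamK.
    by have := mK _ _ hm; rewrite mlt => m1; rewrite m1 in hm.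
  (* [nu 0] is the zero already counted at the first level. *)
  + by have [_ [_ _ _ _ cnu]] := lev; rewrite cnu.
  + move=> m n; have [[i1 i2 i3 _] [j1 j2 j3 _]] := inter _ _ lev m.
    rewrite !addn1 in i3 j3.
    have := i1 (exist _ g hg); have := j1 (exist _ g hg);
      rewrite /G /= => h1 h2.
    by do !split.
- move=> Kb g hg m n; have [d [_ /(_ Kb) + lev mlt]] := levels (or_intror Kb).
  case: d lev => // lev _.
  have [[i1 i2 i3 _] [j1 j2 j3 _]] := inter _ _ lev m.
  rewrite !addn0 in i3 j3.
  have := i1 (exist _ g hg); have := j1 (exist _ g hg); rewrite /G /= => h1 h2.
  by do !split.
- move=> Kab g1 g2 g10 g12 g2pi m n; have [d [_ _ lev _]] := levels Kab.
  have hg1 : - pi < g1 < 0 \/ 0 < g1 < pi by right; rewrite g10 (lt_trans g12).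
  have hg2 : - pi < g2 < 0 \/ 0 < g2 < pi by right; rewrite g2pi (lt_trans g10).
  (* As cos decreases, a falling trace meets the level of the smaller gamma first, a rising one that
     of the larger. *)
  have cos12 : cos g2 < cos g1.
    by rewrite ltr_cos// in_itv/= ?ltW// ?(lt_trans g10)// (lt_trans g12).
  have [[i1 i2 _ i4] [j1 j2 _ j4]] := inter _ _ lev m.
  have [[k1 _ _ _] _] := inter _ _ lev m.+1.
  rewrite doubleS in k1.
  have := i4 (exist _ g1 hg1) (exist _ g2 hg2);
    rewrite /c /= ltr_pM2l// => /(_ cos12).
  have := j4 (exist _ g2 hg2) (exist _ g1 hg1);
    rewrite /c /= ltrN2 ltr_pM2l// => /(_ cos12).
  have := (i1 (exist _ g2 hg2), j1 (exist _ g2 hg2)).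
  have := (j1 (exist _ g1 hg1), k1 (exist _ g1 hg1)).
  rewrite /G /= => -[/andP[_ a1] /andP[a2 _]] [/andP[_ a3] /andP[a4 _]] h1 h2.
  (* Terms of different sweeps are separated by a pair of eigenvalues for [- K], or for [K], with a
     [mu] between the two. *)
  move: i2 j2 => /andP[b1 b2] /andP[b3 b4].
  split=> //; split; first exact: lt_le_trans a3 (le_trans b1 (ltW (le_lt_trans
    b2 a4))).
  by split=> //; exact: lt_le_trans a1 (le_trans b3 (ltW (le_lt_trans b4 a2))).
- rewrite /case_a /case_b !mxE => nab.
  have det : K 0 0 * K 1 1 - K 0 1 * K 1 0 = 1 by rewrite -hK det_mx2.
  have [k11|k11|k11] := ltgtP (K 0 0) 0.
  + left; rewrite oppr_gt0 oppr_le0; split=> //.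
    by rewrite leNgt; apply/negP => k12; apply: nab; right; rewrite (ltW k11).
  + right; rewrite oppr_le0 oppr_lt0 (ltW k11); split=> //.
    by rewrite ltNge; apply/negP => k12; apply: nab; left.
  (* Here det K = 1 excludes k12 = 0. *)
  + right; rewrite k11 oppr0 oppr_lt0; split=> //.
    rewrite lt_neqAle; apply/andP; split.
      by apply/eqP => k12; move: det; rewrite k11 -k12 !mul0r subrr => /eqP;
        rewrite eq_sym oner_eq0.
    by rewrite leNgt; apply/negP => k12; apply: nab; right; rewrite k11.
Qed.
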